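(* Let $\alpha,\beta\in\{0,1\}$ and let $j,k$ be mutually prime integers with $a:=j/k\in(0,1/2]$ such that one of the following conditions holds: (I) $\alpha=\beta=0$; (II) $\alpha=0$, $\beta=1$ and $j$ is even; (III) $\alpha=1$, $\beta=0$ and $k+j$ is even; (IV) $\alpha=\beta=1$ and $k$ is even. Put $b=1/k$, let $q_0\in L(0,1)$ be complex-valued, and let $\Lambda$ be the spectrum of the problem $\mathcal L(q_0(x),a,\alpha,\beta)$. Define $X=(x_1,\dots,x_k)^T$ by $$x_\nu=\begin{cases}(-1)^{\nu-1}, & \alpha=\beta=0,\\ (-1)^{[\nu/2]}, & \alpha=0,\ \beta=1,\\ (-1)^{[(\nu-1)/2]}, & \alpha=1,\ \beta=0,\\ (-1)^{[\nu/2]}, & \alpha=\beta=1,\end{cases}\qquad \nu=1,\dots,k,$$ where $[\,\cdot\,]$ denotes the integer part. Let $\mathcal M_\Lambda$ be the set of all complex-valued $q\in L(0,1)$ for which the spectrum of $\mathcal L(q(x),a,\alpha,\beta)$ coincides with $\Lambda$. Then $$\mathcal M_\Lambda=\big\{\,q_0+R^{-1}(Xf)\;:\; f\in L(0,b)\,\big\},$$ where $R:L(0,1)\to(L(0,b))^k$ is the bijective operator defined in the context. That is, the function $q=q_0+R^{-1}(Xf)$ ranges over all of $\mathcal M_\Lambda$ as $f$ ranges over $L(0,b)$.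
   Context: $L(0,1)$ and $L(0,b)$ denote the spaces of complex-valued integrable functions. For $q\in L(0,1)$, $a\in[0,1]$, $\alpha,\beta\in\{0,1\}$, the boundary value problem $\mathcal L(q(x),a,\alpha,\beta)$ is $$-y''(x)+q(x)y(a)=\lambda y(x),\quad 0<x<1,\qquad y^{(\alpha)}(0)=y^{(\beta)}(1)=0,$$ where $\lambda$ is the spectral parameter. Let $C(x,\lambda)$ and $S(x,\lambda)$ be the solutions of the differential equation with $C(a,\lambda)=S'(a,\lambda)=1$, $S(a,\lambda)=C'(a,\lambda)=0$; explicitly, with $\rho^2=\lambda$, $$C(x,\lambda)=\cos\rho(x-a)+\int_a^x\frac{\sin\rho(x-t)}{\rho}q(t)\,dt,\qquad S(x,\lambda)=\frac{\sin\rho(x-a)}{\rho}.$$ The eigenvalues of the problem are the zeros of the entire characteristic function $$\Delta_{\alpha,\beta}(\lambda)=C^{(\alpha)}(0,\lambda)S^{(\beta)}(1,\lambda)-S^{(\alpha)}(0,\lambda)C^{(\beta)}(1,\lambda)$$ (derivatives in $x$), and the spectrum is the sequence $\{\lambda_n\}_{n\ge1}$ of these zeros counted with multiplicity. The operator $R:L(0,1)\to(L(0,b))^k$, $b=1/k$, is $Rf=(R_1f,\dots,R_kf)^T$, where for $x\in(0,b)$: $R_\nu f(x)=f((k-\nu)b+x)$ if $j+\nu$ is even and $R_\nu f(x)=f((k-\nu+1)b-x)$ if $j+\nu$ is odd, $\nu=1,\dots,k$. It is bijective; explicitly, for $F=(f_1,\dots,f_k)^T$ and $x\in((k-\nu)b,(k-\nu+1)b)$,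 $R^{-1}F(x)=f_\nu(x-(k-\nu)b)$ if $j+\nu$ is even and $R^{-1}F(x)=f_\nu((k-\nu+1)b-x)$ if $j+\nu$ is odd. Here $Xf$ denotes $(x_1f,\dots,x_kf)^T$. *)

(* Defs.v *)
From HB Require Import structures.
From mathcomp Require Import all_boot all_order all_algebra.
From mathcomp Require Import complex.
From mathcomp Require Import all_classical all_reals all_analysis.

Set Implicit Arguments.
Unset Strict Implicit.
Unset Printing Implicit Defensive.

Import Order.TTheory GRing.Theory Num.Theory.
Import numFieldNormedType.Exports.

Local Open Scope classical_set_scope.
Local Open Scope ring_scope.
Local Open Scope complex_scope.

Section ComplexCalculus.
Context {R : realType}.
Implicit Types (f g : R -> R[i]) (z : R[i]) (D : set R).

Local Notation mu := (@lebesgue_measure R).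

Definition cexp z : R[i] :=
  (expR (complex.Re z) * cos (complex.Im z)) +i*
  (expR (complex.Re z) * sin (complex.Im z)).

Definition ccos z : R[i] := (cexp ('i * z) + cexp (- ('i * z))) / 2%:R.

Definition csin z : R[i] := (cexp ('i * z) - cexp (- ('i * z))) / (2%:R * 'i).

Definition cintegrable D f : Prop :=
  mu.-integrable D (fun t => (complex.Re (f t))%:E) /\
  mu.-integrable D (fun t => (complex.Im (f t))%:E).

Definition cintegral D f : R[i] :=
  (\int[mu]_(t in D) complex.Re (f t)) +i* (\int[mu]_(t in D) complex.Im (f t)).

(* The n-th derivative of a complex-valued function of a real variable. *)
Definition cderive n f (x : R) : R[i] :=
  (derive1n n (fun t => complex.Re (f t)) x) +i*
  (derive1n n (fun t => complex.Im (f t)) x).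

(* Representatives of the elements of L(0,c).  Only their values on ]0,c[
   matter. *)
Definition L1 (c : R) : set (R -> R[i]) := [set f | cintegrable `]0, c[ f].

(* The element of L(0,c) represented by f: its class modulo a.e. equality. *)
Definition L1class (c : R) f : set (R -> R[i]) :=
  [set g | L1 c g /\ f = g %[ae mu in `]0, c[%classic]].

End ComplexCalculus.

Section FrozenArgument.
Context {R : realType}.
Implicit Types (q f : R -> R[i]) (a b x : R) (lam : R[i]) (alpha beta : nat).

(* The oriented integral of f over [a,x], where f is taken to vanish outside
   ]0,1[. *)
Definition oint01 a x f : R[i] :=
  if a <= x then cintegral (`]a, x[ `&` `]0, 1[) f
  else - cintegral (`]x, a[ `&` `]0, 1[) f.

(* sin(rho x) / rho and cos(rho x), where rho ^ 2 = lam.  Both are even in rho,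
   so the choice of the square root is immaterial; the first is x for rho = 0. *)
Definition sinrho lam x : R[i] :=
  let rho := sqrtC lam in
  if rho == 0 then x%:C else csin (rho * x%:C) / rho.

Definition cosrho lam x : R[i] := ccos (sqrtC lam * x%:C).

Definition Ssol a x lam : R[i] := sinrho lam (x - a).

(* As q is extended by 0 in oint01, this is a C^1 function of x on the whole
   line, whose derivatives at 0 and 1 are the one-sided derivatives of the
   solution on [0,1]. *)
Definition Csol q a x lam : R[i] :=
  cosrho lam (x - a) + oint01 a x (fun t => sinrho lam (x - t) * q t).

Definition Delta q a alpha beta lam : R[i] :=
  cderive alpha (fun x => Csol q a x lam) 0 *
    cderive beta (fun x => Ssol a x lam) 1 -
  cderive alpha (fun x => Ssol a x lam) 0 *
    cderive beta (fun x => Csol q a x lam) 1.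

(* The zeros of Delta counted with multiplicity: (lam, m) is in the spectrum
   iff m > 0 and lam is a zero of multiplicity at least m, that is, iff lam
   occurs at least m times in the sequence of the zeros.  Two functions have
   the same spectrum iff their sequences of zeros agree up to the order of the
   terms.  The derivatives are the complex ones. *)
Definition spectrum q a alpha beta : set (R[i] * nat) :=
  [set p | (0 < p.2)%N /\ forall i, (i < p.2)%N ->
     derive1n i (Delta q a alpha beta : R[i]^o -> R[i]^o) p.1 = 0].

Definition isospectral a alpha beta (Lambda : set (R[i] * nat)) :
    set (R -> R[i]) :=
  [set q | L1 1 q /\ spectrum q a alpha beta = Lambda].

Definition xsign alpha beta nu : R[i] :=
  match alpha, beta with
  | 0%N, 0%N => (-1) ^+ (nu - 1)
  | 0%N, _ => (-1) ^+ (nu %/ 2)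
  | _, 0%N => (-1) ^+ ((nu - 1) %/ 2)
  | _, _ => (-1) ^+ (nu %/ 2)
  end.

(* The components of vectors are indexed from 0: the component nu = i + 1 of
   the text is the one of index i. *)
Definition Xmul k alpha beta f : 'I_k -> R -> R[i] :=
  fun i x => xsign alpha beta i.+1 * f x.

(* The endpoint (k - nu) b, with b = 1 / k. *)
Definition node k nu : R := (k%:R - nu%:R) * (1 / k%:R).

Definition Rop j k q : 'I_k -> R -> R[i] := fun i x =>
  let nu := i.+1 in
  if odd (j + nu) then q (node k (nu - 1) - x) else q (node k nu + x).

(* The value at the k - 1 interior nodes is irrelevant (here 0). *)
Definition Rinv j k (F : 'I_k -> R -> R[i]) : R -> R[i] := fun x =>
  \sum_(i < k)
    let nu := i.+1 in
    if node k nu < x < node k (nu - 1) then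
      if odd (j + nu) then F i (node k (nu - 1) - x) else F i (x - node k nu)
    else 0.

Lemma node_lt k (i : 'I_k) x : 0 < x < 1 / k%:R ->
  node k i.+1 < node k i.+1 + x < node k i /\
  node k i.+1 < node k i - x < node k i.
Proof.
have -> : node k i = node k i.+1 + 1 / k%:R.
  rewrite /node; set c := 1 / _.
  by rewrite -natr1 opprD addrA [in RHS]mulrBl mul1r subrK.
by move=> /andP[x0 xb]; rewrite !ltrDl ltrD2l x0 xb -addrA ltrDl subr_gt0 xb
  ltrD2l ltrBlDr ltrDl x0.
Qed.

Lemma node_uniq k (i i' : 'I_k) x :
  node k i.+1 < x < node k i -> node k i'.+1 < x < node k i' -> i = i'.
Proof.
have k0 : 0 < 1 / k%:R :> R by rewrite divr_gt0 // ltr0n (leq_ltn_trans _ (ltn_ord i)).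
suff H (u v : 'I_k) : node k u.+1 < x -> x < node k v -> (v <= u)%N.
  move=> /andP[A B] /andP[A' B']; apply/val_inj/eqP.
  by rewrite eqn_leq (H _ _ A' B) (H _ _ A B').
move=> A B; have := lt_trans A B.
by rewrite /node ltr_pM2r // ltrD2l ltrN2 ltr_nat ltnS.
Qed.

(* Rop and Rinv are mutually inverse, away from the nodes. *)
Lemma RopK j k (F : 'I_k -> R -> R[i]) (i : 'I_k) x : 0 < x < 1 / k%:R ->
  Rop j (Rinv j F) i x = F i x.
Proof.
move=> xb; have [h1 h2] := node_lt i xb.
have E y : node k i.+1 < y < node k i -> Rinv j F y =
    if odd (j + i.+1) then F i (node k i - y) else F i (y - node k i.+1).
  move=> hy; rewrite /Rinv (bigD1 i) //= subn1 /= hy big1 ?addr0 // => i' ne.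
  rewrite subn1 /=; case: ifP => // hy'.
  by rewrite (node_uniq hy' hy) eqxx in ne.
rewrite /Rop /= subn1 /=; case: ifPn => o.
  by rewrite E // o subKr.
by rewrite E // (negbTE o) addrC addKr.
Qed.

Lemma RinvK j k q (i : 'I_k) x : node k i.+1 < x < node k i ->
  Rinv j (@Rop j k q) x = q x.
Proof.
move=> hx; rewrite /Rinv (bigD1 i) //= subn1 /= hx big1 ?addr0; last first.
  move=> i' ne; rewrite subn1 /=; case: ifP => // hx'.
  by rewrite (node_uniq hx' hx) eqxx in ne.
by rewrite /Rop subn1 /=; case: ifP => o; rewrite o ?subKr ?subrKC.
Qed.

End FrozenArgument.

Arguments Xmul {R} k alpha beta f.
Arguments Rop {R} j k q.

(* Main.v *)
Require Import Defs.
From HB Require Import structures.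
From mathcomp Require Import all_boot all_order all_algebra.
From mathcomp Require Import complex.
From mathcomp Require Import all_classical all_reals all_analysis.
From mathcomp Require Import measurable_realfun.
From mathcomp Require Import ring lra zify.

Set Implicit Arguments.
Unset Strict Implicit.
Unset Printing Implicit Defensive.

Import Order.TTheory GRing.Theory Num.Theory.
Import numFieldNormedType.Exports.

Local Open Scope classical_set_scope.
Local Open Scope ring_scope.
Local Open Scope complex_scope.

(** Write Delta_q for the characteristic function and p = q - q0. By the addition
    theorems for the sine and the cosine, and by product-to-sum formulas,
    Delta_q(lam) is, up to a sign, an explicit leading term plus half the integral
    over ]0,1[ of E(x, lam) w_q(x), where E is cos rho x, sin rho x / rho or
    (1 - cos rho x) / rho ^ 2, and the folded potential w_q is a signed sum of two
    reflections and two translations of q, extended by 0 ([Delta_folded]). The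
    map from q to w_q is linear, so everything amounts to two facts.

    First, q and q0 have the same spectrum iff w_p = 0 almost everywhere. If
    w_p = 0 the characteristic functions coincide ([folded_spectrum]). Conversely,
    both are entire, and their difference g vanishes at the zeros of
    f = Delta_q0 with at least the same multiplicity, so that g / f has no poles.
    On the images under lam = rho ^ 2 of the boundaries of suitable squares,
    arbitrarily large, f is of the order of its leading term and g is smaller by a
    factor of the order of 1 / |rho| ([boundary_small]). The maximum principle
    ([quotient_max]) gives g = 0. Then the coefficients of the power series g,
    which are the moments of w_p against x ^ (2 n + d) up to constant factors,
    vanish, whence w_p = 0 ([moments_ae0]). Entire functions are represented by
    their power series; the maximum principle rests on the division of a series by
    z - z0 ([pdiv]) and on the existence of n-th roots of complex numbers.

    Second, w_p = 0 means that p lies in R^{-1} (X L(0,b)). On each of the k cells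
    of length b the equation w_p = 0 relates the values of two components of R p
    at the same abscissa ([folded_cell]). Continued by reflection and
    translation to all integers n, the values H(n) of the components satisfy
    H(n + 2 j) = - e0 H(n) and H(n + 2 k) = e0 e1 H(n) with signs e0, e1; as j and
    k are coprime, H(n + 2) is then plus or minus H(n), and the reflection ties
    H(1) to H(0). This is the pattern X times the first component
    ([mirror_xsign]), and under the assumptions on the parities of j and k that
    pattern satisfies all the relations ([xsign_mirror]). *)

(** * Moduli and series of complex numbers *)
Section ComplexModulus.
Context {R : realType}.
Implicit Types (z w : R[i]) (x : R).

Definition cabs z : R := ComplexField.Normc.normc z.

Lemma cabsE z : `|z| = (cabs z)%:C. Proof. by []. Qed.

Lemma cabs_ge0 z : 0 <= cabs z.
Proof. by rewrite -lecR -cabsE normr_ge0. Qed.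

Lemma cabs0 : cabs 0 = 0. Proof. exact: ComplexField.Normc.normc0. Qed.

Lemma cabs1 : cabs 1 = 1. Proof. exact: ComplexField.Normc.normc1. Qed.

Lemma cabsM z w : cabs (z * w) = cabs z * cabs w.
Proof. exact: ComplexField.Normc.normcM. Qed.

Lemma cabsX z n : cabs (z ^+ n) = cabs z ^+ n.
Proof. by elim: n => [|n IH]; rewrite ?expr0 ?cabs1 // !exprS cabsM IH. Qed.

Lemma cabsV z : cabs z^-1 = (cabs z)^-1.
Proof. exact: ComplexField.Normc.normcV. Qed.

Lemma cabsN z : cabs (- z) = cabs z.
Proof. exact: normcN. Qed.

Lemma cabsD z w : cabs (z + w) <= cabs z + cabs w.
Proof. exact: le_normcD. Qed.

Lemma cabsB z w : cabs (z - w) <= cabs z + cabs w.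
Proof. by rewrite -(cabsN w) cabsD. Qed.

Lemma cabs_distC z w : cabs (z - w) = cabs (w - z).
Proof. by rewrite -cabsN opprB. Qed.

Lemma cabsB_ge z w : cabs z - cabs w <= cabs (z - w).
Proof. by rewrite lerBlDr -{1}(subrK w z) cabsD. Qed.

Lemma cabs_eq0 z : (cabs z == 0) = (z == 0).
Proof. by rewrite -(inj_eq (@complexI R)) -cabsE normr_eq0. Qed.

Lemma cabs_gt0 z : (0 < cabs z) = (z != 0).
Proof. by rewrite lt0r cabs_eq0 cabs_ge0 andbT. Qed.

Lemma cabs_real x : cabs x%:C = `|x|.
Proof. by rewrite /cabs /= expr0n addr0 sqrtr_sqr. Qed.

Lemma cabsi : cabs 'i = 1.
Proof. by rewrite /cabs /= expr0n expr1n add0r sqrtr1. Qed.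

Lemma cabs_Re z : `|complex.Re z| <= cabs z.
Proof. by rewrite -lecR -cabsE normc_ge_Re. Qed.

Lemma cabs_Im z : `|complex.Im z| <= cabs z.
Proof.
have -> : complex.Im z = complex.Re (- ('i * z)).
  by case: z => a b /=; rewrite mul0r mul1r sub0r opprK.
by rewrite (le_trans (cabs_Re _))// cabsN cabsM cabsi mul1r.
Qed.

Lemma cabs_le_ReIm z : cabs z <= `|complex.Re z| + `|complex.Im z|.
Proof.
rewrite {1}[z]complexE (le_trans (cabsD _ _))// cabsM !cabs_real.
by rewrite cabsi mul1r.
Qed.

Lemma sqr_cabs z : cabs z ^+ 2 = complex.Re z ^+ 2 + complex.Im z ^+ 2.
Proof. by case: z => a b; rewrite /cabs /= sqr_sqrtr// addr_ge0 ?sqr_ge0. Qed.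

(** Convergence in the topology of R[i] is convergence of the modulus of the
    difference, which lives in the ordered field R. *)
Lemma ccvgP (T : Type) (F : set_system T) (FF : Filter F) (u : T -> R[i]^o) (l : R[i]^o) :
  u t @[t --> F] --> l <-> cabs (u t - l) @[t --> F] --> (0 : R).
Proof.
split=> [h|h].
- apply/cvgr0Pnorm_lt => e e0.
  have e0' : 0 < e%:C by rewrite ltcR.
  move/cvgrPdist_lt: h => /(_ _ e0'); apply: filterS => t.
  by rewrite cabsE ltcR cabs_distC ger0_norm// cabs_ge0.
- apply/cvgrPdist_lt => e e0.
  have [e' ee'] : exists e', e = e'%:C.
    by case: e e0 => a b; rewrite ltcE /= => /andP[/eqP -> _]; exists a.
  move: e0; rewrite ee' ltcR => e0.
  move/cvgr0Pnorm_lt: h => /(_ _ e0); apply: filterS => t.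
  by rewrite cabsE ltcR cabs_distC ger0_norm// cabs_ge0.
Qed.

Lemma ccvg_ReIm (T : Type) (F : set_system T) (FF : Filter F) (u : T -> R[i]^o) (l : R[i]^o) :
  u t @[t --> F] --> l <->
  (complex.Re (u t) @[t --> F] --> complex.Re l) /\
  (complex.Im (u t) @[t --> F] --> complex.Im l).
Proof.
rewrite ccvgP; split=> [h|[h1 h2]].
- split; apply/cvgrPdist_lt => e e0.
  + move/cvgr0Pnorm_lt: h => /(_ _ e0); apply: filterS => t.
    rewrite (ger0_norm (cabs_ge0 _)) distrC; apply: le_lt_trans.
    by have := cabs_Re (u t - l); rewrite raddfB.
  + move/cvgr0Pnorm_lt: h => /(_ _ e0); apply: filterS => t.
    rewrite (ger0_norm (cabs_ge0 _)) distrC; apply: le_lt_trans.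
    by have := cabs_Im (u t - l); rewrite raddfB.
- apply/cvgr0Pnorm_lt => e e0.
  have e2 : 0 < e / 2 by rewrite divr_gt0.
  move/cvgrPdist_lt: h1 => /(_ _ e2) h1; move/cvgrPdist_lt: h2 => /(_ _ e2) h2.
  apply: filterS2 h1 h2 => t a b.
  rewrite (ger0_norm (cabs_ge0 _)) (le_lt_trans (cabs_le_ReIm _))//.
  by rewrite [e]splitr ltrD// raddfB/= distrC.
Qed.

Lemma cvg_cabs (u : nat -> R[i]^o) (l : R[i]^o) (e : nat -> R) :
  (forall n, cabs (u n - l) <= e n) -> e n @[n --> \oo] --> (0 : R) ->
  u n @[n --> \oo] --> l.
Proof.
move=> ue e0; apply/ccvgP; apply: (squeeze_cvgr _ (cvg_cst 0) e0).
by apply: nearW => n; rewrite cabs_ge0 ue.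
Qed.

End ComplexModulus.

(** Locked: conversion would otherwise unfold the limit in every comparison of
    algebraic expressions. *)
HB.lock Definition csum (R : realType) (u : nat -> R[i]) : R[i] :=
  xget (0 : R[i]^o) [set l : R[i]^o | (fun n => \sum_(i < n) u i : R[i]^o) @ \oo --> l].

Section ComplexSeries.
Context {R : realType}.
Implicit Types (z w : R[i]) (x M r : R) (n : nat).

Lemma cvg_halfpow M : M / 2 ^+ n @[n --> \oo] --> (0 : R).
Proof.
have -> : (fun n => M / 2 ^+ n) = geometric M 2^-1.
  by apply/funext => n; rewrite /geometric /= exprVn.
by apply: cvg_geometric; rewrite ger0_norm ?invr_ge0// invf_lt1 ?ltr1n.
Qed.

(** The partial sums minus or plus the tail bound 2 M / 2 ^ n are monotone and
    enclose the sum. *)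
Lemma real_series_half (u : nat -> R) M : (forall n, `|u n| <= M / 2 ^+ n) ->
  exists l, (\sum_(i < n) u i @[n --> \oo] --> l) /\
    forall n, `|l - \sum_(i < n) u i| <= 2 * M / 2 ^+ n.
Proof.
move=> hu.
pose v n := \sum_(i < n) u i.
pose a n := v n - 2 * M / 2 ^+ n.
pose b n := v n + 2 * M / 2 ^+ n.
have pow n : 2 * M / 2 ^+ n = M / 2 ^+ n + 2 * M / 2 ^+ n.+1.
  by rewrite exprS; field; rewrite ?expf_neq0.
have na : nondecreasing_seq a.
  apply/nondecreasing_seqP => n; rewrite /a /v big_ord_recr /= pow.
  have := hu n; rewrite ler_norml => /andP[h _]; lra.
have nb : nonincreasing_seq b.
  apply/nonincreasing_seqP => n; rewrite /b /v big_ord_recr /= [in leRHS]pow.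
  have := hu n; rewrite ler_norml => /andP[_ h]; lra.
have M0 : 0 <= M by have := hu 0%N; rewrite expr0 divr1; apply: le_trans.
have ab n : a n <= b n.
  by rewrite /a /b lerD2l ge0_cp// divr_ge0 ?mulr_ge0// exprn_ge0.
have ca : cvgn a.
  apply: nondecreasing_is_cvgn => //; exists (b 0%N) => _ [n _ <-].
  by rewrite (le_trans (ab n))// nb.
have cv : v n @[n --> \oo] --> limn a.
  have -> : v = a \+ (fun n => 2 * M / 2 ^+ n) by apply/funext => n /=; rewrite /a subrK.
  by rewrite -[limn a]addr0; apply: cvgD => //; apply: cvg_halfpow.
have ha n := nondecreasing_cvgn_le na ca n.
have hb n : limn a <= b n.
  have cb : b n @[n --> \oo] --> limn a.
    by rewrite -[limn a]addr0; apply: cvgD cv _; apply: cvg_halfpow.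
  rewrite -(cvg_lim _ cb)//; apply: nonincreasing_cvgn_ge => //.
  by apply/cvg_ex; exists (limn a).
move: (limn a) ha hb cv => l ha hb cv; exists l; split=> // n.
move: (ha n) (hb n); rewrite /a /b /v ler_norml => h1 h2.
by apply/andP; split; lra.
Qed.

Lemma csum_unique (u : nat -> R[i]) (l : R[i]^o) :
  (fun n => \sum_(i < n) u i : R[i]^o) @ \oo --> l -> csum u = l.
Proof.
move=> h; rewrite csum.unlock.
by apply: xget_unique => // l' h'; apply: cvg_unique h' h.
Qed.

Lemma csum_half (u : nat -> R[i]) M : (forall n, cabs (u n) <= M / 2 ^+ n) ->
  forall n, cabs (csum u - \sum_(i < n) u i) <= 4 * M / 2 ^+ n.
Proof.
move=> hu.
have [x [cx hx]] := @real_series_half (fun n => complex.Re (u n)) M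
  (fun n => le_trans (cabs_Re _) (hu n)).
have [y [cy hy]] := @real_series_half (fun n => complex.Im (u n)) M
  (fun n => le_trans (cabs_Im _) (hu n)).
have -> : csum u = x +i* y.
  apply: csum_unique; apply/ccvg_ReIm; split=> /=.
  - by under eq_fun do rewrite raddf_sum.
  - by under eq_fun do rewrite raddf_sum.
move=> n; rewrite (le_trans (cabs_le_ReIm _))//.
rewrite !raddfB !raddf_sum /=.
rewrite !sumrN; have := lerD (hx n) (hy n); lra.
Qed.

Lemma csum_cvg (u : nat -> R[i]) M : (forall n, cabs (u n) <= M / 2 ^+ n) ->
  (fun n => \sum_(i < n) u i : R[i]^o) @ \oo --> (csum u : R[i]^o).
Proof.
move=> hu; apply: (@cvg_cabs _ _ _ (fun n => 4 * M / 2 ^+ n)) => [n|].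
- by rewrite cabs_distC csum_half.
- exact: cvg_halfpow.
Qed.

Lemma csum_le (u : nat -> R[i]) M : (forall n, cabs (u n) <= M / 2 ^+ n) ->
  cabs (csum u) <= 4 * M.
Proof.
by move=> /csum_half /(_ 0%N); rewrite big_ord0 subr0 expr0 divr1.
Qed.

Lemma csum_recl (u : nat -> R[i]) M : (forall n, cabs (u n) <= M / 2 ^+ n) ->
  csum u = u 0%N + csum (fun n => u n.+1).
Proof.
move=> hu; apply: csum_unique.
have hu' n : cabs (u n.+1) <= (M / 2) / 2 ^+ n.
  by rewrite (le_trans (hu _))// exprS invfM mulrA.
rewrite -(@cvg_shiftS R[i]^o (fun n => \sum_(i < n) u i)).
under eq_fun do rewrite big_ord_recl /=.
by apply: cvgD; [exact: cvg_cst|exact: csum_cvg hu'].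
Qed.

End ComplexSeries.

(** * Entire power series *)
HB.lock Definition psum (R : realType) (c : nat -> R[i]) (z : R[i]) : R[i] :=
  csum (fun n => c n * z ^+ n).

Section EntireSeries.
Context {R : realType}.
Implicit Types (z w a b : R[i]) (x M r : R) (n m i : nat) (c d : nat -> R[i]).

(** The Cauchy bounds of all radii: they amount to an infinite radius of
    convergence. *)
Definition entire c := forall r, 0 < r -> exists M, forall n, cabs (c n) * r ^+ n <= M.

(** The radius r >= 2 |z| leaves a geometric factor 1 / 2 ^ n to spare. *)
Lemma entire_dom c z r M : 0 < r -> (forall n, cabs (c n) * r ^+ n <= M) ->
  2 * cabs z <= r -> forall n, cabs (c n * z ^+ n) <= M / 2 ^+ n.
Proof.
move=> r0 hM zr n; rewrite ler_pdivlMr ?exprn_gt0// cabsM cabsX -mulrA -exprMn.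
apply: le_trans (hM n); rewrite ler_wpM2l ?cabs_ge0//.
by rewrite lerXn2r ?nnegrE ?mulr_ge0 ?cabs_ge0 ?(ltW r0)// mulrC.
Qed.

Lemma entire_domE c z : entire c ->
  exists M, forall n, cabs (c n * z ^+ n) <= M / 2 ^+ n.
Proof.
have r0 : 0 < 2 * cabs z + 1 by rewrite ltr_wpDl ?mulr_ge0 ?cabs_ge0.
move=> /(_ _ r0)[M hM]; exists M; apply: entire_dom hM _ => //.
by rewrite lerDl.
Qed.

Lemma psum_cvg c z : entire c ->
  (fun n => \sum_(i < n) c i * z ^+ i : R[i]^o) @ \oo --> (psum c z : R[i]^o).
Proof. by rewrite psum.unlock; move=> /(entire_domE z)[M hM]; apply: csum_cvg hM. Qed.

Lemma psum_unique c z (l : R[i]^o) :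
  (fun n => \sum_(i < n) c i * z ^+ i : R[i]^o) @ \oo --> l -> psum c z = l.
Proof. by rewrite psum.unlock; exact: csum_unique. Qed.

Lemma psum_le c z r M : 0 < r -> (forall n, cabs (c n) * r ^+ n <= M) ->
  2 * cabs z <= r -> cabs (psum c z) <= 4 * M.
Proof. by rewrite psum.unlock => r0 hM zr; apply: csum_le; apply: entire_dom hM zr. Qed.

Lemma csumZ a (u : nat -> R[i]) M : (forall n, cabs (u n) <= M / 2 ^+ n) ->
  csum (fun n => a * u n) = a * csum u.
Proof.
move=> hu; apply: csum_unique; under eq_fun do rewrite -mulr_sumr.
by apply: cvgM; [exact: cvg_cst|exact: csum_cvg hu].
Qed.

Lemma entireL a b c d : entire c -> entire d -> entire (fun n => a * c n + b * d n).
Proof.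
move=> hc hd r r0; have [M hM] := hc r r0; have [M' hM'] := hd r r0.
exists (cabs a * M + cabs b * M') => n.
rewrite (le_trans (ler_wpM2r (exprn_ge0 _ (ltW r0)) (cabsD _ _)))//.
by rewrite mulrDl !cabsM -!mulrA lerD// ler_wpM2l ?cabs_ge0.
Qed.

Lemma psumL a b c d z : entire c -> entire d ->
  psum (fun n => a * c n + b * d n) z = a * psum c z + b * psum d z.
Proof.
move=> hc hd; apply: psum_unique.
under eq_fun do under eq_bigr do rewrite mulrDl -!mulrA.
under eq_fun do rewrite big_split -!mulr_sumr /=.
by apply: cvgD; (apply: cvgM; [exact: cvg_cst|exact: psum_cvg]).
Qed.

(** Multiplication of the sum by the linear factor z - z0. *)
Definition mulXB z0 c n := (if n is m.+1 then c m else 0) - z0 * c n.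

Lemma entireX c : entire c -> entire (fun n => if n is m.+1 then c m else 0).
Proof.
move=> hc r r0; have [M hM] := hc r r0; exists (M * r) => -[|n].
- rewrite cabs0 mul0r mulr_ge0 ?(ltW r0)//.
  by rewrite (le_trans _ (hM 0%N))// mulr_ge0 ?cabs_ge0.
- by rewrite exprSr mulrA ler_wpM2r ?(ltW r0).
Qed.

Lemma psumX c z : entire c ->
  psum (fun n => if n is m.+1 then c m else 0) z = z * psum c z.
Proof.
move=> hc; have [M hM] := entire_domE z hc.
have [M' hM'] := entire_domE z (entireX hc).
rewrite psum.unlock (csum_recl hM') mul0r add0r -(csumZ z hM); congr csum.
by apply/funext => n; rewrite exprS mulrCA.
Qed.

Lemma mulXBE z0 c :
  mulXB z0 c = (fun n => 1 * (if n is m.+1 then c m else 0) + (- z0) * c n).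
Proof. by apply/funext => n; rewrite /mulXB mul1r mulNr. Qed.

Lemma entire_mulXB z0 c : entire c -> entire (mulXB z0 c).
Proof. by move=> hc; rewrite mulXBE; apply/entireL/hc/entireX. Qed.

Lemma psum_mulXB z0 c z : entire c -> psum (mulXB z0 c) z = (z - z0) * psum c z.
Proof.
move=> hc; rewrite mulXBE psumL//; last exact: entireX.
by rewrite psumX// mul1r mulrBl mulNr.
Qed.

Lemma entire_iter_mulXB z0 c m : entire c -> entire (iter m (mulXB z0) c).
Proof. by move=> hc; elim: m => //= m; apply: entire_mulXB. Qed.

Lemma psum_iter_mulXB z0 c m z : entire c ->
  psum (iter m (mulXB z0) c) z = (z - z0) ^+ m * psum c z.
Proof.
move=> hc; elim: m => [|m IH]; first by rewrite expr0 mul1r.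
by rewrite iterS psum_mulXB ?IH ?exprS ?mulrA//; apply: entire_iter_mulXB.
Qed.

(** The coefficients of the quotient (f(z) - f(z0)) / (z - z0): since
    z ^ n - z0 ^ n = (z - z0) * sum of z ^ i * z0 ^ (n - 1 - i), that of z ^ i
    is the sum over j of c_(i+j+1) * z0 ^ j. *)
Definition pdiv z0 c i : R[i] := csum (fun j => c (i + j).+1 * z0 ^+ j).

Lemma pdiv_dom c z0 r M i : 0 < r -> (forall n, cabs (c n) * r ^+ n <= M) ->
  2 * cabs z0 <= r ->
  forall j, cabs (c (i + j).+1 * z0 ^+ j) <= (M / r ^+ i.+1) / 2 ^+ j.
Proof.
move=> r0 hM zr; apply: (entire_dom (r := r)) => // n.
rewrite ler_pdivlMr ?exprn_gt0// -mulrA -exprD.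
by have := hM (i + n).+1; rewrite addnS addnC.
Qed.

Lemma pdiv_bound c z0 r M : 0 < r -> (forall n, cabs (c n) * r ^+ n <= M) ->
  2 * cabs z0 <= r -> forall i, cabs (pdiv z0 c i) * r ^+ i <= 4 * M / r.
Proof.
move=> r0 hM zr i; rewrite -ler_pdivlMr ?exprn_gt0//.
have := csum_le (pdiv_dom i r0 hM zr).
by rewrite exprSr invfM !mulrA [X in _ <= X -> _]mulrAC.
Qed.

Lemma entire_pdiv z0 c : entire c -> entire (pdiv z0 c).
Proof.
move=> hc r r0.
have s0 : 0 < r + 2 * cabs z0 by rewrite ltr_pwDl// mulr_ge0 ?cabs_ge0.
have [M hM] := hc _ s0; exists (4 * M / (r + 2 * cabs z0)) => n.
have h : 2 * cabs z0 <= r + 2 * cabs z0 by rewrite lerDr ltW.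
apply: le_trans (pdiv_bound s0 hM h n).
rewrite ler_wpM2l ?cabs_ge0// lerXn2r ?nnegrE ?(ltW r0) ?(ltW s0)//.
by rewrite lerDl mulr_ge0 ?cabs_ge0.
Qed.

Lemma pdiv_rec c z0 i : entire c -> c i.+1 = pdiv z0 c i - z0 * pdiv z0 c i.+1.
Proof.
move=> hc.
have r0 : 0 < 2 * cabs z0 + 1 by rewrite ltr_wpDl ?mulr_ge0 ?cabs_ge0.
have [M hM] := hc _ r0.
have zr : 2 * cabs z0 <= 2 * cabs z0 + 1 by rewrite lerDl.
have dom k := @pdiv_dom c z0 _ M k r0 hM zr.
rewrite {1}/pdiv (csum_recl (dom _)).
rewrite addn0 expr0 mulr1 -(csumZ z0 (dom _)).
rewrite (_ : (fun n => _) = (fun n => z0 * (c (i.+1 + n).+1 * z0 ^+ n))) ?addrK//.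
by apply/funext => n; rewrite addnS addSn exprS mulrCA.
Qed.

Lemma pdiv_rec0 c z0 : entire c -> c 0%N = psum c z0 - z0 * pdiv z0 c 0.
Proof.
move=> hc.
have [M hM] := entire_domE z0 hc.
rewrite psum.unlock (csum_recl hM) expr0 mulr1.
have r0 : 0 < 2 * cabs z0 + 1 by rewrite ltr_wpDl ?mulr_ge0 ?cabs_ge0.
have [M' hM'] := hc _ r0.
rewrite -(csumZ z0 (pdiv_dom 0 r0 hM' _)); last by rewrite lerDl.
rewrite (_ : (fun n => _) = (fun n => z0 * (c (0 + n).+1 * z0 ^+ n))) ?addrK//.
by apply/funext => n; rewrite add0n exprS mulrCA.
Qed.

Lemma pdivK c z0 : entire c -> psum c z0 = 0 -> c = mulXB z0 (pdiv z0 c).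
Proof.
move=> hc c0; apply/funext => -[|n]; rewrite /mulXB; last exact: pdiv_rec.
by rewrite (pdiv_rec0 z0 hc) c0.
Qed.

Lemma psum_pdiv c z0 z : entire c ->
  psum c z = psum c z0 + (z - z0) * psum (pdiv z0 c) z.
Proof.
move=> hc; have hd := entire_pdiv z0 hc.
pose c0 n := if n is 0 then psum c z0 else 0.
have c00 n : (0 < n)%N -> c0 n = 0 by case: n.
have hc0 : entire c0.
  move=> r r0; exists (cabs (psum c z0)) => -[|n]; first by rewrite expr0 mulr1.
  by rewrite cabs0 mul0r cabs_ge0.
have e : c = (fun n => 1 * c0 n + 1 * mulXB z0 (pdiv z0 c) n).
  apply/funext => -[|n]; rewrite /mulXB !mul1r.
  - by rewrite {1}(pdiv_rec0 z0 hc) add0r.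
  - by rewrite /= add0r; exact: pdiv_rec.
have psum0 : psum c0 z = psum c z0.
  apply: psum_unique; rewrite -(@cvg_shiftS R[i]^o).
  rewrite (_ : [sequence _]_n = fun=> psum c z0 : R[i]^o); first exact: cvg_cst.
  apply/funext => n /=; rewrite big_ord_recl /= expr0 mulr1 big1 ?addr0// => i _.
  by rewrite mul0r.
rewrite {1}e psumL//; last exact: entire_mulXB.
by rewrite psum0 psum_mulXB// !mul1r.
Qed.

Lemma psum_iter_pdiv c z0 z : entire c ->
  (forall m, psum (iter m (pdiv z0) c) z0 = 0) ->
  forall m, psum c z = (z - z0) ^+ m * psum (iter m (pdiv z0) c) z.
Proof.
move=> hc h; elim=> [|m IH]; first by rewrite expr0 mul1r.
have hm : entire (iter m (pdiv z0) c) by elim: m {IH} => //= m; apply: entire_pdiv.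
by rewrite IH (psum_pdiv z0 z hm) h add0r /= exprSr mulrA.
Qed.

(** The quotients d_m by (z - z0) ^ m of a series with a zero of infinite order
    satisfy |d_m i| r ^ i <= M (4 / r) ^ m, so that f(z) = (z - z0) ^ m d_m(z)
    tends to 0 as soon as r > 8 |z - z0|; and r is arbitrary. *)
Lemma psum_flat c z0 : entire c ->
  (forall m, psum (iter m (pdiv z0) c) z0 = 0) -> forall z, psum c z = 0.
Proof.
move=> hc h z.
pose r := 8 * cabs (z - z0) + 2 * cabs z + 2 * cabs z0 + 1.
have p1 := cabs_ge0 z; have p2 := cabs_ge0 z0; have p3 := cabs_ge0 (z - z0).
have r0 : 0 < r by rewrite /r; lra.
have [M hM] := hc _ r0.
have bound m n : cabs (iter m (pdiv z0) c n) * r ^+ n <= M * (4 / r) ^+ m.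
  elim: m n => [|m IH] n; first by rewrite expr0 mulr1.
  have zr : 2 * cabs z0 <= r by rewrite /r; lra.
  rewrite (le_trans (pdiv_bound r0 IH zr n))// exprSr.
  by rewrite le_eqVlt; apply/orP; left; apply/eqP; field; rewrite gt_eqF.
have fle m : cabs (psum c z) <= 4 * M / 2 ^+ m.
  rewrite (psum_iter_pdiv z hc h m) cabsM cabsX.
  have zr : 2 * cabs z <= r by rewrite /r; lra.
  apply: (le_trans (ler_wpM2l (exprn_ge0 _ p3) (psum_le r0 (bound m) zr))).
  rewrite mulrCA -!mulrA ler_wpM2l// mulrCA ler_wpM2l//.
    by rewrite (le_trans _ (hM 0%N))// mulr_ge0 ?cabs_ge0.
  rewrite -exprMn -exprVn lerXn2r ?nnegrE ?mulr_ge0 ?invr_ge0 ?(ltW r0)//.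
  by rewrite mulrA ler_pdivrMr// /r; lra.
apply/eqP; rewrite -cabs_eq0 eq_le cabs_ge0 andbT.
rewrite -(cvg_lim _ (cvg_halfpow (4 * M)))//; apply: limr_ge.
  by apply/cvg_ex; exists 0; exact: cvg_halfpow.
by apply: nearW.
Qed.

Lemma entire_iter_pdiv c z0 m : entire c -> entire (iter m (pdiv z0) c).
Proof. by move=> hc; elim: m => //= m; apply: entire_pdiv. Qed.

(** A zero of infinite order is excluded by [psum_flat]. *)
Lemma psum_order c z0 : entire c -> (forall z, psum c z = 0) \/
  exists m d, [/\ entire d, psum d z0 != 0 & c = iter m (mulXB z0) d].
Proof.
move=> hc.
have [h|/existsNP[m]] := pselect (forall m, psum (iter m (pdiv z0) c) z0 = 0).
  by left; apply: psum_flat h.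
move=> /eqP h; right.
have ex : exists m, psum (iter m (pdiv z0) c) z0 != 0 by exists m.
case: (ex_minnP ex) => {h}m h mmin.
exists m, (iter m (pdiv z0) c); split=> //; first exact: entire_iter_pdiv.
suff H n : (n <= m)%N -> c = iter n (mulXB z0) (iter n (pdiv z0) c) by exact: H.
elim: n => [//|n IH nm]; rewrite iterSr iterS -pdivK; first exact: IH (ltnW nm).
  exact: entire_iter_pdiv.
by apply/eqP/negPn/negP => /mmin; rewrite leqNgt nm.
Qed.

(** ** Derivatives *)

Definition pder c n : R[i] := n.+1%:R * c n.+1.

Lemma entire_pder c : entire c -> entire (pder c).
Proof.
move=> hc r r0; have r20 : 0 < 2 * r by rewrite mulr_gt0.
have [M hM] := hc _ r20; exists (M / r) => n.
rewrite ler_pdivlMr// -mulrA -exprSr /pder cabsM.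
apply: le_trans (hM n.+1); rewrite exprMn mulrA ler_wpM2r ?exprn_ge0 ?(ltW r0)//.
rewrite mulrC ler_wpM2l ?cabs_ge0//.
have -> : cabs (n.+1%:R : R[i]) = n.+1%:R.
  by rewrite -(rmorph_nat (real_complex R)) cabs_real ger0_norm.
by rewrite -natrX ler_nat ltnW// ltn_expl.
Qed.

(** Summation by parts in c_(i+1) = d_i - z0 d_(i+1), where the boundary term
    n d_n z0 ^ n is O(n / 4 ^ n). *)
Lemma psum_pder c z0 : entire c -> psum (pder c) z0 = psum (pdiv z0 c) z0.
Proof.
move=> hc; have hd := entire_pdiv z0 hc; set d := pdiv z0 c.
apply: psum_unique.
have e n : \sum_(i < n) pder c i * z0 ^+ i =
    \sum_(i < n) d i * z0 ^+ i - n%:R * (d n * z0 ^+ n).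
  elim: n => [|n IH]; first by rewrite !big_ord0 mul0r subr0.
  rewrite !big_ord_recr /= IH /pder (pdiv_rec z0 n hc) -/d exprS -natr1.
  by ring.
under eq_fun do rewrite e.
rewrite -[psum d z0]subr0; apply: cvgB; first exact: psum_cvg.
have r0 : 0 < 4 * cabs z0 + 1 by rewrite ltr_wpDl ?mulr_ge0 ?cabs_ge0.
have [M hM] := hd _ r0.
apply: (@cvg_cabs _ _ _ (fun n => M / 2 ^+ n)); last exact: cvg_halfpow.
move=> n; rewrite subr0 ler_pdivlMr ?exprn_gt0// cabsM.
have -> : cabs (n%:R : R[i]) = n%:R.
  by rewrite -(rmorph_nat (real_complex R)) cabs_real ger0_norm.
apply: le_trans (hM n); rewrite cabsM cabsX mulrAC mulrCA ler_wpM2l ?cabs_ge0//.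
have h4 : cabs z0 <= (4 * cabs z0 + 1) / 4 by have := cabs_ge0 z0; lra.
have h4n : cabs z0 ^+ n <= (4 * cabs z0 + 1) ^+ n / 4 ^+ n.
  by rewrite -exprVn -exprMn lerXn2r ?nnegrE ?cabs_ge0 ?mulr_ge0 ?invr_ge0 ?(ltW r0).
rewrite (le_trans (ler_wpM2l _ h4n)) ?mulr_ge0 ?ler0n ?exprn_ge0//.
rewrite mulrCA ler_piMr ?exprn_ge0 ?(ltW r0)//.
rewrite ler_pdivrMr ?exprn_gt0// mul1r.
by rewrite -!natrX -natrM ler_nat (_ : 4 = 2 * 2)%N// expnMn leq_mul2r (ltnW (ltn_expl _ _))// orbT.
Qed.

Lemma psum_lipschitz c z0 : entire c ->
  exists K, forall z, cabs (z - z0) <= 1 ->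
    cabs (psum c z - psum c z0) <= K * cabs (z - z0).
Proof.
move=> hc.
have r0 : 0 < 2 * (cabs z0 + 1) by rewrite mulr_gt0// ltr_wpDl ?cabs_ge0.
have [M hM] := entire_pdiv z0 hc r0.
exists (4 * M) => z z1; rewrite (psum_pdiv z0 z hc) [X in cabs X]addrC addKr cabsM mulrC.
rewrite ler_wpM2r ?cabs_ge0//; apply: psum_le hM _ => //.
by rewrite ler_pM2l// -[z](subrK z0) (le_trans (cabsD _ _))// addrC lerD2l.
Qed.

Lemma psum_near c z0 : entire c ->
  forall e, 0 < e -> exists2 t, 0 < t & forall z, cabs (z - z0) <= t ->
    cabs (psum c z - psum c z0) <= e.
Proof.
move=> hc e e0; have [K hK] := psum_lipschitz z0 hc.
have K0 : 0 < `|K| + 1 by rewrite ltr_wpDl.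
exists (Num.min 1 (e / (`|K| + 1))); first by rewrite lt_min ltr01 divr_gt0.
move=> z; rewrite le_min => /andP[z1 z2]; rewrite (le_trans (hK _ z1))//.
rewrite (le_trans (ler_wpM2r (cabs_ge0 _) (_ : K <= `|K| + 1)))//.
  by rewrite (le_trans (ler_norm _))// lerDl.
by rewrite mulrC -ler_pdivlMr.
Qed.

(** The difference quotient at z0 is the value of the continuous function
    [psum (pdiv z0 c)] at z0 + h. *)
Lemma derive1_psum c : entire c ->
  derive1 (psum c : R[i]^o -> R[i]^o) = psum (pder c).
Proof.
move=> hc; apply/funext => z0; rewrite psum_pder//.
apply: cvg_lim => //; apply/ccvgP; apply/cvgr0Pnorm_le => e e0.
have [t t0 ht] := psum_near z0 (entire_pdiv z0 hc) e0.
have t0' : 0 < t%:C by rewrite ltcR.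
near=> h.
have h0 : h != 0 by near: h; exact: nbhs_dnbhs_neq.
rewrite (psum_pdiv z0 (h + z0) hc) addrAC subrr add0r addrK.
rewrite -[_ *: _]/(h^-1 * (h * _)) mulKf// ger0_norm ?cabs_ge0//.
apply: ht; rewrite addrK -lecR -cabsE.
near: h; exact: dnbhs0_le.
Unshelve. all: by end_near. Qed.

Lemma entire_iter_pder c n : entire c -> entire (iter n pder c).
Proof. by move=> hc; elim: n => //= n; apply: entire_pder. Qed.

Lemma derive1n_psum c n : entire c ->
  derive1n n (psum c : R[i]^o -> R[i]^o) = psum (iter n pder c).
Proof.
move=> hc; elim: n => //= n IH.
by rewrite IH derive1_psum//; apply: entire_iter_pder.
Qed.

End EntireSeries.

(** * Multiplicity of zeros *)
Section Multiplicity.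
Context {R : realType}.
Implicit Types (z w a b : R[i]) (n m i : nat) (c d : nat -> R[i]).

Lemma entireD c d : entire c -> entire d -> entire (fun n => c n + d n).
Proof.
move=> hc hd; have := entireL 1 1 hc hd.
by congr entire; apply/funext => n; rewrite !mul1r.
Qed.

Lemma psumD c d z : entire c -> entire d ->
  psum (fun n => c n + d n) z = psum c z + psum d z.
Proof.
move=> hc hd; have := psumL 1 1 z hc hd; rewrite !mul1r => <-.
by congr psum; apply/funext => n; rewrite !mul1r.
Qed.

Lemma iter_mulXBD z0 c d m : iter m (mulXB z0) (fun n => c n + d n) =
  fun n => iter m (mulXB z0) c n + iter m (mulXB z0) d n.
Proof.
elim: m => //= m ->; apply/funext => -[|n]; rewrite /mulXB; ring.
Qed.

Lemma pder_mulXB z0 c : pder (mulXB z0 c) = fun n => c n + mulXB z0 (pder c) n.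
Proof.
apply/funext => -[|n]; rewrite /pder /mulXB; first by ring.
by rewrite -(natr1 n.+1); ring.
Qed.

(** The product rule: the derivative of (z - z0) ^ (m + 1) d is (z - z0) ^ m e
    with e = (m + 1) d + (z - z0) d'. *)
Lemma pder_iter_mulXB z0 d m : entire d -> exists e, [/\ entire e,
  psum e z0 = m.+1%:R * psum d z0 &
  pder (iter m.+1 (mulXB z0) d) = iter m (mulXB z0) e].
Proof.
move=> hd; elim: m => [|m [e [he ez e_]]].
- exists (fun n => d n + mulXB z0 (pder d) n); rewrite pder_mulXB.
  have h : entire (mulXB z0 (pder d)) by apply/entire_mulXB/entire_pder.
  split=> //; first exact: entireD.
  by rewrite psumD// psum_mulXB ?subrr ?mul0r ?addr0 ?mul1r//; apply: entire_pder.
- exists (fun n => d n + e n); split; first exact: entireD.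
    by rewrite psumD// ez -(natr1 m.+1) mulrDl mul1r addrC.
  by rewrite iterS pder_mulXB e_ iter_mulXBD.
Qed.

Lemma pder_factor z0 d m : entire d ->
  (forall i, (i < m)%N -> psum (iter i pder (iter m (mulXB z0) d)) z0 = 0) /\
  psum (iter m pder (iter m (mulXB z0) d)) z0 = m`!%:R * psum d z0.
Proof.
elim: m d => [|m IH] d hd; first by rewrite mul1r.
have [e [he ez e_]] := pder_iter_mulXB z0 m hd.
have [h1 h2] := IH e he; split.
- case=> [_|i im]; last by rewrite iterSr e_ h1.
  by rewrite -[iter 0 _ _]/(iter m.+1 (mulXB z0) d) psum_iter_mulXB// subrr expr0n mul0r.
- by rewrite iterSr e_ h2 ez factS natrM mulrA (mulrC _ m.+1%:R).
Qed.

Lemma factor_of_pder z0 c m : entire c ->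
  (forall i, (i < m)%N -> psum (iter i pder c) z0 = 0) ->
  exists2 d, entire d & c = iter m (mulXB z0) d.
Proof.
move=> hc; elim: m => [|m IH] h; first by exists c.
have [d hd cd] := IH (fun i im => h i (ltnW im)).
have := h m (ltnSn m); rewrite cd (pder_factor z0 m hd).2 => /eqP.
rewrite mulf_eq0 pnatr_eq0 gtn_eqF ?fact_gt0//= => /eqP d0.
exists (pdiv z0 d); first exact: entire_pdiv.
by rewrite -iterS iterSr -pdivK.
Qed.

End Multiplicity.

(** * A maximum principle for quotients *)
Section MaximumPrinciple.
Context {R : realType}.
Implicit Types (z w a b : R[i]) (r e t : R) (n m i : nat) (f g c d u v : nat -> R[i]).

Lemma ratio_near u v z0 : entire u -> entire v -> psum v z0 != 0 ->
  forall e, 0 < e -> exists2 t, 0 < t & forall z, cabs (z - z0) <= t ->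
    psum v z != 0 /\ cabs (psum u z / psum v z - psum u z0 / psum v z0) <= e.
Proof.
move=> hu hv v0 e e0.
have a0 : 0 < cabs (psum v z0) by rewrite cabs_gt0.
have a2 : 0 < cabs (psum v z0) / 2 by rewrite divr_gt0.
have [t1 t10 h1] := psum_near z0 hv a2.
pose g n := psum v z0 * u n + (- psum u z0) * v n.
have hg : entire g by exact: entireL.
have e1 : 0 < e * (cabs (psum v z0) / 2 * cabs (psum v z0)) by rewrite !mulr_gt0.
have [t2 t20 h2] := psum_near z0 hg e1.
exists (Num.min t1 t2); first by rewrite lt_min t10.
move=> z; rewrite le_min => /andP[/h1 z1 /h2 z2].
have lb : cabs (psum v z0) / 2 <= cabs (psum v z).
  have := cabsB_ge (psum v z0) (psum v z); rewrite cabs_distC; lra.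
have vz : psum v z != 0 by rewrite -cabs_gt0 (lt_le_trans a2).
split=> //.
have -> : psum u z / psum v z - psum u z0 / psum v z0 =
    (psum g z - psum g z0) / (psum v z * psum v z0).
  by rewrite !psumL//; field; apply/andP.
rewrite cabsM cabsV ler_pdivrMr ?cabs_gt0 ?mulf_neq0// (le_trans z2)//.
by rewrite ler_wpM2l ?(ltW e0)// cabsM ler_wpM2r ?cabs_ge0.
Qed.

(** Compactness arguments take place in R * R. *)
Lemma continuous_plane (G : R[i] -> R) :
  (forall z0 e, 0 < e -> exists2 t, 0 < t &
     forall z, cabs (z - z0) <= t -> `|G z - G z0| <= e) ->
  continuous (fun p : R * R => G (p.1 +i* p.2)).
Proof.
move=> h [x0 y0]; apply/cvgrPdist_le => e e0.
have [t t0 ht] := h (x0 +i* y0) e e0.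
have t2 : 0 < t / 2 by rewrite divr_gt0.
exists ([set x | `|x0 - x| < t / 2], [set y | `|y0 - y| < t / 2]).
  by split=> /=; apply: nbhsx_ballx.
move=> [x y] [/= hx hy]; rewrite distrC; apply: ht.
rewrite (le_trans (cabs_le_ReIm _))//= [t]splitr.
by rewrite lerD// distrC ltW.
Qed.

(** For z = rho ^ 2 this is 2 max((Re rho) ^ 2, (Im rho) ^ 2), so that the curve
    gauge z = 2 r ^ 2 is the image of the boundary of the square
    |Re rho|, |Im rho| <= r. *)
Definition gauge z : R := cabs z + `|complex.Re z|.

Lemma gauge_near z0 e : 0 < e -> exists2 t, 0 < t &
  forall z, cabs (z - z0) <= t -> `|gauge z - gauge z0| <= e.
Proof.
move=> e0; exists (e / 2); rewrite ?divr_gt0// => z hz.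
have h1 : `|cabs z - cabs z0| <= cabs (z - z0).
  by rewrite ler_norml cabsB_ge lerNl opprB cabs_distC cabsB_ge.
have h2 : `|(`|complex.Re z| - `|complex.Re z0|)| <= cabs (z - z0).
  rewrite (le_trans (ler_dist_dist _ _))// ?raddfB.
  by have := cabs_Re (z - z0); rewrite raddfB.
rewrite /gauge opprD addrACA (le_trans (ler_normD _ _))//.
by rewrite [e]splitr lerD// (le_trans _ hz).
Qed.

Lemma cabs_near z0 e : 0 < e -> exists2 t, 0 < t &
  forall z, cabs (z - z0) <= t -> `|cabs z - cabs z0| <= e.
Proof.
move=> e0; exists e => // z; apply: le_trans.
by rewrite ler_norml cabsB_ge lerNl opprB cabs_distC cabsB_ge.
Qed.

Lemma gauge_compact r : compact [set p : R * R | gauge (p.1 +i* p.2) <= r].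
Proof.
apply: (subclosed_compact _ (compact_setX (@segment_compact R (- r) r) (@segment_compact R (- r) r))).
- apply: (@closed_comp _ _ _ [set x | x <= r]); last exact: closed_le.
  by move=> p _; apply: continuous_plane; apply: gauge_near.
- move=> [x y] /= h; have hc : cabs (x +i* y) <= r.
    by apply: le_trans h; rewrite lerDl.
  by split; rewrite /= in_itv /= -ler_norml (le_trans _ hc)//;
    [exact: (cabs_Re (x +i* y))|exact: (cabs_Im (x +i* y))].
Qed.

(** A quotient that is locally one of entire series has a maximum modulus on a
    compact set; among the points where it is attained, the one of the largest
    modulus cannot be interior. *)
Lemma quotient_max (h : R[i] -> R[i]) r e : 0 <= e ->
  (forall z0, exists u v, [/\ entire u, entire v, psum v z0 != 0 &
     exists2 t, 0 < t & forall z, cabs (z - z0) <= t -> h z = psum u z / psum v z]) ->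
  (forall z, gauge z = r -> cabs (h z) <= e) ->
  forall z, gauge z <= r -> cabs (h z) <= e.
Proof.
move=> e0 hloc hbd z1 z1r.
have hnear z0 e' : 0 < e' -> exists2 t, 0 < t &
    forall z, cabs (z - z0) <= t -> `|cabs (h z) - cabs (h z0)| <= e'.
  move=> e'0; have [u [v [hu hv v0 [t t0 ht]]]] := hloc z0.
  have [t' t'0 ht'] := ratio_near hu hv v0 e'0.
  exists (Num.min t t'); first by rewrite lt_min t0.
  move=> z; rewrite le_min => /andP[/ht hz /ht' [_]].
  rewrite hz (ht z0) ?subrr ?cabs0 ?(ltW t0)//; apply: le_trans.
  by rewrite ler_norml cabsB_ge lerNl opprB cabs_distC cabsB_ge.
have hcont := continuous_plane hnear.
pose K := [set p : R * R | gauge (p.1 +i* p.2) <= r].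
have K0 : K !=set0 by exists (complex.Re z1, complex.Im z1); case: z1 z1r.
have [p /set_mem pK pmax] := compact_EVT_max K0 (@gauge_compact r)
  (continuous_subspaceT hcont).
pose M := cabs (h (p.1 +i* p.2)).
have hM z : gauge z <= r -> cabs (h z) <= M.
  by case: z => x y hz; apply: (pmax (x, y)); rewrite inE.
suff Me : M <= e by rewrite (le_trans (hM _ z1r)).
pose K1 := K `&` [set p | M <= cabs (h (p.1 +i* p.2))].
have K1c : compact K1.
  apply: compact_closedI; first exact: gauge_compact.
  apply: (@closed_comp _ _ _ [set x | M <= x]); last exact: closed_ge.
  by move=> q _; apply: hcont.
have K10 : K1 !=set0 by exists p; split=> //=.
have [[x0 y0] /set_mem[q0K qM] qmax] := compact_EVT_max K10 K1c
  (continuous_subspaceT (continuous_plane cabs_near)).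
pose z0 := x0 +i* y0; rewrite -[x0 +i* y0]/z0 /= in qM qmax.
have z0r : gauge z0 <= r by [].
have z0max z : gauge z <= r -> M <= cabs (h z) -> cabs z <= cabs z0.
  by case: z => x y hz hMz; apply: (qmax (x, y)); rewrite inE.
have [z0eq|z0neq] := eqVneq (gauge z0) r; first by rewrite (le_trans qM)// hbd.
have z0lt : 0 < r - gauge z0 by rewrite subr_gt0 lt_neqAle z0neq.
have [t1 t10 ht1] := gauge_near z0 z0lt.
have inK z : cabs (z - z0) <= t1 -> gauge z <= r.
  by move=> /ht1; rewrite ler_norml => /andP[_]; lra.
have hz0 : cabs (h z0) = M by apply/eqP; rewrite eq_le qM hM.
have [->//|M0] := eqVneq M 0.
have c0 : h z0 != 0 by rewrite -cabs_eq0 hz0.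
have [u [v [hu hv v0 [t2 t20 ht2]]]] := hloc z0.
have hz0E : h z0 = psum u z0 / psum v z0 by rewrite ht2// subrr cabs0 ltW.
pose g n := 1 * u n + (- h z0) * v n.
have hg : entire g by exact: entireL.
have gE z : psum g z = psum u z - h z0 * psum v z by rewrite psumL// mul1r mulNr.
have g0 : psum g z0 = 0 by rewrite gE hz0E divfK ?subrr.
have [t3 t30 ht3] := ratio_near hu hv v0 ltr01.
exfalso.
have [gz|[m [d [hd d0 gd]]]] := psum_order z0 hg.
- (* the quotient is constant near z0: move away from the origin *)
  pose t := Num.min t1 (Num.min t2 t3).
  have t0 : 0 < t by rewrite !lt_min t10 t20.
  pose a := if z0 == 0 then 1 else z0 / (cabs z0)%:C.
  have a1 : cabs a = 1.
    rewrite /a; case: eqVneq => [_|z00]; first exact: cabs1.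
    by rewrite cabsM cabsV cabs_real ger0_norm ?cabs_ge0// mulfV// cabs_eq0.
  have z0a : z0 = (cabs z0)%:C * a.
    rewrite /a; case: eqVneq => [->|z00]; first by rewrite cabs0 mul0r.
    by rewrite mulrC divfK// -[0]/(0%:C) (inj_eq (@complexI R)) cabs_eq0.
  pose z := z0 + t%:C * a.
  have zt : cabs (z - z0) <= t.
    by rewrite /z addrC addKr cabsM a1 mulr1 cabs_real ger0_norm ?(ltW t0).
  move: (zt); rewrite !le_min => /and3P[zt1 zt2 zt3].
  have [vz _] := ht3 _ zt3.
  have hz : h z = h z0.
    rewrite (ht2 _ zt2); move/eqP: (gz z); rewrite gE subr_eq0 => /eqP ->.
    by rewrite mulfK.
  have := z0max z (inK _ zt1); rewrite hz hz0 lexx => /(_ isT).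
  rewrite /z {1}z0a -mulrDl cabsM a1 mulr1 -rmorphD cabs_real.
  by rewrite ger0_norm ?addr_ge0 ?cabs_ge0 ?(ltW t0)// gerDl leNgt t0.
- (* move in a direction in which the first non-constant term is a positive
     multiple of the value *)
  have m0 : (0 < m)%N.
    by case: m gd g0 => // ->/= /eqP; rewrite (negbTE d0).
  pose q0 := psum d z0 / psum v z0.
  have q00 : q0 != 0 by rewrite mulf_neq0 ?invr_eq0.
  pose a := m.-root (h z0 / q0).
  have am : a ^+ m = h z0 / q0 by rewrite /a rootCK.
  have a0 : a != 0.
    apply: contra_neq (mulf_neq0 c0 (invr_neq0 q00)) => a0.
    by rewrite -am a0 expr0n gtn_eqF.
  have ca0 : 0 < cabs a by rewrite cabs_gt0.
  have q02 : 0 < cabs q0 / 2 by rewrite divr_gt0// cabs_gt0.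
  have [t4 t40 ht4] := ratio_near hd hv v0 q02.
  pose t := Num.min t1 (Num.min t2 t4).
  have t0 : 0 < t by rewrite !lt_min t10 t20.
  pose s := t / cabs a.
  have s0 : 0 < s by rewrite divr_gt0.
  pose z := z0 + s%:C * a.
  have zt : cabs (z - z0) <= t.
    rewrite /z addrC addKr cabsM cabs_real ger0_norm ?(ltW s0)//.
    by rewrite /s divfK ?gt_eqF.
  move: (zt); rewrite !le_min => /and3P[zt1 zt2 zt4].
  have [vz qz] := ht4 _ zt4.
  have hz : h z = h z0 * (1 + s%:C ^+ m) +
      s%:C ^+ m * (h z0 / q0) * (psum d z / psum v z - q0).
    rewrite (ht2 _ zt2).
    have -> : psum u z = h z0 * psum v z + (s%:C * a) ^+ m * psum d z.
      have := gE z; rewrite gd psum_iter_mulXB// {1}/z addrC addKr => ->.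
      by rewrite addrC subrK.
    by rewrite exprMn am; field; rewrite q00 vz.
  have M1 : 0 < M by rewrite lt0r M0 -hz0 cabs_ge0.
  have sm : 0 < s ^+ m by rewrite exprn_gt0.
  have := hM z (inK _ zt1); rewrite leNgt => /negP; apply.
  have lb := cabsB_ge (h z0 * (1 + s%:C ^+ m))
    (- (s%:C ^+ m * (h z0 / q0) * (psum d z / psum v z - q0))).
  rewrite opprK -hz cabsN in lb.
  apply: lt_le_trans lb.
  rewrite !cabsM cabsX cabs_real cabsV hz0.
  have -> : cabs (1 + s%:C ^+ m) = 1 + s ^+ m.
    by rewrite -rmorphXn -[1]/(1%:C) -rmorphD cabs_real ger0_norm// addr_ge0 ?ltW.
  rewrite (ger0_norm (ltW s0)).
  have : s ^+ m * (M / cabs q0) * cabs (psum d z / psum v z - q0) <=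
      s ^+ m * (M / cabs q0) * (cabs q0 / 2).
    by rewrite ler_wpM2l// mulr_ge0 ?divr_ge0 ?cabs_ge0 ?ltW.
  have -> : s ^+ m * (M / cabs q0) * (cabs q0 / 2) = s ^+ m * M / 2.
    by field; rewrite cabs_eq0.
  have := mulr_gt0 sm M1; lra.
Qed.

Definition zeros_include f g := forall z0 m,
  (forall i, (i < m)%N -> derive1n i (psum f : R[i]^o -> R[i]^o) z0 = 0) ->
  (forall i, (i < m)%N -> derive1n i (psum g : R[i]^o -> R[i]^o) z0 = 0).

(** Both series are divisible by (z - z0) ^ m, where m is the multiplicity of
    the zero z0 of the first one. *)
Lemma common_factor f g z1 : entire f -> entire g -> psum f z1 != 0 ->
  zeros_include f g -> forall z0, exists p : nat * (nat -> R[i]) * (nat -> R[i]),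
  [/\ entire p.1.2, entire p.2, psum p.2 z0 != 0,
      f = iter p.1.1 (mulXB z0) p.2 & g = iter p.1.1 (mulXB z0) p.1.2].
Proof.
move=> hf hg f1 hfg z0; have [f0|[m [v [hv v0 fv]]]] := psum_order z0 hf.
  by rewrite f0 eqxx in f1.
suff [u hu gu] : exists2 u, entire u & g = iter m (mulXB z0) u.
  by exists (m, u, v).
apply: factor_of_pder => // i im; rewrite -derive1n_psum//.
apply: (hfg z0 m) => // j jm; rewrite derive1n_psum// fv.
by apply: (pder_factor z0 m hv).1.
Qed.

(** If g vanishes wherever f does, with at least the same multiplicity, then
    g / f extends to an entire function and the maximum principle applies. *)
Lemma entire_domination f g r e z1 : entire f -> entire g -> psum f z1 != 0 ->
  zeros_include f g -> 0 <= e ->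
  (forall z, gauge z = r -> psum f z != 0 /\ cabs (psum g z) <= e * cabs (psum f z)) ->
  forall z, gauge z <= r -> cabs (psum g z) <= e * cabs (psum f z).
Proof.
move=> hf hg f1 hfg e0 hbd.
have [p hp] := choice (common_factor hf hg f1 hfg).
pose h z := psum (p z).1.2 z / psum (p z).2 z.
have hE z : psum g z = h z * psum f z.
  have [hu hv v0 fv gu] := hp z.
  rewrite {1}gu {1}fv !psum_iter_mulXB// /h.
  by rewrite [RHS]mulrCA divfK.
have hfE z : psum f z != 0 -> h z = psum g z / psum f z.
  by move=> fz; rewrite hE mulfK.
suff H : forall z, gauge z <= r -> cabs (h z) <= e.
  by move=> z zr; rewrite hE cabsM ler_wpM2r ?cabs_ge0// H.
apply: quotient_max => // [z0|z'].
- have [hu hv v0 fv gu] := hp z0.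
  exists (p z0).1.2, (p z0).2; split=> //.
  have [t t0 ht] := ratio_near hu hv v0 ltr01.
  exists t => // z /ht[vz _].
  have [->//|zz0] := eqVneq z z0.
  have zn : (z - z0) ^+ (p z0).1.1 != 0 by rewrite expf_neq0// subr_eq0.
  have fz : psum f z != 0 by rewrite fv psum_iter_mulXB// mulf_neq0.
  rewrite hfE// {1}gu fv !psum_iter_mulXB//.
  by rewrite -mulf_div mulfV// mul1r.
- by move=> /hbd[fz]; rewrite hfE// cabsM cabsV ler_pdivrMr ?cabs_gt0.
Qed.

(** By [entire_domination], |g(z)| <= e |f(z)| for every e > 0 at a given z. *)
Lemma entire_domination0 f g z1 : entire f -> entire g -> psum f z1 != 0 ->
  zeros_include f g ->
  (forall e r0, 0 < e -> exists2 r, r0 <= r & forall z, gauge z = r ->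
     psum f z != 0 /\ cabs (psum g z) <= e * cabs (psum f z)) ->
  forall z, psum g z = 0.
Proof.
move=> hf hg f1 hfg hbd z; apply/eqP; rewrite -cabs_eq0 eq_le cabs_ge0 andbT.
apply/ler_addgt0Pl => e e0; rewrite addr0.
have c0 : 0 < cabs (psum f z) + 1 by rewrite ltr_wpDl ?cabs_ge0.
have e1 : 0 < e / (cabs (psum f z) + 1) by rewrite divr_gt0.
have [r zr hr] := hbd _ (gauge z) e1.
rewrite (le_trans (entire_domination hf hg f1 hfg (ltW e1) hr zr))//.
by rewrite mulrAC ler_pdivrMr// ler_wpM2l ?(ltW e0)// lerDl.
Qed.

End MaximumPrinciple.

(** * Complex-valued functions of a real variable *)
Section RealVariable.
Context {R : realType}.
Implicit Types (z w : R[i]) (x y t : R) (f g : R -> R[i]).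

Definition rder f x (l : R[i]) :=
  is_derive x 1 (fun t => complex.Re (f t)) (complex.Re l) /\
  is_derive x 1 (fun t => complex.Im (f t)) (complex.Im l).

Lemma ReD z w : complex.Re (z + w) = complex.Re z + complex.Re w.
Proof. by case: z w => [? ?] []. Qed.

Lemma ImD z w : complex.Im (z + w) = complex.Im z + complex.Im w.
Proof. by case: z w => [? ?] []. Qed.

Lemma ReN z : complex.Re (- z) = - complex.Re z.
Proof. by case: z. Qed.

Lemma ImN z : complex.Im (- z) = - complex.Im z.
Proof. by case: z. Qed.

Lemma ReM z w : complex.Re (z * w) = complex.Re z * complex.Re w - complex.Im z * complex.Im w.
Proof. by case: z w => [? ?] []. Qed.

Lemma ImM z w : complex.Im (z * w) = complex.Re z * complex.Im w + complex.Im z * complex.Re w.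
Proof. by case: z w => [? ?] []. Qed.

Lemma eq_complexP z w : complex.Re z = complex.Re w -> complex.Im z = complex.Im w -> z = w.
Proof. by case: z w => [a b] [c d] /= -> ->. Qed.

Lemma rder_cst z x : rder (fun=> z) x 0.
Proof. by split; apply: is_derive_cst. Qed.

Lemma rder_real (h : R -> R) x l : is_derive x 1 h l -> rder (fun t => (h t)%:C) x l%:C.
Proof. by split=> //=; apply: is_derive_cst. Qed.

Lemma rderD f g x l m : rder f x l -> rder g x m -> rder (fun t => f t + g t) x (l + m).
Proof.
move=> [a b] [c d]; split.
- by under eq_fun do rewrite ReD; rewrite ReD; exact: is_deriveD.
- by under eq_fun do rewrite ImD; rewrite ImD; exact: is_deriveD.
Qed.

Lemma rderM f g x l m : rder f x l -> rder g x m ->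
  rder (fun t => f t * g t) x (f x * m + l * g x).
Proof.
move=> [a b] [c d]; split.
- under eq_fun do rewrite ReM.
  apply: (is_derive_eq (is_deriveB (is_deriveM a c) (is_deriveM b d))).
  by rewrite ReD !ReM /GRing.scale /=; ring.
- under eq_fun do rewrite ImM.
  apply: (is_derive_eq (is_deriveD (is_deriveM a d) (is_deriveM b c))).
  by rewrite ImD !ImM /GRing.scale /=; ring.
Qed.

Lemma rderZ f x l w : rder f x l -> rder (fun t => w * f t) x (w * l).
Proof. by move=> h; have := rderM (rder_cst w x) h; rewrite mul0r addr0. Qed.

Lemma rderB f g x l m : rder f x l -> rder g x m -> rder (fun t => f t - g t) x (l - m).
Proof.
move=> hf hg; rewrite -mulN1r; under eq_fun do rewrite -mulN1r.
by apply: rderD => //; apply: rderZ.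
Qed.

Lemma rder_sum n (F F' : nat -> R -> R[i]) x : (forall i, rder (F i) x (F' i x)) ->
  rder (fun t => \sum_(i < n) F i t) x (\sum_(i < n) F' i x).
Proof.
move=> h; elim: n => [|n IH].
  by under eq_fun do rewrite big_ord0; rewrite big_ord0; apply: rder_cst.
by under eq_fun do rewrite big_ord_recr; rewrite big_ord_recr; apply: rderD.
Qed.

Lemma rder_comp f (h : R -> R) x l m : rder f (h x) l -> is_derive x 1 h m ->
  rder (fun t => f (h t)) x (m%:C * l).
Proof.
move=> [a b] c; split.
- apply: (is_derive_eq (is_derive1_comp a c)).
  by rewrite ReM /= mul0r subr0 mulrC.
- apply: (is_derive_eq (is_derive1_comp b c)).
  by rewrite ImM /= mul0r addr0 mulrC.
Qed.

Lemma is_derive_exprn n x : is_derive x 1 (fun t : R => t ^+ n) (n%:R * x ^+ n.-1).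
Proof.
have -> : (fun t : R => t ^+ n) = id ^+ n by apply/funext => t; rewrite exprfctE.
apply: (is_derive_eq (is_deriveX n (is_derive_id x 1))).
by rewrite /GRing.scale /= mulr1 mulr_natl.
Qed.

Lemma cderive1E f x l : rder f x l -> cderive 1 f x = l.
Proof.
move=> [a b]; apply: eq_complexP; rewrite /cderive /derive1n /= derive1E.
- exact: derive_val.
- exact: derive_val.
Qed.

Lemma cderive0E f x : cderive 0 f x = f x.
Proof. exact: eq_complexP. Qed.

(** Differentiability from a first order expansion, in the form in which the
    moving end points of an integral are handled. *)
Lemma rder_expansion f x l :
  (forall e, 0 < e -> exists2 t, 0 < t & forall h, `|h| <= t ->
     cabs (f (x + h) - f x - h%:C * l) <= e * `|h|) ->
  rder f x l.
Proof.
move=> H.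
suff K (P : R[i] -> R) : (forall z w, P (z - w) = P z - P w) ->
    (forall z, `|P z| <= cabs z) -> (forall r z, P (r%:C * z) = r * P z) ->
    is_derive x 1 (fun t => P (f t)) (P l).
  split; apply: K => [z w|z|r z]; rewrite ?ReD ?ReN ?ImD ?ImN ?cabs_Re ?cabs_Im//.
  - by rewrite ReM /= mul0r subr0.
  - by rewrite ImM /= mul0r addr0.
move=> PB Ple PZ.
have cv : h^-1 *: (P (f (h *: 1 + x)) - P (f x)) @[h --> 0^'] --> P l.
  apply/cvgrPdist_le => e e0.
  have [t t0 ht] := H e e0.
  near=> h.
  have h0 : h != 0 by near: h; exact: nbhs_dnbhs_neq.
  have hn : 0 < `|h| by rewrite normr_gt0.
  have hle : `|h| <= t by near: h; exact: dnbhs0_le.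
  have -> : P l - h^-1 *: (P (f (h *: 1 + x)) - P (f x)) =
      - (h^-1 * P (f (x + h) - f x - h%:C * l)).
    by rewrite -[_ *: (_ - _)]/(_ * _) -[h *: 1]/(h * 1) mulr1 [x + h]addrC !PB PZ; field.
  rewrite normrN normrM normfV mulrC ler_pdivrMr//.
  exact: le_trans (Ple _) (ht _ hle).
have dv : derivable (fun t => P (f t)) x 1 by apply/cvg_ex; exists (P l).
apply: (@DeriveDef _ _ _ _ _ _ _ dv).
exact: cvg_lim cv.
Unshelve. all: by end_near. Qed.

(** The mean value inequality, for the two components separately: hence the
    factor 2. *)
Lemma rder_bound f f' X A n : 0 <= A -> (forall x, rder f x (f' x)) -> f 0 = 0 ->
  (forall x, 0 <= x <= X -> cabs (f' x) <= A * x ^+ n / n`!%:R) ->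
  forall x, 0 <= x <= X -> cabs (f x) <= 2 * A * x ^+ n.+1 / n.+1`!%:R.
Proof.
move=> A0 df f0 hf' x /andP[x0 xX].
have key (g g' : R -> R) : (forall y, is_derive y 1 g (g' y)) -> g 0 = 0 ->
    (forall y, 0 <= y <= X -> g' y <= A * y ^+ n / n`!%:R) ->
    g x <= A * x ^+ n.+1 / n.+1`!%:R.
  move=> dg g0 hg; move: x0; rewrite le_eqVlt => /predU1P[<-|x0].
    by rewrite g0 expr0n mulr0 mul0r.
  pose F y := A / n.+1`!%:R * y ^+ n.+1 - g y.
  pose F' y := A * y ^+ n / n`!%:R - g' y.
  have dF y : is_derive y 1 F (F' y).
    apply: (is_derive_eq (is_deriveB (is_deriveZ (A / n.+1`!%:R) (is_derive_exprn n.+1 y)) (dg y))).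
    rewrite /F' /GRing.scale /=; congr (_ - _).
    rewrite factS natrM; field.
    by rewrite nat1r !pnatr_eq0 -lt0n fact_gt0.
  have [c] := MVT x0 (fun y _ => dF y) (derivable_within_continuous (fun y _ => @ex_derive _ _ _ _ _ _ _ (dF y))).
  rewrite in_itv /= => /andP[c0 cx]; rewrite subr0 {2}/F g0 expr0n mulr0 !subr0.
  move=> e; rewrite -subr_ge0.
  have -> : A * x ^+ n.+1 / n.+1`!%:R - g x = F x by rewrite /F mulrAC.
  rewrite e mulr_ge0 ?(ltW x0)// subr_ge0 hg// (ltW c0) /=.
  by rewrite (le_trans (ltW cx)).
have abs (P : R[i] -> R) : (forall z, `|P z| <= cabs z) -> P 0 = 0 ->
    (forall y, is_derive y 1 (fun t => P (f t)) (P (f' y))) ->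
    `|P (f x)| <= A * x ^+ n.+1 / n.+1`!%:R.
  move=> Ple P0 dP; rewrite ler_norml lerNl; apply/andP; split.
  - apply: (key (fun t => - P (f t)) (fun t => - P (f' t))) => [|y hy].
    + by rewrite f0 P0 oppr0.
    + rewrite (le_trans _ (hf' _ hy))// (le_trans _ (Ple _))//.
      by rewrite -normrN ler_norm.
  - apply: (key (fun t => P (f t)) (fun t => P (f' t))) => [|y hy].
    + by rewrite f0 P0.
    + by rewrite (le_trans _ (hf' _ hy))// (le_trans _ (Ple _))// ler_norm.
rewrite (le_trans (cabs_le_ReIm _))//.
have h1 := abs (@complex.Re R) cabs_Re erefl (fun y => (df y).1).
have h2 := abs (@complex.Im R) cabs_Im erefl (fun y => (df y).2).
by rewrite (le_trans (lerD h1 h2))// -!mulrA -mulr2n mulr_natl.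
Qed.

End RealVariable.

(** * The complex exponential, cosine and sine *)
Section ComplexExponential.
Context {R : realType}.
Implicit Types (z w mu : R[i]) (x y t : R).

Lemma cexpD z w : cexp (z + w) = cexp z * cexp w.
Proof.
apply: eq_complexP; rewrite ?ReM ?ImM /= ReD ImD expRD ?cosD ?sinD; ring.
Qed.

Lemma cexp0 : cexp 0 = 1 :> R[i].
Proof. by apply: eq_complexP; rewrite /= expR0 ?cos0 ?sin0 mul1r. Qed.

Lemma cabs_cexp z : cabs (cexp z) = expR (complex.Re z).
Proof.
apply/eqP; rewrite -(@eqrXn2 _ 2) ?cabs_ge0 ?expR_ge0// sqr_cabs /=.
by rewrite !exprMn -mulrDr cos2Dsin2 mulr1.
Qed.

Lemma csqr_i : 'i * 'i = -1 :> R[i].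
Proof. by rewrite -expr2 sqr_i. Qed.

Lemma csinE z : csin z = - ('i / 2) * (cexp ('i * z) - cexp (- ('i * z))).
Proof.
have i0 : 'i != 0 :> R[i] by rewrite -cabs_gt0 cabsi.
rewrite /csin mulrC; congr (_ * _).
apply: (mulfI i0); rewrite mulrN mulrA csqr_i invfM mulrCA mulfV// mulr1.
by rewrite mulN1r opprK.
Qed.

Lemma ccosD z w : ccos (z + w) = ccos z * ccos w - csin z * csin w.
Proof.
rewrite !csinE /ccos (mulrDr 'i z w) opprD !cexpD.
move: (cexp ('i * z)) (cexp (- ('i * z))) (cexp ('i * w)) (cexp (- ('i * w))).
move=> a a' b b'.
transitivity ((a + a') / 2 * ((b + b') / 2) - ('i * 'i) / 4 * (a - a') * (b - b')).
  by rewrite csqr_i; field.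
by field.
Qed.

Lemma csinD z w : csin (z + w) = csin z * ccos w + ccos z * csin w.
Proof. by rewrite !csinE /ccos (mulrDr 'i z w) opprD !cexpD; field. Qed.

Lemma ccosN z : ccos (- z) = ccos z.
Proof. by rewrite /ccos mulrN opprK addrC. Qed.

Lemma csinN z : csin (- z) = - csin z.
Proof. by rewrite !csinE mulrN opprK; ring. Qed.

Lemma ccos0 : ccos 0 = 1 :> R[i].
Proof. by rewrite /ccos mulr0 oppr0 cexp0; field. Qed.

Lemma csin0 : csin 0 = 0 :> R[i].
Proof. by rewrite /csin mulr0 oppr0 subrr mul0r. Qed.

Lemma Re_imul z : complex.Re ('i * z) = - complex.Im z.
Proof. by rewrite ReM /= mul0r mul1r sub0r. Qed.

Lemma cabs2 : cabs 2 = 2 :> R.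
Proof. by rewrite -(rmorph_nat (real_complex R)) cabs_real ger0_norm. Qed.

Lemma cexp_imul_le z : cabs (cexp ('i * z)) <= expR `|complex.Im z| /\
  cabs (cexp (- ('i * z))) <= expR `|complex.Im z|.
Proof.
rewrite !cabs_cexp ReN Re_imul opprK !ler_expR; split; last exact: ler_norm.
by rewrite -normrN ler_norm.
Qed.

Lemma ccos_le z : cabs (ccos z) <= expR `|complex.Im z|.
Proof.
have [h1 h2] := cexp_imul_le z.
rewrite /ccos cabsM cabsV cabs2 ler_pdivrMr// (le_trans (cabsD _ _))//; lra.
Qed.

Lemma csin_le z : cabs (csin z) <= expR `|complex.Im z|.
Proof.
have [h1 h2] := cexp_imul_le z.
rewrite /csin cabsM cabsV cabsM cabs2 cabsi mulr1 ler_pdivrMr//.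
rewrite (le_trans (cabsB _ _))//; lra.
Qed.

Lemma ccos_real x : ccos x%:C = (cos x)%:C.
Proof.
rewrite /ccos /cexp !ReN !ImN Re_imul ImM /= mul0r !mul1r add0r !oppr0 !expR0 !mul1r cosN sinN.
have n2 : (2 : R[i]) != 0 by rewrite pnatr_eq0.
apply: (mulIf n2); rewrite divfK//.
have -> : (cos x)%:C * 2 = (cos x)%:C + (cos x)%:C by ring.
apply: eq_complexP; rewrite ?ReD ?ImD /=; ring.
Qed.

Lemma csin_real x : csin x%:C = (sin x)%:C.
Proof.
rewrite csinE /cexp !ReN !ImN Re_imul ImM /= mul0r !mul1r add0r !oppr0 !expR0 !mul1r cosN sinN.
have -> : (cos x +i* sin x) - (cos x +i* - sin x) = 2 * ('i * (sin x)%:C).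
  have -> : 2 * ('i * (sin x)%:C) = 'i * (sin x)%:C + 'i * (sin x)%:C by ring.
  by apply: eq_complexP; rewrite ?ReD ?ImD ?ReN ?ImN ?ReM ?ImM /=; ring.
transitivity (- ('i * 'i) * (sin x)%:C); first by field.
by rewrite csqr_i opprK mul1r.
Qed.

Lemma ccos_imul y : ccos ('i * y%:C) = ((expR y + expR (- y)) / 2)%:C.
Proof.
rewrite /ccos mulrA csqr_i mulN1r opprK.
have e t : cexp t%:C = (expR t)%:C.
  by apply: eq_complexP; rewrite /= ?cos0 ?sin0 ?mulr1 ?mulr0.
by rewrite -rmorphN !e rmorphM fmorphV rmorph_nat rmorphD addrC.
Qed.

Lemma cosh_ge y : expR `|y| / 2 <= (expR y + expR (- y)) / 2.
Proof.
have := expR_gt0 y; have := expR_gt0 (- y).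
by case: (ger0P y) => _; lra.
Qed.

Lemma sinh_ge y : 1 <= `|y| -> expR `|y| / 4 <= (expR `|y| - expR (- `|y|)) / 2.
Proof.
move=> y1; have h1 : 1 + `|y| <= expR `|y| by exact: expR_ge1Dx.
have h2 : expR (- `|y|) <= 1 by rewrite -expR0 ler_expR oppr_le0.
lra.
Qed.

(** One of the two exponentials has modulus exp |Im z|, the other one
    exp (- |Im z|), which is at most half of it. *)
Lemma cexp_diff z (a b : R[i]) : 1 <= `|complex.Im z| -> a = cexp ('i * z) ->
  b = cexp (- ('i * z)) ->
  expR `|complex.Im z| / 4 <= cabs (a + b) / 2 /\
  expR `|complex.Im z| / 4 <= cabs (a - b) / 2.
Proof.
move=> z1 ea eb; have := sinh_ge z1.
have [ha hb] : cabs a = expR (- complex.Im z) /\ cabs b = expR (complex.Im z).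
  by rewrite ea eb !cabs_cexp ReN Re_imul opprK.
have h1 := cabsB_ge a b; have h2 := cabsB_ge b a.
have h3 := cabsB_ge a (- b); have h4 := cabsB_ge b (- a).
move: h1 h2 h3 h4; rewrite (cabs_distC b a) !cabsN !opprK (addrC b a) ha hb.
by case: (ger0P (complex.Im z)) => _ ; rewrite ?opprK => *; split; lra.
Qed.

(** For sin (Re z) = 0 the modulus is that of cos (i Im z), a hyperbolic
    cosine. *)
Lemma ccos_ge z : sin (complex.Re z) = 0 \/ 1 <= `|complex.Im z| ->
  expR `|complex.Im z| / 4 <= cabs (ccos z).
Proof.
case=> [s0|z1].
- have c1 : `|cos (complex.Re z)| = 1.
    apply/eqP; rewrite -(@eqrXn2 _ 2)// expr1n real_normK ?num_real//.
    by have := cos2Dsin2 (complex.Re z); rewrite s0 expr0n addr0 => ->.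
  rewrite {2}[z]complexE ccosD csin_real s0 mul0r subr0 cabsM ccos_real cabs_real c1 mul1r.
  rewrite ccos_imul cabs_real [X in _ <= X]ger0_norm.
    have := cosh_ge (complex.Im z); have := expR_gt0 `|complex.Im z|; lra.
  by rewrite mulr_ge0 ?invr_ge0// addr_ge0 ?expR_ge0.
- have [h _] := cexp_diff z1 erefl erefl.
  by rewrite /ccos cabsM cabsV cabs2.
Qed.

Lemma csin_ge z : cos (complex.Re z) = 0 \/ 1 <= `|complex.Im z| ->
  expR `|complex.Im z| / 4 <= cabs (csin z).
Proof.
case=> [c0|z1].
- have s1 : `|sin (complex.Re z)| = 1.
    apply/eqP; rewrite -(@eqrXn2 _ 2)// expr1n real_normK ?num_real//.
    by have := cos2Dsin2 (complex.Re z); rewrite c0 expr0n add0r => ->.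
  rewrite {2}[z]complexE csinD ccos_real c0 mul0r addr0 cabsM csin_real cabs_real s1 mul1r.
  rewrite ccos_imul cabs_real [X in _ <= X]ger0_norm.
    by have := cosh_ge (complex.Im z); have := expR_gt0 `|complex.Im z|; lra.
  by rewrite mulr_ge0 ?invr_ge0// addr_ge0 ?expR_ge0.
- have [_ h] := cexp_diff z1 erefl erefl.
  by rewrite /csin cabsM cabsV cabsM cabs2 cabsi mulr1.
Qed.

Lemma rder_cexp mu x : rder (fun t => cexp (mu * t%:C)) x (mu * cexp (mu * x%:C)).
Proof.
have ReE t : complex.Re (mu * t%:C) = complex.Re mu * t by rewrite ReM /= mulr0 subr0.
have ImE t : complex.Im (mu * t%:C) = complex.Im mu * t by rewrite ImM /= mulr0 add0r.
have lin (k : R) : is_derive x 1 (fun t => k * t) k.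
  by apply: is_derive_eq; rewrite /GRing.scale /= mulr1.
have dexp := is_derive1_comp (is_derive_expR (complex.Re mu * x)) (lin (complex.Re mu)).
have dcos := is_derive1_comp (is_derive_cos (complex.Im mu * x)) (lin (complex.Im mu)).
have dsin := is_derive1_comp (is_derive_sin (complex.Im mu * x)) (lin (complex.Im mu)).
split.
- under eq_fun do rewrite /cexp /= ReE ImE.
  apply: (is_derive_eq (is_deriveM dexp dcos)).
  by rewrite ReM /cexp [complex.Re (_ +i* _)]/= [complex.Im (_ +i* _)]/= ReE ImE /GRing.scale /=; ring.
- under eq_fun do rewrite /cexp /= ReE ImE.
  apply: (is_derive_eq (is_deriveM dexp dsin)).
  by rewrite ImM /cexp [complex.Re (_ +i* _)]/= [complex.Im (_ +i* _)]/= ReE ImE /GRing.scale /=; ring.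
Qed.

Lemma rder_ccos mu x : rder (fun t => ccos (mu * t%:C)) x (- mu * csin (mu * x%:C)).
Proof.
have e1 t : 'i * mu * t%:C = 'i * (mu * t%:C) by rewrite mulrA.
have e2 t : - ('i * mu) * t%:C = - ('i * (mu * t%:C)) by rewrite mulNr mulrA.
have := rderZ 2^-1 (rderD (rder_cexp ('i * mu) x) (rder_cexp (- ('i * mu)) x)).
under eq_fun do rewrite e1 e2 mulrC -/(ccos _).
by rewrite csinE e1 e2; congr rder; field.
Qed.

Lemma rder_csin mu x : rder (fun t => csin (mu * t%:C)) x (mu * ccos (mu * x%:C)).
Proof.
have e1 t : 'i * mu * t%:C = 'i * (mu * t%:C) by rewrite mulrA.
have e2 t : - ('i * mu) * t%:C = - ('i * (mu * t%:C)) by rewrite mulNr mulrA.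
have := rderZ (- ('i / 2)) (rderB (rder_cexp ('i * mu) x) (rder_cexp (- ('i * mu)) x)).
under eq_fun do rewrite e1 e2 -csinE.
rewrite /ccos e1 e2; set a := cexp _; set b := cexp _; congr rder.
transitivity (- ('i * 'i) * (mu * ((a + b) / 2))); first by field.
by rewrite csqr_i opprK mul1r.
Qed.

End ComplexExponential.

(** * The fundamental solutions *)
Section FundamentalSolutions.
Context {R : realType}.
Implicit Types (lam : R[i]) (x y t : R) (n d : nat).

Lemma rho_sinrho lam x : sqrtC lam * sinrho lam x = csin (sqrtC lam * x%:C).
Proof.
rewrite /sinrho; case: eqVneq => [->|r0]; first by rewrite !mul0r csin0.
by rewrite mulrC divfK.
Qed.

Lemma sinrhoE lam x : sqrtC lam != 0 ->
  sinrho lam x = csin (sqrtC lam * x%:C) / sqrtC lam.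
Proof. by rewrite /sinrho => /negbTE ->. Qed.

Lemma cosrho0 lam : cosrho lam 0 = 1.
Proof. by rewrite /cosrho mulr0 ccos0. Qed.

Lemma sinrho0 lam : sinrho lam 0 = 0.
Proof. by rewrite /sinrho; case: eqVneq => // _; rewrite mulr0 csin0 mul0r. Qed.

Lemma cosrhoN lam x : cosrho lam (- x) = cosrho lam x.
Proof. by rewrite /cosrho rmorphN mulrN ccosN. Qed.

Lemma sinrhoN lam x : sinrho lam (- x) = - sinrho lam x.
Proof.
by rewrite /sinrho; case: ifP => _; rewrite rmorphN // mulrN csinN mulNr.
Qed.

Lemma cosrhoD lam x y : cosrho lam (x + y) =
  cosrho lam x * cosrho lam y - lam * sinrho lam x * sinrho lam y.
Proof.
rewrite {1 2 3}/cosrho rmorphD mulrDr ccosD -!rho_sinrho; congr (_ - _).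
by rewrite mulrACA -expr2 sqrtCK mulrA.
Qed.

Lemma sinrhoD lam x y : sinrho lam (x + y) =
  sinrho lam x * cosrho lam y + cosrho lam x * sinrho lam y.
Proof.
have [r0|r0] := eqVneq (sqrtC lam) 0.
  by rewrite /sinrho /cosrho r0 eqxx !mul0r ccos0 mulr1 mul1r rmorphD.
by rewrite /cosrho !sinrhoE// rmorphD mulrDr csinD; field.
Qed.

Lemma rder_cosrho lam x : rder (cosrho lam) x (- lam * sinrho lam x).
Proof.
have := rder_ccos (sqrtC lam) x; congr rder.
by rewrite -rho_sinrho mulNr mulrA -expr2 sqrtCK mulNr.
Qed.

Lemma rder_sinrho lam x : rder (sinrho lam) x (cosrho lam x).
Proof.
have [r0|r0] := eqVneq (sqrtC lam) 0.
  have -> : sinrho lam = fun t => t%:C.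
    by apply/funext => t; rewrite /sinrho r0 eqxx.
  by rewrite /cosrho r0 mul0r ccos0; apply: rder_real; apply: is_derive_id.
have -> : sinrho lam = fun t => (sqrtC lam)^-1 * csin (sqrtC lam * t%:C).
  by apply/funext => t; rewrite sinrhoE// mulrC.
have := rderZ (sqrtC lam)^-1 (rder_csin (sqrtC lam) x).
by rewrite mulKf.
Qed.

(** The sums of (- lam) ^ n x ^ (2 n + d) / (2 n + d)! for d = 0, 1, 2: each one
    is the primitive of the preceding one that vanishes at 0. The third one is
    (1 - cos rho x) / lam, written so as to make sense for lam = 0. *)
Definition trigser d lam x : R[i] :=
  match d with
  | 0 => cosrho lam x
  | 1 => sinrho lam x
  | _ => 2 * sinrho lam (x / 2) ^+ 2
  end.

Lemma cosrho_half lam x : lam * trigser 2 lam x = 1 - cosrho lam x.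
Proof.
have h y : cosrho lam y ^+ 2 + lam * sinrho lam y ^+ 2 = 1.
  by have := cosrhoD lam y (- y); rewrite subrr cosrho0 cosrhoN sinrhoN => ->; ring.
have -> : cosrho lam x = cosrho lam (x / 2) ^+ 2 - lam * sinrho lam (x / 2) ^+ 2.
  by rewrite {1}[x]splitr cosrhoD; ring.
by rewrite -(h (x / 2)) /=; ring.
Qed.

Lemma rder_trigser d lam x : (d < 2)%N -> rder (trigser d.+1 lam) x (trigser d lam x).
Proof.
case: d => [|[|//]] _; first exact: rder_sinrho.
have dh : is_derive x 1 (fun t => t / 2) (2^-1 : R).
  under eq_fun do rewrite mulrC.
  by apply: is_derive_eq; rewrite /GRing.scale /= mulr1.
have ds := @rder_comp _ _ (fun t => t / 2) _ _ _ (rder_sinrho lam (x / 2)) dh.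
have := rderZ 2 (rderM ds ds).
have e0 : trigser 1 lam x = 2 * (sinrho lam (x / 2) * cosrho lam (x / 2)).
  by rewrite /= {1}[x]splitr sinrhoD; ring.
have e : (2^-1)%:C = 2^-1 :> R[i] by rewrite fmorphV rmorph_nat.
by rewrite e e0; congr rder; field.
Qed.

Lemma trigser0 d lam : trigser d.+1 lam 0 = 0.
Proof. by case: d => [|d] /=; rewrite ?mul0r sinrho0// expr0n mulr0. Qed.

Definition tmon m x : R[i] := (x ^+ m / m`!%:R)%:C.

Lemma rder_tmon m x : rder (tmon m.+1) x (tmon m x).
Proof.
apply: rder_real.
have := is_deriveZ (m.+1`!%:R^-1) (is_derive_exprn m.+1 x).
move=> h; under eq_fun do rewrite mulrC; apply: (is_derive_eq h).
rewrite /GRing.scale /= factS natrM; field.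
by rewrite nat1r !pnatr_eq0 -lt0n fact_gt0.
Qed.

Lemma rder_tmon0 x : rder (tmon 0) x 0.
Proof. by rewrite /tmon; under eq_fun do rewrite expr0; apply: rder_cst. Qed.

Definition tpart d lam n x : R[i] := \sum_(i < n) (- lam) ^+ i * tmon (2 * i + d) x.

Lemma rder_tpart d lam n x : rder (tpart d.+1 lam n) x (tpart d lam n x).
Proof.
apply: (@rder_sum _ n (fun i t => (- lam) ^+ i * tmon (2 * i + d.+1) t)
  (fun i t => (- lam) ^+ i * tmon (2 * i + d) t)) => i.
by rewrite addnS; apply: rderZ; apply: rder_tmon.
Qed.

Lemma rder_tpart0 lam n x : rder (tpart 0 lam n.+1) x (- lam * tpart 1 lam n x).
Proof.
have -> : tpart 0 lam n.+1 = fun t => tmon 0 t +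
    - lam * \sum_(i < n) (- lam) ^+ i * tmon (2 * i + 1).+1 t.
  apply/funext => t; rewrite /tpart big_ord_recl expr0 mul1r mulr_sumr; congr (_ + _).
  by apply: eq_bigr => i _; rewrite exprS mulrA /= /bump add1n addn0 mulnS addn1.
rewrite -[- lam * _]add0r; apply: rderD; first exact: rder_tmon0.
apply: rderZ.
apply: (@rder_sum _ n (fun i t => (- lam) ^+ i * tmon (2 * i + 1).+1 t)
  (fun i t => (- lam) ^+ i * tmon (2 * i + 1) t)) => i.
by apply: rderZ; apply: rder_tmon.
Qed.

Lemma tpart_at0 d lam n : tpart d.+1 lam n 0 = 0.
Proof.
rewrite /tpart big1// => i _.
by rewrite /tmon addnS expr0n mul0r mulr0.
Qed.

Lemma tpart0_at0 lam n : tpart 0 lam n.+1 0 = 1.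
Proof.
rewrite /tpart big_ord_recl big1 ?addr0 => [|i _].
  by rewrite expr0 mul1r /tmon expr0 fact0 divr1.
by rewrite /tmon addn0 expr0n /= /bump /= mul0r mulr0.
Qed.

Lemma cabs_cosrho_le lam x : 0 <= x <= 1 ->
  cabs (cosrho lam x) <= expR `|complex.Im (sqrtC lam)|.
Proof.
move=> /andP[x0 x1]; rewrite (le_trans (ccos_le _))// ler_expR.
by rewrite ImM /= mulr0 add0r normrM (ger0_norm x0) ler_piMr.
Qed.

Lemma cabs_csin_le lam x : 0 <= x <= 1 ->
  cabs (csin (sqrtC lam * x%:C)) <= expR `|complex.Im (sqrtC lam)|.
Proof.
move=> /andP[x0 x1]; rewrite (le_trans (csin_le _))// ler_expR.
by rewrite ImM /= mulr0 add0r normrM (ger0_norm x0) ler_piMr.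
Qed.

(** The remainders of the three series: each one is, up to the factor - lam,
    the derivative of the next one, and the first one is cos rho x. *)
Lemma trigser_remainder d lam n x : (d <= 2)%N -> 0 <= x <= 1 ->
  cabs (trigser d lam x - tpart d lam n x) <=
  expR `|complex.Im (sqrtC lam)| * (2 * (1 + cabs lam)) ^+ (2 * n + d) *
    x ^+ (2 * n + d) / (2 * n + d)`!%:R.
Proof.
(* each step costs the factor 2 of the mean value inequality and the factor 1
   or |lam| of the differential equation: both are absorbed by K *)
set B := expR _; set K := 2 * _.
have B0 : 0 <= B by exact: expR_ge0.
have K0 : 0 <= K by rewrite mulr_ge0// addr_ge0 ?cabs_ge0.
have step mu f f' m : (forall y, rder f y (mu * f' y)) -> f 0 = 0 ->
    2 * cabs mu <= K ->
    (forall y, 0 <= y <= 1 -> cabs (f' y) <= B * K ^+ m * y ^+ m / m`!%:R) ->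
    forall y, 0 <= y <= 1 -> cabs (f y) <= B * K ^+ m.+1 * y ^+ m.+1 / m.+1`!%:R.
  move=> df f0 muK hf' y y01.
  have A0 : 0 <= cabs mu * (B * K ^+ m) by rewrite !mulr_ge0 ?cabs_ge0 ?exprn_ge0.
  have := @rder_bound _ f (fun y => mu * f' y) 1 _ m A0 df f0 _ y y01.
  move/(_ _)/le_trans; apply.
    by move=> u hu; rewrite cabsM -!mulrA ler_wpM2l ?cabs_ge0// !mulrA hf'.
  case/andP: y01 => y0 _.
  rewrite ler_wpM2r ?invr_ge0// ler_wpM2r ?exprn_ge0//.
  have -> : 2 * (cabs mu * (B * K ^+ m)) = B * (2 * cabs mu * K ^+ m) by ring.
  by rewrite exprS ler_wpM2l// ler_wpM2r// exprn_ge0.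
pose P e m := forall y, 0 <= y <= 1 -> cabs (trigser e lam y - tpart e lam m y) <=
    B * K ^+ (2 * m + e) * y ^+ (2 * m + e) / (2 * m + e)`!%:R.
have up e m : (e < 2)%N -> P e m -> P e.+1 m.
  move=> e2 h y y01; rewrite addnS.
  apply: (step 1 (fun u => trigser e.+1 lam u - tpart e.+1 lam m u)
    (fun u => trigser e lam u - tpart e lam m u)) => // [u||].
  - by rewrite mul1r; apply: rderB; [apply: rder_trigser|apply: rder_tpart].
  - by rewrite trigser0 tpart_at0 subrr.
  - by rewrite cabs1 mulr1 /K mulrDr mulr1 lerDl mulr_ge0 ?cabs_ge0.
have P0 m : P 0%N m.
  elim: m => [|m IH] y y01.
    rewrite muln0 !expr0 fact0 divr1 !mulr1.
    by rewrite /tpart big_ord0 subr0; exact: cabs_cosrho_le.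
  rewrite (_ : 2 * m.+1 + 0 = (2 * m + 1).+1)%N; last by lia.
  apply: (step (- lam) (fun u => trigser 0 lam u - tpart 0 lam m.+1 u)
    (fun u => trigser 1 lam u - tpart 1 lam m u)) => // [u|||].
  - by rewrite mulrBr; apply: rderB; [apply: rder_cosrho|apply: rder_tpart0].
  - by rewrite tpart0_at0 /= cosrho0 subrr.
  - by rewrite cabsN /K ler_pM2l// lerDr.
  - exact: up.
have PP e m : (e <= 2)%N -> P e m.
  by elim: e => // e IH e2; apply: up => //; apply: IH; apply: ltnW.
by move=> d2; apply: PP.
Qed.

Lemma trigser_remainder1 d lam n x : (d <= 2)%N -> 0 <= x <= 1 ->
  cabs (trigser d lam x - tpart d lam n x) <=
  expR `|complex.Im (sqrtC lam)| * exp_coeff (2 * (1 + cabs lam)) (2 * n + d).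
Proof.
move=> d2 x01; apply: (le_trans (trigser_remainder lam n d2 x01)).
rewrite /exp_coeff /= mulrA ler_wpM2r ?invr_ge0// ler_piMr ?mulr_ge0 ?expR_ge0 ?exprn_ge0//.
  by rewrite mulr_ge0// addr_ge0 ?cabs_ge0.
by case/andP: x01 => x0 x1; rewrite exprn_ile1.
Qed.

Lemma trigser_bounded d lam : (d <= 2)%N ->
  exists M, forall x, 0 <= x <= 1 -> cabs (trigser d lam x) <= M.
Proof.
move=> d2; eexists => x x01; have := trigser_remainder1 lam 0 d2 x01.
by rewrite /tpart big_ord0 subr0; apply.
Qed.

(** The remainders of the series after the first term, which control the moving
    end point of the integral in the solution C(x, lam). *)
Lemma fundamental_near0 lam : exists2 K, 0 <= K & forall x, `|x| <= 1 ->
  [/\ cabs (cosrho lam x) <= K, cabs (sinrho lam x) <= K * `|x|,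
      cabs (cosrho lam x - 1) <= K * x ^+ 2 & cabs (sinrho lam x - x%:C) <= K * x ^+ 2].
Proof.
set B := expR `|complex.Im (sqrtC lam)|; set L := 2 * (1 + cabs lam).
have B0 : 0 <= B by exact: expR_ge0.
have L1 : 1 <= L by have := cabs_ge0 lam; rewrite /L; lra.
have L0 : 0 <= L by lra.
have L3 n : (n <= 3)%N -> L ^+ n <= L ^+ 3 by move=> n3; rewrite ler_weXn2l.
have BL n : (n <= 3)%N -> B * L ^+ n <= B * L ^+ 3 by move=> /L3 ?; rewrite ler_wpM2l.
have BL0 n : 0 <= B * L ^+ n by rewrite mulr_ge0// exprn_ge0.
exists (B * L ^+ 3); first exact: BL0.
suff H x : 0 <= x <= 1 -> [/\ cabs (cosrho lam x) <= B * L ^+ 3,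
    cabs (sinrho lam x) <= B * L ^+ 3 * x, cabs (cosrho lam x - 1) <= B * L ^+ 3 * x ^+ 2 &
    cabs (sinrho lam x - x%:C) <= B * L ^+ 3 * x ^+ 2].
  move=> x; case: (ger0P x) => x0 x1; first by apply: H; rewrite x0.
  have [] := H (- x) _; first by apply/andP; split; lra.
  rewrite sqrrN cosrhoN sinrhoN cabsN rmorphN => h1 h2 h3 h4; split=> //.
  by rewrite -cabsN opprB addrC; move: h4; rewrite opprK addrC.
move=> x01; case/andP: (x01) => x0 x1; split.
- have := trigser_remainder lam 0 (isT : (0 <= 2)%N) x01.
  rewrite /tpart big_ord0 subr0 muln0 expr0 fact0 divr1 !mulr1 => /le_trans; apply.
  by have := BL 0%N isT; rewrite expr0 mulr1.
- have := trigser_remainder lam 0 (isT : (1 <= 2)%N) x01.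
  rewrite /tpart big_ord0 subr0 muln0 divr1 => /le_trans; apply.
  by rewrite ler_wpM2r// BL.
- have := trigser_remainder lam 1 (isT : (0 <= 2)%N) x01.
  rewrite /tpart big_ord1 expr0 mul1r /tmon expr0 fact0 divr1 => /le_trans; apply.
  rewrite muln1 addn0 -mulrA; apply: ler_pM; last 2 first.
  + exact: BL.
  + by rewrite ler_piMr ?exprn_ge0// invf_le1 ?ler1n ?ltr0n.
  + exact: BL0.
  + by rewrite mulr_ge0 ?exprn_ge0 ?invr_ge0.
- have := trigser_remainder lam 1 (isT : (1 <= 2)%N) x01.
  rewrite /tpart big_ord1 expr0 mul1r /tmon expr1 divr1 => /le_trans; apply.
  rewrite muln1 addn1 -mulrA ler_wpM2l//.
  rewrite ler_pdivrMr ?ltr0n ?fact_gt0// exprSr ler_pM ?exprn_ge0//.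
  by rewrite (le_trans x1)// ler1n fact_gt0.
Qed.

Lemma trigser_le d lam x : (d <= 2)%N -> 0 <= x <= 1 ->
  cabs (trigser d lam x) * cabs (sqrtC lam) ^+ d <= 2 * expR `|complex.Im (sqrtC lam)|.
Proof.
move=> d2 x01; have c := cabs_cosrho_le lam x01; have s := cabs_csin_le lam x01.
have e0 := expR_ge0 `|complex.Im (sqrtC lam)|.
have e1 : 1 <= expR `|complex.Im (sqrtC lam)| by rewrite -expR0 ler_expR.
case: d d2 => [|[|[|//]]] _.
- by rewrite expr0 mulr1; apply: le_trans c _; lra.
- by rewrite expr1 -cabsM mulrC rho_sinrho; apply: le_trans s _; lra.
- rewrite -cabsX -cabsM sqrtCK mulrC cosrho_half (le_trans (cabsB _ _))// cabs1; lra.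
Qed.

(** The gauge of rho ^ 2 is 2 max((Re rho) ^ 2, (Im rho) ^ 2). *)
Lemma gauge_sqrt lam r : 0 <= r -> gauge lam = 2 * r ^+ 2 ->
  (`|complex.Re (sqrtC lam)| = r \/ `|complex.Im (sqrtC lam)| = r) /\
  r <= cabs (sqrtC lam).
Proof.
move=> r0; rewrite /gauge -{1 2}(sqrtCK lam) cabsX.
set z := sqrtC lam; rewrite sqr_cabs expr2 ReM -!expr2.
have sqE (u : R) : u ^+ 2 = r ^+ 2 -> `|u| = r.
  by move=> h; apply/eqP; rewrite -(@eqrXn2 _ 2)// real_normK ?num_real// h.
move=> h.
have [e|e] : complex.Re z ^+ 2 = r ^+ 2 \/ complex.Im z ^+ 2 = r ^+ 2.
- by move: h; case: ger0P => _ h; [left|right]; lra.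
- by split; [left; exact: sqE|rewrite -(sqE _ e) cabs_Re].
- by split; [right; exact: sqE|rewrite -(sqE _ e) cabs_Im].
Qed.

Lemma sin_npi n : sin (n%:R * pi) = 0 :> R.
Proof.
elim: n => [|n IH]; first by rewrite mul0r sin0.
by rewrite -natr1 mulrDl mul1r sinDpi IH oppr0.
Qed.

Lemma cos_npihalf n : cos (n%:R * pi + pi / 2) = 0 :> R.
Proof. by rewrite cosDpihalf sin_npi oppr0. Qed.

(** The derivative of [trigser d lam] at 1. For d = 2 - (alpha + beta) it is, up
    to a sign, the characteristic function of the problem with q = 0. *)
Definition leading d lam : R[i] :=
  match d with
  | 0 => - lam * sinrho lam 1
  | 1 => cosrho lam 1
  | _ => sinrho lam 1
  end.

(** On the boundary of the square |Re rho|, |Im rho| <= r: the radius is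
    N pi + pi / 2 or N pi, so that cos (Re rho), respectively sin (Re rho),
    vanishes on the vertical sides; on the horizontal ones |Im rho| = r is
    large. *)
Lemma leading_ge d : (d <= 2)%N -> forall r0 : R, exists2 r, r0 <= r & forall lam,
  gauge lam = 2 * r ^+ 2 ->
  r <= cabs (sqrtC lam) /\
  expR `|complex.Im (sqrtC lam)| / 4 * cabs (sqrtC lam) <=
  cabs (leading d lam) * cabs (sqrtC lam) ^+ d.
Proof.
move=> d2 r0.
pose N := Num.bound `|r0|.
have pi2 : 2 <= (pi : R) by exact: pi_ge2.
have rN0 : `|r0| < N%:R by apply: archi_boundP.
have Nr : r0 <= N%:R by rewrite (le_trans (ler_norm _))// ltW.
have N1 : 1 <= N%:R :> R.
  by rewrite ler1n -(ltr0n R) (le_lt_trans (normr_ge0 _) rN0).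
pose r := if d == 1%N then N%:R * pi else N%:R * pi + pi / 2 : R.
have rN : N%:R <= r.
  have h : N%:R * 2 <= N%:R * pi :> R by rewrite ler_wpM2l.
  by rewrite /r; case: ifP => _; lra.
have r1 : 1 <= r by exact: le_trans rN.
exists r; first exact: le_trans rN.
move=> lam /(gauge_sqrt (le_trans ler01 r1))[hr hc]; split=> //.
set z := sqrtC lam in hr hc *.
have z0 : 0 < cabs z by rewrite (lt_le_trans _ hc)// (lt_le_trans _ r1).
have absE (f : R -> R) (u : R) : (f (- u) = f u \/ f (- u) = - f u) ->
    f `|u| = 0 -> f u = 0.
  by case: ger0P => // _ [->|-> /eqP]; rewrite // oppr_eq0 => /eqP.
have zC : z = z * 1%:C by rewrite mulr1.
have hs : d != 1%N -> expR `|complex.Im z| / 4 <= cabs (z * sinrho lam 1).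
  rewrite rho_sinrho -/z -zC /r => d1; apply: csin_ge.
  case: hr => hr; [left|by right; rewrite hr].
  apply: absE; first by left; rewrite cosN.
  by rewrite hr /r (negbTE d1) cos_npihalf.
case: d d2 @r rN r1 hr hc hs => [|[|[|//]]] _ r rN r1 hr hc hs.
- have lamE : lam = z * z by rewrite -expr2 sqrtCK.
  rewrite expr0 mulr1 /= mulNr cabsN {1}lamE -(mulrA z) (cabsM z) [X in X <= _]mulrC.
  by rewrite ler_wpM2l ?cabs_ge0// hs.
- rewrite expr1 ler_wpM2r ?cabs_ge0// /= /cosrho -/z -zC; apply: ccos_ge.
  case: hr => hr; [left|by right; rewrite hr].
  apply: absE; first by right; rewrite sinN.
  by rewrite hr sin_npi.
- by rewrite /= expr2 mulrA ler_wpM2r ?cabs_ge0// [X in _ <= X]mulrC -cabsM hs.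
Qed.

End FundamentalSolutions.

(** * Integration of complex-valued functions *)
Section ComplexIntegral.
Context {R : realType}.
Implicit Types (D A B : set R) (f g phi : R -> R[i]) (x c M : R) (z : R[i]).
Local Notation mu := (@lebesgue_measure R).

Lemma eq_cintegral D f g : (forall x, D x -> f x = g x) ->
  cintegral D f = cintegral D g.
Proof.
move=> h; rewrite /cintegral.
by congr (_ +i* _); apply: eq_Rintegral => x /set_mem/h ->.
Qed.

Lemma eq_cintegrable D f g : measurable D -> (forall x, D x -> f x = g x) ->
  cintegrable D f -> cintegrable D g.
Proof.
move=> mD h [h1 h2]; split.
- by apply: eq_integrable h1 => // x /set_mem/h ->.
- by apply: eq_integrable h2 => // x /set_mem/h ->.
Qed.

Lemma cintegrableS D A f : measurable D -> measurable A -> A `<=` D ->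
  cintegrable D f -> cintegrable A f.
Proof. by move=> mD mA AD [h1 h2]; split; [exact: integrableS h1|exact: integrableS h2]. Qed.

Lemma cintegrableD D f g : measurable D -> cintegrable D f -> cintegrable D g ->
  cintegrable D (fun x => f x + g x).
Proof.
move=> mD [h1 h2] [h3 h4]; split.
- under eq_fun do rewrite ReD EFinD; exact: integrableD.
- under eq_fun do rewrite ImD EFinD; exact: integrableD.
Qed.

Definition cmeas D phi := measurable_fun D (fun x => complex.Re (phi x)) /\
  measurable_fun D (fun x => complex.Im (phi x)).

Lemma rder_cmeas D phi phi' : measurable D -> (forall x, rder phi x (phi' x)) -> cmeas D phi.
Proof.
move=> mD h.
have c (P : R[i] -> R) : (forall x, derivable (fun t => P (phi t)) x 1) ->
    measurable_fun D (fun t => P (phi t)).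
  move=> dP; apply: (measurable_funS (E := setT)) => //.
  apply: measurable_funTS; apply: continuous_measurable_fun => x.
  exact/differentiable_continuous/derivable1_diffP.
by split; apply: c => x; [exact: (@ex_derive _ _ _ _ _ _ _ (h x).1)|exact: (@ex_derive _ _ _ _ _ _ _ (h x).2)].
Qed.

Lemma cmeas_bounded D phi M (P : R[i] -> R) : (forall z, `|P z| <= cabs z) ->
  (forall x, D x -> cabs (phi x) <= M) -> [bounded P (phi x) | x in D].
Proof.
move=> hP h; exists M; split; first exact: num_real.
by move=> y My x Dx /=; rewrite (le_trans (hP _))// (le_trans (h _ Dx))// ltW.
Qed.

Lemma cintegrableM D phi f M : measurable D -> cmeas D phi ->
  (forall x, D x -> cabs (phi x) <= M) -> cintegrable D f ->
  cintegrable D (fun x => phi x * f x).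
Proof.
move=> mD [m1 m2] hM [f1 f2].
have b1 := cmeas_bounded cabs_Re hM; have b2 := cmeas_bounded cabs_Im hM.
split.
- under eq_fun do rewrite ReM EFinB !EFinM.
  by apply: integrableB => //; apply: integrableMr.
- under eq_fun do rewrite ImM EFinD !EFinM.
  by apply: integrableD => //; apply: integrableMr.
Qed.

Lemma cmeas_cst D z : cmeas D (fun=> z).
Proof. by split; apply: measurable_cst. Qed.

Lemma cintegrableZ D f z : measurable D -> cintegrable D f ->
  cintegrable D (fun x => z * f x).
Proof. by move=> mD; apply: (@cintegrableM D (fun=> z) f (cabs z)) => //; apply: cmeas_cst. Qed.

Lemma cintegralD D f g : measurable D -> cintegrable D f -> cintegrable D g ->
  cintegral D (fun x => f x + g x) = cintegral D f + cintegral D g.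
Proof.
move=> mD [f1 f2] [g1 g2]; rewrite /cintegral.
under eq_Rintegral do rewrite ReD.
under [X in _ +i* X]eq_Rintegral do rewrite ImD.
by rewrite !RintegralD//; apply: eq_complexP; rewrite ?ReD ?ImD.
Qed.

Lemma cintegralZ D f z : measurable D -> cintegrable D f ->
  cintegral D (fun x => z * f x) = z * cintegral D f.
Proof.
move=> mD [f1 f2]; rewrite /cintegral.
under eq_Rintegral do rewrite ReM.
under [X in _ +i* X]eq_Rintegral do rewrite ImM.
have iZ (k : R) (h : R -> R) : mu.-integrable D (EFin \o h) ->
    mu.-integrable D (EFin \o (fun x => k * h x)).
  by move=> ih; rewrite /comp; under eq_fun do rewrite EFinM; apply: integrableZl.
rewrite RintegralB//; [|exact: iZ..]; rewrite RintegralD//; [|exact: iZ..].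
rewrite !RintegralZl//.
by apply: eq_complexP; rewrite ?ReM ?ImM.
Qed.

Lemma cintegrable0 D : measurable D -> cintegrable D (fun=> 0).
Proof. by move=> mD; split; apply: integrable0. Qed.

Lemma cintegral0 D : cintegral D (fun=> 0) = 0.
Proof. by rewrite /cintegral /= /Rintegral integral0. Qed.

Lemma cintegrable_sum D n (F : nat -> R -> R[i]) : measurable D ->
  (forall i, cintegrable D (F i)) -> cintegrable D (fun x => \sum_(i < n) F i x).
Proof.
move=> mD h; elim: n => [|n IH].
  by under eq_fun do rewrite big_ord0; apply: cintegrable0.
by under eq_fun do rewrite big_ord_recr; apply: cintegrableD.
Qed.

Lemma cintegral_sum D n (F : nat -> R -> R[i]) : measurable D ->
  (forall i, cintegrable D (F i)) ->
  cintegral D (fun x => \sum_(i < n) F i x) = \sum_(i < n) cintegral D (F i).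
Proof.
move=> mD h; elim: n => [|n IH].
  by rewrite big_ord0 -[RHS](cintegral0 D); apply: eq_cintegral => x _; rewrite big_ord0.
rewrite big_ord_recr /= -IH -cintegralD//; last exact: cintegrable_sum.
by apply: eq_cintegral => x _; rewrite big_ord_recr.
Qed.

Lemma cintegral_setU A B f : measurable A -> measurable B ->
  cintegrable (A `|` B) f -> [disjoint A & B] ->
  cintegral (A `|` B) f = cintegral A f + cintegral B f.
Proof.
move=> mA mB [f1 f2] AB; rewrite /cintegral !Rintegral_setU//.
Qed.

(** Equivalent to the integral of the modulus, and reduced to real functions. *)
Definition lnorm D f : R :=
  \int[mu]_(x in D) (`|complex.Re (f x)| + `|complex.Im (f x)|).

Lemma lnorm_integrable D f : measurable D -> cintegrable D f ->
  mu.-integrable D (EFin \o (fun x => `|complex.Re (f x)| + `|complex.Im (f x)|)).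
Proof.
move=> mD [f1 f2]; rewrite /comp; under eq_fun do rewrite EFinD.
by apply: integrableD => //; [exact: (integrable_norm f1)|exact: (integrable_norm f2)].
Qed.

Lemma lnorm_ge0 D f : 0 <= lnorm D f.
Proof. by apply: Rintegral_ge0 => x _; rewrite addr_ge0. Qed.

Lemma cintegral_le D f : measurable D -> cintegrable D f ->
  cabs (cintegral D f) <= lnorm D f.
Proof.
move=> mD [f1 f2]; rewrite (le_trans (cabs_le_ReIm _))//= /lnorm.
have n1 := integrable_norm f1; have n2 := integrable_norm f2.
by rewrite RintegralD// lerD// le_normr_Rintegral.
Qed.

Lemma lnormM D phi f M : measurable D -> cmeas D phi ->
  (forall x, D x -> cabs (phi x) <= M) -> cintegrable D f ->
  lnorm D (fun x => phi x * f x) <= 2 * M * lnorm D f.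
Proof.
move=> mD mphi hM intf.
rewrite /lnorm -RintegralZl//; last exact: lnorm_integrable.
apply: le_Rintegral => //.
- by apply: lnorm_integrable => //; apply: cintegrableM hM intf.
- rewrite /comp; under eq_fun do rewrite EFinM.
  by apply: integrableZl => //; apply: lnorm_integrable.
- move=> x Dx; have h1 := cabs_Re (phi x * f x); have h2 := cabs_Im (phi x * f x).
  rewrite (le_trans (lerD h1 h2))// cabsM.
  have := ler_pM (cabs_ge0 _) (cabs_ge0 _) (hM _ Dx) (cabs_le_ReIm (f x)); lra.
Qed.

Lemma cintegralM_le D phi f M : measurable D -> cmeas D phi ->
  (forall x, D x -> cabs (phi x) <= M) -> cintegrable D f ->
  cabs (cintegral D (fun x => phi x * f x)) <= 2 * M * lnorm D f.
Proof.
move=> mD mphi hM intf; apply: le_trans (lnormM mD mphi hM intf).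
by apply: cintegral_le => //; apply: cintegrableM hM intf.
Qed.

(** ** Invariance under x |-> c + s x with s = 1 or s = - 1 *)

Lemma affine_measurable c (s : R) : measurable_fun setT (fun x : R => c + s * x).
Proof. by apply: measurable_funD => //; apply: measurable_funM. Qed.

(** The two measures agree on the half-open intervals. *)
Lemma affine_measure c (s : R) A : (s = 1) \/ (s = -1) -> measurable A ->
  pushforward mu (fun x : R => c + s * x : measurableTypeR R) A = mu A.
Proof.
move=> s1 mA; apply/esym/lebesgue_measure_unique => //=; first exact: affine_measurable.
move=> _ _ [[a b]] _ <-; rewrite /pushforward /=.
case: s1 => ->.
- have -> : (fun x => c + 1 * x) @^-1` `]a, b] = `]a - c, b - c]%classic.
    by apply/seteqP; split=> x; rewrite /= !in_itv /= mul1r ltrBlDl lerBrDl.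
  by rewrite !lebesgue_measure_itv/= !lte_fin ltrD2r -!EFinB opprB addrA subrK.
- have -> : (fun x => c + -1 * x) @^-1` `]a, b] = `[c - b, c - a[%classic.
    apply/seteqP; split=> x; rewrite /= !in_itv /= mulN1r.
    + by move=> /andP[h1 h2]; apply/andP; split; lra.
    + by move=> /andP[h1 h2]; apply/andP; split; lra.
  rewrite !lebesgue_measure_itv/= !lte_fin ltrD2l ltrN2 -!EFinB.
  by case: ifP => // _; congr EFin; ring.
Qed.

Lemma affine_integral c (s : R) (f : R -> R) : (s = 1) \/ (s = -1) ->
  mu.-integrable setT (EFin \o f) ->
  mu.-integrable setT (EFin \o (fun x => f (c + s * x))) /\
  \int[mu]_x f (c + s * x) = \int[mu]_x f x.
Proof.
move=> s1 /integrableP[mf intf].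
pose tau := (fun x : R => c + s * x) : measurableTypeR R -> measurableTypeR R.
have mtau : measurable_fun setT tau by exact: affine_measurable.
have mftau : measurable_fun setT (EFin \o (fun x => f (c + s * x))).
  exact: (measurableT_comp mf mtau).
have i1 : mu.-integrable setT (EFin \o (fun x => f (c + s * x))).
  apply/integrableP; split=> //; apply: le_lt_trans intf.
  have mfn : measurable_fun setT (fun y : R => `|(f y)%:E|%E).
    exact: (@measurableT_comp _ _ _ _ _ _ (@abse R) _ (EFin \o f)).
  have h := ge0_integral_pushforward mtau mu measurableT mfn (fun y _ => abse_ge0 _).
  rewrite le_eqVlt; apply/orP; left; apply/eqP.
  apply: (eq_trans (esym h)).
  by apply: eq_measure_integral => A mA _; apply: affine_measure.
split=> //; rewrite /Rintegral; congr fine.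
have h := integral_pushforward mtau mf (mu := mu) (D := setT) i1 measurableT.
apply: (eq_trans (esym h)).
by apply: eq_measure_integral => A mA _; apply: affine_measure.
Qed.

Lemma cintegral_affine c (s : R) f : (s = 1) \/ (s = -1) -> cintegrable setT f ->
  cintegrable setT (fun x => f (c + s * x)) /\
  cintegral setT (fun x => f (c + s * x)) = cintegral setT f.
Proof.
move=> s1 [f1 f2].
have [a1 a2] := affine_integral c s1 f1; have [b1 b2] := affine_integral c s1 f2.
by split; [split|rewrite /cintegral a2 b2].
Qed.

Definition ext0 D f x : R[i] := if x \in D then f x else 0.

Lemma ext0_patch D f : (fun x => complex.Re (ext0 D f x)) = (fun x => complex.Re (f x)) \_ D /\
  (fun x => complex.Im (ext0 D f x)) = (fun x => complex.Im (f x)) \_ D.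
Proof. by split; apply/funext => x; rewrite /ext0 patchE; case: ifP. Qed.

Lemma cintegral_ext0 D f : cintegral D f = cintegral setT (ext0 D f).
Proof.
have [e1 e2] := ext0_patch D f.
by rewrite /cintegral Rintegral_mkcond -e1 [X in _ +i* X]Rintegral_mkcond -e2.
Qed.

Lemma cintegrable_ext0 D f : measurable D -> cintegrable D f <-> cintegrable setT (ext0 D f).
Proof.
move=> mD; have [e1 e2] := ext0_patch D f.
have h (g : R -> R) : mu.-integrable D (fun t => (g t)%:E) <->
    mu.-integrable setT (fun t => ((g \_ D) t)%:E).
  by have := @integrable_mkcond _ _ R mu D (EFin \o g) mD; rewrite restrict_EFin.
rewrite /cintegrable; rewrite !h.
split=> -[].
- by rewrite -e1 -e2.
- by rewrite -e1 -e2.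
Qed.

(** Substitution in the form in which it is used: the second factor is
    extended by 0, the first one is restricted by the domain of integration. *)
Lemma cintegral_subst D A f phi c (s : R) M : (s = 1) \/ (s = -1) ->
  measurable D -> measurable A -> cintegrable A f -> cmeas setT phi ->
  (forall x, D x -> cabs (phi x) <= M) ->
  cintegrable D (fun x => phi x * ext0 A f (c + s * x)) /\
  cintegral D (fun x => phi x * ext0 A f (c + s * x)) =
  cintegral (A `&` [set t | D (s * (t - c))]) (fun t => phi (s * (t - c)) * f t).
Proof.
move=> s1 mD mA /(cintegrable_ext0 _ mA) intf [m1 m2] hM.
have ss : s * s = 1 by case: s1 => ->; rewrite ?mulrNN mul1r.
have [i1 _] := cintegral_affine c s1 intf.
have i2 := cintegrableS measurableT mD (@subsetT _ D) i1.
have i3 : cintegrable D (fun x => phi x * ext0 A f (c + s * x)).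
  by apply: cintegrableM hM i2 => //; split; apply: measurable_funTS.
split=> //.
rewrite cintegral_ext0 [RHS]cintegral_ext0.
have [_ <-] := cintegral_affine (s * - c) s1 ((cintegrable_ext0 _ mD).1 i3).
apply: eq_cintegral => t _.
rewrite -mulrDr addrC /ext0.
have e : c + s * (s * (t - c)) = t by rewrite mulrA ss mul1r addrC subrK.
have eD : (t \in [set t | D (s * (t - c))]) = (s * (t - c) \in D).
  by apply/idP/idP; rewrite !inE.
by rewrite e in_setI eD; case: (_ \in D); case: (t \in A); rewrite ?mulr0.
Qed.

End ComplexIntegral.

(** * Completeness of the even powers *)
Section Moments.
Context {R : realType}.
Implicit Types (x y t u : R) (n m : nat) (w : R -> R) (p : {poly R}).
Local Notation mu := (@lebesgue_measure R).

Lemma bernoulli_ge t m : 0 <= t <= 1 -> 1 - m%:R * t <= (1 - t) ^+ m.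
Proof.
move=> /andP[t0 t1]; elim: m => [|m IH]; first by rewrite mul0r subr0 expr0.
rewrite exprS (le_trans _ (ler_wpM2l _ IH)) ?subr_ge0//.
rewrite -natr1 -subr_ge0.
have -> : (1 - t) * (1 - m%:R * t) - (1 - (m%:R + 1) * t) = m%:R * t ^+ 2 by ring.
by rewrite mulr_ge0// sqr_ge0.
Qed.

Lemma bernoulli_le t m : 0 <= t <= 1 -> (1 - t) ^+ m * (1 + m%:R * t) <= 1.
Proof.
move=> /andP[t0 t1]; elim: m => [|m IH]; first by rewrite mul0r addr0 expr0 mulr1.
apply: le_trans IH.
rewrite exprSr -mulrA ler_wpM2l ?exprn_ge0 ?subr_ge0// -natr1 -subr_ge0.
have -> : 1 + m%:R * t - (1 - t) * (1 + (m%:R + 1) * t) = (m%:R + 1) * t ^+ 2 by ring.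
by rewrite mulr_ge0 ?addr_ge0// sqr_ge0.
Qed.

(** On [0,1] these polynomials in u tend to 1 for u < 1 / 2 and to 0 for
    u > 1 / 2, by the inequality of Bernoulli. *)
Definition step_pow n u := (1 - u ^+ n) ^+ (2 ^ n)%N.

Lemma step_pow_itv n u : 0 <= u <= 1 -> 0 <= step_pow n u <= 1.
Proof.
move=> /andP[u0 u1]; have h0 : 0 <= u ^+ n by rewrite exprn_ge0.
have h1 : u ^+ n <= 1 by rewrite exprn_ile1.
by rewrite /step_pow exprn_ge0 ?subr_ge0//= exprn_ile1 ?subr_ge0// gerBl.
Qed.

Lemma step_pow_lt u : 0 <= u < 1 / 2 -> step_pow n u @[n --> \oo] --> (1 : R).
Proof.
move=> /andP[u0 u1].
have c0 : (2 * u) ^+ n @[n --> \oo] --> (0 : R).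
  by apply: cvg_expr; rewrite ger0_norm ?mulr_ge0//; lra.
have c1 : 1 - (2 * u) ^+ n @[n --> \oo] --> (1 : R).
  by rewrite -[X in _ --> X]subr0; apply: cvgB => //; apply: cvg_cst.
apply: (@squeeze_cvgr _ _ _ _ (fun n => 1 - (2 * u) ^+ n) (fun=> 1) _ _ _ c1); last exact: cvg_cst.
apply: nearW => n.
have u01 : 0 <= u <= 1 by rewrite u0 /=; lra.
have /andP[_ ->] := step_pow_itv n u01; rewrite andbT.
have t01 : 0 <= u ^+ n <= 1 by rewrite exprn_ge0// exprn_ile1//; lra.
by rewrite (le_trans _ (bernoulli_ge _ t01))// natrX exprMn.
Qed.

Lemma step_pow_gt u : 1 / 2 < u <= 1 -> step_pow n u @[n --> \oo] --> (0 : R).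
Proof.
move=> /andP[u0 u1].
have c0 : ((2 * u)^-1) ^+ n @[n --> \oo] --> (0 : R).
  apply: cvg_expr; rewrite ger0_norm ?invr_ge0 ?mulr_ge0//; last by lra.
  by rewrite invf_lt1; lra.
apply: (@squeeze_cvgr _ _ _ _ (fun=> 0) (fun n => (2 * u)^-1 ^+ n) _ _ _ _ c0); last exact: cvg_cst.
apply: nearW => n.
have u01 : 0 <= u <= 1 by apply/andP; split; lra.
have /andP[-> _] := step_pow_itv n u01; rewrite /=.
have t01 : 0 <= u ^+ n <= 1 by rewrite exprn_ge0 ?exprn_ile1//; lra.
have u2 : 0 < (2 * u) ^+ n by rewrite exprn_gt0//; lra.
rewrite exprVn -[leRHS]mul1r ler_pdivlMr//.
apply: le_trans (bernoulli_le (2 ^ n) t01).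
rewrite ler_wpM2l//; first by have /andP[] := step_pow_itv n u01.
by rewrite natrX -exprMn lerDr.
Qed.

Lemma integrable_mul01 (D : set R) (h : R -> R) w : measurable D -> measurable_fun D h ->
  (forall x, D x -> 0 <= h x <= 1) -> mu.-integrable D (EFin \o w) ->
  mu.-integrable D (EFin \o (fun x => h x * w x)).
Proof.
move=> mD mh h01 iw; rewrite /comp; under eq_fun do rewrite EFinM.
apply: integrableMr => //; exists 1; split=> // M M1 x Dx /=.
by have /andP[h0 h1] := h01 x Dx; rewrite ger0_norm// (le_trans h1)// ltW.
Qed.

Lemma integrable_scale (D : set R) (k : R) w : measurable D -> mu.-integrable D (EFin \o w) ->
  mu.-integrable D (EFin \o (fun x => k * w x)).
Proof.
by move=> mD iw; rewrite /comp; under eq_fun do rewrite EFinM; apply: integrableZl.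
Qed.

Lemma integral_comb0 (D : set R) (F : nat -> R -> R) (c : nat -> R) m : measurable D ->
  (forall n, mu.-integrable D (EFin \o F n)) -> (forall n, \int[mu]_(x in D) F n x = 0) ->
  mu.-integrable D (EFin \o (fun x => \sum_(i < m) c i * F i x)) /\
  \int[mu]_(x in D) (\sum_(i < m) c i * F i x) = 0.
Proof.
move=> mD iF hF; elim: m => [|m [i1 h1]].
  rewrite /comp; under eq_fun do rewrite big_ord0.
  under eq_Rintegral do rewrite big_ord0.
  by split; [exact: integrable0|rewrite /Rintegral integral0].
have iZ := integrable_scale (c m) mD (iF m).
rewrite /comp; under eq_fun do rewrite big_ord_recr /= EFinD.
under eq_Rintegral do rewrite big_ord_recr /=.
split; first exact: integrableD iZ.
by rewrite RintegralD// h1 add0r RintegralZl// hF mulr0.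
Qed.

Lemma poly_moments w p : mu.-integrable `]0, 1[ (EFin \o w) ->
  (forall n, \int[mu]_(x in `]0, 1[) (x ^+ (2 * n) * w x) = 0) ->
  \int[mu]_(x in `]0, 1[) (p.[x ^+ 2] * w x) = 0.
Proof.
move=> iw hw.
have ipow n : mu.-integrable `]0, 1[ (EFin \o (fun x => x ^+ (2 * n) * w x)).
  apply: integrable_mul01 => // x.
  rewrite /= in_itv /= => /andP[x0 x1].
  by rewrite exprn_ge0 ?exprn_ile1 ?ltW.
have [_ h] := integral_comb0 (fun i => p`_i) (size p) (measurable_itv _) ipow hw.
rewrite -[RHS]h.
apply: eq_Rintegral => x _; rewrite horner_coef mulr_suml.
by apply: eq_bigr => i _; rewrite -exprM mulrA.
Qed.

(** For u = (1 + x ^ 2 - y ^ 2) / 2, the polynomials [step_pow n u] in x ^ 2 tend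
    boundedly to the indicator function of x < y. *)
Lemma integral_prefix w y : mu.-integrable `]0, 1[ (EFin \o w) ->
  (forall n, \int[mu]_(x in `]0, 1[) (x ^+ (2 * n) * w x) = 0) ->
  0 < y < 1 -> \int[mu]_(x in `]0, 1[) (if x <= y then w x else 0) = 0.
Proof.
move=> iw hw /andP[y0 y1].
pose U x := (1 + x ^+ 2 - y ^+ 2) / 2.
have U01 x : 0 < x < 1 -> 0 <= U x <= 1.
  move=> /andP[x0 x1].
  have hx : x ^+ 2 <= 1 by rewrite exprn_ile1 ?ltW.
  have hy : y ^+ 2 <= 1 by rewrite exprn_ile1 ?ltW.
  by have := sqr_ge0 x; have := sqr_ge0 y; rewrite /U => *; apply/andP; split; lra.
pose p n : {poly R} := (1 - (2^-1 *: 'X + ((1 - y ^+ 2) / 2)%:P) ^+ n) ^+ (2 ^ n).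
have pE n x : (p n).[x ^+ 2] = step_pow n (U x).
  rewrite /p /step_pow !(hornerE, horner_exp).
  by congr ((1 - _ ^+ n) ^+ _); rewrite /U /=; field.
pose f n x := (step_pow n (U x) * w x)%:E.
have mw : measurable_fun (`]0, 1[%classic : set R) (EFin \o w) by exact: measurable_int iw.
have mwr : measurable_fun (`]0, 1[%classic : set R) w by apply/measurable_EFinP.
have mU : measurable_fun (`]0, 1[%classic : set R) U.
  apply: measurable_funM => //; apply: measurable_funB => //; apply: measurable_funD => //.
have mf n : measurable_fun (`]0, 1[%classic : set R) (f n).
  apply/measurable_EFinP; apply: measurable_funM => //.
  apply: measurable_funX; apply: measurable_funB => //; exact: measurable_funX.
have mg : measurable_fun (`]0, 1[%classic : set R) (fun x => (if x <= y then w x else 0)%:E).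
  apply/measurable_EFinP; apply: measurable_fun_if => //; first exact: measurable_fun_ler.
  by apply: measurable_funS mwr => //; exact: subIsetl.
have cv : \forall x \ae mu, (`]0, 1[%classic : set R) x ->
    f n x @[n --> \oo] --> (if x <= y then w x else 0)%:E.
  exists [set y]; split; [exact: measurable_set1|exact: lebesgue_measure_set1|].
  move=> x /= h; apply: contrapT => xy; apply: h.
  rewrite in_itv /= => x01; apply: cvg_EFin; first exact: nearW.
  rewrite /f /comp /=.
  have U0 := U01 x x01; case/andP: (x01) => x0 x1.
  case: leP => xly.
  - rewrite -[X in _ --> X]mul1r; apply: cvgM; last exact: cvg_cst.
    apply: step_pow_lt; case/andP: U0 => -> _ /=.
    by rewrite /U ltr_pM2r ?invr_gt0// ltrBlDr ltrD2l ltrXn2r ?nnegrE ?(ltW x0) ?(ltW y0)// lt_neqAle xly andbT; apply/eqP.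
  - rewrite -[X in _ --> X](mul0r (w x)); apply: cvgM; last exact: cvg_cst.
    apply: step_pow_gt; case/andP: U0 => _ ->; rewrite andbT.
    by rewrite /U ltr_pM2r ?invr_gt0// ltrBrDr ltrD2l ltrXn2r ?nnegrE ?ltW.
have dom : \forall x \ae mu, forall n, (`]0, 1[%classic : set R) x -> (`|f n x| <= `|(w x)%:E|)%E.
  apply: aeW => x n /=; rewrite in_itv /= => x01.
  have /andP[s0 s1] := step_pow_itv n (U01 x x01).
  by rewrite lee_fin normrM (ger0_norm s0) ler_piMl.
have iabs : mu.-integrable `]0, 1[ (fun x => `|(w x)%:E|)%E by exact: integrable_abse.
have [_ _ h] := @dominated_convergence _ _ R mu _ (measurable_itv _) f _ _ mf mg cv iabs dom.
have e n : (\int[mu]_(x in `]0%R, 1%R[) f n x = 0)%E.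
  have inf : mu.-integrable `]0, 1[ (f n).
    apply: integrable_mul01 => // [|x /=]; last by rewrite in_itv /= => x01; apply/step_pow_itv/U01.
    by apply: measurable_funX; apply: measurable_funB => //; exact: measurable_funX.
  have := poly_moments (p n) iw hw; rewrite /Rintegral.
  under eq_integral do rewrite pE.
  by move=> h0; rewrite -[LHS]fineK ?h0//; apply: integrable_fin_num.
rewrite /Rintegral.
rewrite (_ : (fun n => _) = fun=> 0%E) in h; last by apply/funext.
by rewrite -(cvg_lim _ h)// lim_cst.
Qed.

(** The primitive of w vanishes by [integral_prefix], hence so does w by the
    differentiation theorem of Lebesgue. *)
Lemma moments_ae0 w : mu.-integrable `]0, 1[ (EFin \o w) ->
  (forall n, \int[mu]_(x in `]0, 1[) (x ^+ (2 * n) * w x) = 0) ->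
  \forall x \ae mu, (`]0, 1[%classic : set R) x -> w x = 0.
Proof.
move=> iw hw.
pose w0 := w \_ `]0, 1[.
have iw0 : mu.-integrable setT (EFin \o w0).
  have := @integrable_mkcond _ _ R mu `]0, 1[%classic (EFin \o w) (measurable_itv _).
  by rewrite restrict_EFin => -[h _]; apply: h.
have lw0 : locally_integrable setT w0 by apply: integrable_locally => //; exact: openT.
have iNy y : mu.-integrable `]-oo, y] (EFin \o w0) by apply: integrableS iw0.
have := FTC1Ny iNy lw0.
apply: (@filterS _ _ (ae_filter_ringOfSetsType mu)) => x [dF Fx] /= x01.
have F0 y : 0 < y < 1 -> \int[mu]_(t in `]-oo, y]) w0 t = 0.
  move=> y01; rewrite -[RHS](integral_prefix iw hw y01).
  rewrite -Rintegral_mkcondr setIC Rintegral_mkcondr.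
  apply: eq_Rintegral => t _; rewrite patchE.
  by have -> : (t \in [set` `]-oo, y]]) = (t <= y) by apply/idP/idP; rewrite inE /= in_itv.
have wx : w0 x = w x by rewrite /w0 patchE mem_set.
rewrite -wx -Fx; apply: cvg_lim => //; apply: cvg_near_cst.
have x0 : 0 < x by move: x01; rewrite in_itv => /andP[].
have x1 : x < 1 by move: x01; rewrite in_itv => /andP[].
have d0 : 0 < Num.min x (1 - x) by rewrite lt_min x0 subr_gt0.
near=> h.
have : `|h| < Num.min x (1 - x) by near: h; exact: dnbhs0_lt.
rewrite lt_min => /andP[]; rewrite !ltr_norml => /andP[h1 h2] /andP[h3 h4].
by rewrite !F0 ?subrr ?scaler0//; apply/andP; split; lra.
Unshelve. all: by end_near. Qed.

End Moments.

(** * The solutions at the end points *)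
Section CsolDerivative.
Context {R : realType}.
Implicit Types (lam : R[i]) (x t h a : R) (D : set R) (q : R -> R[i]).
Local Notation mu := (@lebesgue_measure R).

Lemma cosrho_cmeas D lam (g : R -> R) : measurable D ->
  (forall x, derivable g x 1) -> cmeas D (fun t => cosrho lam (g t)).
Proof.
move=> mD dg; apply: (@rder_cmeas _ _ _ (fun t => ('D_1 g t)%:C * (- lam * sinrho lam (g t)))) => // x.
by apply: rder_comp; [exact: rder_cosrho|exact: derivableP].
Qed.

Lemma sinrho_cmeas D lam (g : R -> R) : measurable D ->
  (forall x, derivable g x 1) -> cmeas D (fun t => sinrho lam (g t)).
Proof.
move=> mD dg; apply: (@rder_cmeas _ _ _ (fun t => ('D_1 g t)%:C * cosrho lam (g t))) => // x.
by apply: rder_comp; [exact: rder_sinrho|exact: derivableP].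
Qed.

Lemma derivable_subl x : forall t, derivable (fun t : R => x - t) t 1.
Proof. by move=> t; apply: derivableB; [exact: derivable_cst|exact: derivable_id]. Qed.

(** Absolute continuity of the integral. *)
Lemma lnorm_small D q : measurable D -> cintegrable D q -> forall e, 0 < e ->
  exists2 r, 0 < r & forall A, measurable A -> A `<=` D -> (mu A < r%:E)%E -> lnorm A q <= e.
Proof.
move=> mD intq e e0.
have i0 : mu.-integrable setT (EFin \o ((fun t => `|complex.Re (q t)| + `|complex.Im (q t)|) \_ D)).
  have := @integrable_mkcond _ _ R mu D (EFin \o (fun t => `|complex.Re (q t)| + `|complex.Im (q t)|)) mD.
  by rewrite restrict_EFin => -[h _]; apply: h; apply: lnorm_integrable.
have [r [r0 hr]] := integral_normr_continuous i0 e0.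
exists r => // A mA AD Ar; apply: le_trans (ltW (hr A mA Ar)).
rewrite le_eqVlt; apply/orP; left; apply/eqP; apply: eq_Rintegral => t /set_mem/AD Dt.
by rewrite patchE mem_set// [RHS]ger0_norm ?addr_ge0.
Qed.

(** The derivative at x of the integral of s(y - t) q(t) over D minus a part E
    that shrinks to the point x with y: the contribution of E is o(y - x) as
    s(0) = 0. *)
Lemma rder_moving_integral lam D (E : R -> set R) q (F : R -> R[i]) x :
  measurable D -> (forall t, D t -> `|x - t| <= 1) -> cintegrable D q ->
  (exists2 r0 : R, 0 < r0 & forall h, `|h| <= r0 ->
    [/\ measurable (E h), E h `<=` D, (mu (E h) <= `|h|%:E)%E,
      forall t, E h t -> `|x + h - t| <= `|h| &
      F (x + h) = cintegral D (fun t => sinrho lam (x + h - t) * q t)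
                - cintegral (E h) (fun t => sinrho lam (x + h - t) * q t)]) ->
  rder F x (cintegral D (fun t => cosrho lam (x - t) * q t)).
Proof.
move=> mD D1 intq [r0 r00 hE]; apply: rder_expansion => e e0.
have [K K0 hK] := fundamental_near0 lam.
have L0 := lnorm_ge0 D q.
have e1 : 0 < e / (4 * (K + 1)) by rewrite divr_gt0// mulr_gt0// ltr_wpDl.
have [r1 r10 hr1] := lnorm_small mD intq e1.
pose K2 := 2 * (K * K + K * K) * lnorm D q + 1.
have K20 : 0 < K2 by rewrite /K2 ltr_wpDl// mulr_ge0// mulr_ge0// addr_ge0 ?mulr_ge0.
pose r := Num.min (Num.min r0 (r1 / 2)) (Num.min 1 (e / (2 * K2))).
have rpos : 0 < r by rewrite /r !lt_min r00 ltr01 !divr_gt0// mulr_gt0.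
exists r => // h; rewrite /r !le_min => /andP[/andP[h0 h1] /andP[h2 h3]].
have [mE ED muE nearE FE] := hE h h0.
have h00 : `|0 : R| <= r0 by rewrite normr0 ltW.
have [mE0 E0D muE0 nearE0 FE0] := hE 0 h00.
have i_s y (A : set R) : measurable A -> A `<=` D -> (forall t, A t -> `|y - t| <= 1) ->
    cintegrable A (fun t => sinrho lam (y - t) * q t).
  move=> mA AD hA; apply: (cintegrableM (M := K)) => //.
  - by apply: sinrho_cmeas => //; apply: derivable_subl.
  - move=> t At; have [_ h' _ _] := hK _ (hA t At).
    by rewrite (le_trans h')// ler_piMr// hA.
  - exact: cintegrableS intq.
have F0 : F x = cintegral D (fun t => sinrho lam (x - t) * q t).
  rewrite -{1}(addr0 x) FE0 addr0 [X in _ - X](_ : _ = 0) ?subr0//.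
  rewrite -[RHS](cintegral0 (E 0)); apply: eq_cintegral => t /nearE0.
  by rewrite addr0 normr0 normr_le0 => /eqP ->; rewrite sinrho0 mul0r.
have D2 t : D t -> cabs (cosrho lam (x - t)) <= K /\ cabs (sinrho lam (x - t)) <= K.
  move=> Dt; have [c s _ _] := hK _ (D1 t Dt); split=> //.
  by rewrite (le_trans s)// ler_piMr// D1.
have [ch sh ch1 sh1] := hK h h2.
have expand t : sinrho lam (x + h - t) = sinrho lam (x - t) + h%:C * cosrho lam (x - t) +
    ((cosrho lam h - 1) * sinrho lam (x - t) + (sinrho lam h - h%:C) * cosrho lam (x - t)).
  by rewrite {1}(_ : x + h - t = x - t + h) ?sinrhoD; ring.
have i1 := i_s x D mD (@subset_refl _ D) D1.
have i2 : cintegrable D (fun t => cosrho lam (x - t) * q t).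
  apply: (cintegrableM (M := K)) => //; last by move=> t /D2[].
  by apply: cosrho_cmeas => //; apply: derivable_subl.
pose rest t := (cosrho lam h - 1) * sinrho lam (x - t) + (sinrho lam h - h%:C) * cosrho lam (x - t).
have mrest : cmeas D rest.
  apply: (@rder_cmeas _ _ _ (fun t => (cosrho lam h - 1) * ((-1)%:C * cosrho lam (x - t)) +
    (sinrho lam h - h%:C) * ((-1)%:C * (- lam * sinrho lam (x - t))))) => // t.
  have dx : is_derive t 1 (fun t : R => x - t) (-1).
    by apply: (is_derive_eq (is_deriveB (is_derive_cst x t 1) (is_derive_id t 1))); rewrite sub0r.
  by apply: rderD; apply: rderZ; apply: rder_comp dx; [exact: rder_sinrho|exact: rder_cosrho].
have brest t : D t -> cabs (rest t) <= (K * K + K * K) * h ^+ 2.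
  move=> /D2[c s].
  have hA := ler_pM (cabs_ge0 _) (cabs_ge0 _) ch1 s.
  have hB := ler_pM (cabs_ge0 _) (cabs_ge0 _) sh1 c.
  have -> : (K * K + K * K) * h ^+ 2 = K * h ^+ 2 * K + K * h ^+ 2 * K by ring.
  by rewrite /rest (le_trans (cabsD _ _))// lerD// cabsM.
have i3 := cintegrableM mD mrest brest intq.
have main : cintegral D (fun t => sinrho lam (x + h - t) * q t) = F x +
    h%:C * cintegral D (fun t => cosrho lam (x - t) * q t) +
    cintegral D (fun t => rest t * q t).
  rewrite F0 -cintegralZ// -cintegralD//; last exact: cintegrableZ.
  rewrite -cintegralD//; last by apply: cintegrableD => //; exact: cintegrableZ.
  by apply: eq_cintegral => t _; rewrite expand /rest; ring.
have -> : F (x + h) - F x - h%:C * cintegral D (fun t => cosrho lam (x - t) * q t) =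
    cintegral D (fun t => rest t * q t) -
    cintegral (E h) (fun t => sinrho lam (x + h - t) * q t).
  by rewrite FE main; ring.
rewrite (le_trans (cabsB _ _))//.
have nE t : E h t -> `|x + h - t| <= 1 by move=> /nearE/le_trans; apply.
have b1 : cabs (cintegral D (fun t => rest t * q t)) <= e / 2 * `|h|.
  rewrite (le_trans (cintegralM_le mD mrest brest intq))//.
  rewrite -[h ^+ 2]real_normK ?num_real// expr2 !mulrA.
  rewrite [X in X <= _](_ : _ = (2 * (K * K + K * K) * lnorm D q * `|h|) * `|h|); last by ring.
  rewrite ler_wpM2r// (le_trans (_ : _ <= K2 * `|h|))//.
    by rewrite ler_wpM2r// /K2 lerDl.
  by rewrite mulrC -ler_pdivlMr// (le_trans h3)// invfM mulrA.
have muE1 : (mu (E h) < r1%:E)%E.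
  rewrite (le_lt_trans muE)// lte_fin (le_lt_trans h1)// ltr_pdivrMr// mulr_natr mulr2n.
  by rewrite ltrDl.
have b2 : cabs (cintegral (E h) (fun t => sinrho lam (x + h - t) * q t)) <= e / 2 * `|h|.
  have intE := cintegrableS mD mE ED intq.
  have bs t : E h t -> cabs (sinrho lam (x + h - t)) <= K * `|h|.
    move=> Et; have [_ s _ _] := hK _ (nE t Et).
    by rewrite (le_trans s)// ler_wpM2l// nearE.
  have ms : cmeas (E h) (fun t => sinrho lam (x + h - t)).
    by apply: sinrho_cmeas => //; apply: derivable_subl.
  rewrite (le_trans (cintegralM_le mE ms bs intE))//.
  rewrite (le_trans (ler_wpM2l _ (hr1 (E h) mE ED muE1)))//; first by rewrite !mulr_ge0.
  rewrite [X in X <= _](_ : _ = K / (K + 1) * (e / 2 * `|h|)); last first.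
    by field; rewrite gt_eqF// ltr_wpDl.
  rewrite ler_piMl ?mulr_ge0 ?invr_ge0 ?(ltW e0)//.
  by rewrite ler_pdivrMr ?ltr_wpDl// mul1r lerDl.
by apply: (le_trans (lerD b1 b2)); rewrite -mulrDl -splitr.
Qed.

Lemma in_oo (b c t : R) : (t \in `]b, c[) = (b < t) && (t < c).
Proof. by rewrite in_itv. Qed.

Lemma in_oc (b c t : R) : (t \in `]b, c]) = (b < t) && (t <= c).
Proof. by rewrite in_itv. Qed.

Lemma in_co (b c t : R) : (t \in `[b, c[) = (b <= t) && (t < c).
Proof. by rewrite in_itv. Qed.

Definition in_itvR := (in_oo, in_oc, in_co).

Lemma sub_itv (i j : interval R) : (forall t : R, t \in i -> t \in j) ->
  [set` i] `<=` [set` j].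
Proof. by []. Qed.

Lemma eq_itvU (i j l : interval R) : (forall t : R, (t \in i) = (t \in j) || (t \in l)) ->
  [set` i] = [set` j] `|` [set` l].
Proof.
move=> h; apply/seteqP; split=> t /=; first by rewrite h => /orP[]; [left|right].
by rewrite h => -[->|->]; rewrite ?orbT.
Qed.

Lemma eq_itvI (i j l : interval R) : (forall t : R, (t \in j) && (t \in l) = (t \in i)) ->
  [set` j] `&` [set` l] = [set` i].
Proof.
move=> h; apply/seteqP; split=> t /=; first by case=> h1 h2; rewrite -h h1.
by rewrite -h => /andP[].
Qed.

Lemma disjoint_itv (i j : interval R) : (forall t : R, t \in i -> t \in j -> False) ->
  [disjoint [set` i] & [set` j]].
Proof. by move=> h; apply/eqP/seteqP; split=> t //= -[]; exact: h. Qed.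

Lemma setI_itv01 (b c : R) : 0 <= b -> c <= 1 ->
  (`]b, c[%classic `&` `]0, 1[%classic : set R) = `]b, c[%classic.
Proof.
move=> b0 c1; apply: eq_itvI => t; rewrite !in_itvR /=.
by apply/andP/idP => [[]//|/andP[h1 h2]]; split; [rewrite h1|apply/andP; split; lra].
Qed.

Lemma sub0a a : a < 1 -> `]0, a[ `<=` (`]0, 1[%classic : set R).
Proof. by move=> a1 t /=; rewrite !in_itvR /= => /andP[-> h]; exact: lt_trans a1. Qed.

Lemma suba1 a : 0 < a -> `]a, 1[ `<=` (`]0, 1[%classic : set R).
Proof.
by move=> a0 t /=; rewrite !in_itvR /= => /andP[h ->]; rewrite andbT; exact: lt_trans h.
Qed.

Variables (lam : R[i]) (a : R) (q : R -> R[i]).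
Hypotheses (a0 : 0 < a) (a1 : a < 1) (intq : L1 1 q).

Lemma sinrho_integrable (A : set R) x : measurable A -> A `<=` `]0, 1[ -> 0 <= x <= 1 ->
  cintegrable A (fun t => sinrho lam (x - t) * q t).
Proof.
move=> mA A01 /andP[x0 x1]; have [K K0 hK] := fundamental_near0 lam.
apply: (cintegrableM (M := K)) => //; last exact: cintegrableS intq.
- by apply: sinrho_cmeas => //; apply: derivable_subl.
- move=> t /A01; rewrite /= !in_itvR /= => /andP[t0 t1].
  have xt : `|x - t| <= 1 by rewrite ler_norml; apply/andP; split; lra.
  by have [_ s _ _] := hK _ xt; rewrite (le_trans s)// ler_piMr.
Qed.

Lemma Csol_at0 : Csol q a 0 lam =
  cosrho lam a + cintegral `]0, a[ (fun t => sinrho lam t * q t).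
Proof.
rewrite /Csol sub0r cosrhoN /oint01 leNgt a0 /= setI_itv01 ?(ltW a1)//; congr (_ + _).
rewrite -mulN1r -cintegralZ//.
  by apply: eq_cintegral => t _; rewrite sub0r sinrhoN; ring.
by apply: sinrho_integrable; [|exact: sub0a|rewrite lexx ler01].
Qed.

Lemma Csol_at1 : Csol q a 1 lam =
  cosrho lam (1 - a) + cintegral `]a, 1[ (fun t => sinrho lam (1 - t) * q t).
Proof. by rewrite /Csol /oint01 (ltW a1) setI_itv01 ?(ltW a0). Qed.

Lemma is_derive_subr (x : R) : is_derive x 1 (fun t : R => t - a) 1.
Proof.
by apply: (is_derive_eq (is_deriveB (is_derive_id x 1) (is_derive_cst a x 1))); rewrite subr0.
Qed.

(** As q is extended by 0, the integral from a to h is, up to the sign, the one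
    over ]0,a[ minus the one over ]0,h], also if h <= 0; likewise at 1. *)
Lemma dCsol_at0 : cderive 1 (fun x => Csol q a x lam) 0 =
  lam * sinrho lam a - cintegral `]0, a[ (fun t => cosrho lam t * q t).
Proof.
have p0 := a0; have p1 := a1; apply: cderive1E.
have near0a (t : R) : t \in `]0, a[ -> `|0 - t| <= 1.
  by rewrite !in_itvR /= => /andP[t0 ta]; rewrite ler_norml; apply/andP; split; lra.
pose F x := - oint01 a x (fun t => sinrho lam (x - t) * q t).
have dF : rder F 0 (cintegral `]0, a[ (fun t => cosrho lam (0 - t) * q t)).
  apply: (@rder_moving_integral lam _ (fun h => `]0, h]%classic)) => //.
    exact: cintegrableS (sub0a a1) intq.
  exists (a / 2); first by rewrite divr_gt0.
  move=> h; rewrite ler_norml => /andP[h1 h2].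
  split=> //.
  - by apply: sub_itv => t; rewrite !in_itvR /= => /andP[-> th] /=; lra.
  - rewrite lebesgue_measure_itv /= lte_fin; case: ltP => h0; last by rewrite lee_fin.
    by rewrite sube0 lee_fin ler_norm.
  - move=> t /=; rewrite !in_itvR /= => /andP[t0 th].
    rewrite add0r !ger0_norm ?subr_ge0 ?lerBlDr ?lerDl ?(ltW t0)//.
    exact: le_trans (ltW t0) th.
  rewrite /F add0r /oint01 leNgt (_ : h < a); last by lra.
  rewrite opprK; have [h0|h0] := ltP 0 h.
  - rewrite setI_itv01 ?(ltW h0) ?(ltW a1)//.
    have e : `]0, a[%classic = `]0, h] `|` (`]h, a[%classic : set R).
      apply: eq_itvU => t; rewrite !in_itvR /=.
      by apply/idP/orP => [/andP[t0 ta]|[]/andP[t0 ta]];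
        [case: (leP t h) => th; [left|right]; apply/andP; split|apply/andP; split; lra..].
    rewrite e cintegral_setU//; first by rewrite addrAC subrr add0r.
    + rewrite -e; apply: sinrho_integrable => //; first exact: sub0a.
      by rewrite (ltW h0) /=; lra.
    + apply: disjoint_itv => t; rewrite !in_itvR /= => /andP[_ th] /andP[ht _].
      by move: (lt_le_trans ht th); rewrite ltxx.
  - have -> : `]h, a[ `&` `]0, 1[ = (`]0, a[%classic : set R).
      apply: eq_itvI => t; rewrite !in_itvR /=.
      by apply/andP/idP => [[/andP[ht ta] /andP[t0 t1]]|/andP[t0 ta]]; [rewrite t0|split; apply/andP; split; lra].
    have -> : `]0, h]%classic = set0 :> set R by rewrite set_itv_ge// bnd_simp -leNgt.
    by rewrite [X in _ - X](_ : _ = 0) ?subr0// /cintegral !Rintegral_set0.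
have := rderB (@rder_comp _ (cosrho lam) (fun x => x - a) 0 _ _ (rder_cosrho lam _) (is_derive_subr 0)) dF.
have -> : cintegral `]0, a[ (fun t => cosrho lam (0 - t) * q t) =
    cintegral `]0, a[ (fun t => cosrho lam t * q t).
  by apply: eq_cintegral => t _; rewrite sub0r cosrhoN.
rewrite mul1r sub0r sinrhoN mulrNN.
rewrite (_ : (fun x => cosrho lam (x - a) - F x) = (fun x => Csol q a x lam))//.
by apply/funext => x; rewrite /Csol /F opprK.
Qed.

Lemma dCsol_at1 : cderive 1 (fun x => Csol q a x lam) 1 =
  - lam * sinrho lam (1 - a) + cintegral `]a, 1[ (fun t => cosrho lam (1 - t) * q t).
Proof.
have p0 := a0; have p1 := a1; apply: cderive1E.
have near1a (t : R) : t \in `]a, 1[ -> `|1 - t| <= 1.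
  by rewrite !in_itvR /= => /andP[t0 ta]; rewrite ler_norml; apply/andP; split; lra.
pose F x := oint01 a x (fun t => sinrho lam (x - t) * q t).
have dF : rder F 1 (cintegral `]a, 1[ (fun t => cosrho lam (1 - t) * q t)).
  apply: (@rder_moving_integral lam _ (fun h => `[1 + h, 1[%classic)) => //.
    exact: cintegrableS (suba1 a0) intq.
  exists ((1 - a) / 2); first by rewrite divr_gt0// subr_gt0.
  move=> h; rewrite ler_norml => /andP[h1 h2].
  have nearE (t : R) : t \in `[1 + h, 1[ -> `|1 + h - t| <= `|h|.
    by rewrite !in_itvR /= => /andP[t0 th]; rewrite !ler0_norm; lra.
  split=> //.
  - by apply: sub_itv => t; rewrite !in_itvR /= => /andP[th ->]; rewrite andbT; lra.
  - rewrite lebesgue_measure_itv /= lte_fin; case: ltP => h0; last by rewrite lee_fin.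
    by rewrite -EFinB lee_fin opprD addrA subrr add0r -normrN ler_norm.
  rewrite /F /oint01 (_ : a <= 1 + h); last by lra.
  have [h0|h0] := ltP h 0.
  - rewrite setI_itv01 ?(ltW a0)//; last by lra.
    have e : `]a, 1[%classic = `]a, 1 + h[ `|` (`[1 + h, 1[%classic : set R).
      apply: eq_itvU => t; rewrite !in_itvR /=.
      by apply/idP/orP => [/andP[t0 ta]|[]/andP[t0 ta]];
        [case: (ltP t (1 + h)) => th; [left|right]; apply/andP; split|apply/andP; split; lra..].
    rewrite e cintegral_setU//; first by rewrite addrK.
    + rewrite -e; apply: sinrho_integrable => //; first exact: suba1.
      by apply/andP; split; lra.
    + apply: disjoint_itv => t; rewrite !in_itvR /= => /andP[_ th] /andP[ht _].
      by move: (lt_le_trans th ht); rewrite ltxx.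
  - have -> : `]a, 1 + h[ `&` `]0, 1[ = (`]a, 1[%classic : set R).
      apply: eq_itvI => t; rewrite !in_itvR /=.
      by apply/andP/idP => [[/andP[ht ta] /andP[t0 t1]]|/andP[t0 ta]]; [rewrite ht|split; apply/andP; split; lra].
    have -> : `[1 + h, 1[%classic = set0 :> set R by rewrite set_itv_ge// bnd_simp -leNgt lerDl.
    by rewrite [X in _ - X](_ : _ = 0) ?subr0// /cintegral !Rintegral_set0.
have := rderD (@rder_comp _ (cosrho lam) (fun x => x - a) 1 _ _ (rder_cosrho lam _) (is_derive_subr 1)) dF.
by rewrite mul1r.
Qed.

Lemma Ssol_derive (x : R) : cderive 1 (fun y => Ssol a y lam) x = cosrho lam (x - a).
Proof.
apply: cderive1E.
have := @rder_comp _ (sinrho lam) (fun x => x - a) x _ _ (rder_sinrho lam _) (is_derive_subr x).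
by rewrite mul1r.
Qed.

End CsolDerivative.

(** * The folded potential *)
Section CharacteristicFunction.
Context {R : realType}.
Implicit Types (lam : R[i]) (x t u v a : R) (q : R -> R[i]) (alpha beta : nat).
Local Notation mu := (@lebesgue_measure R).

(** The sign of the reflection at an end point with the boundary condition
    y^(alpha) = 0. *)
Definition eps alpha : R[i] := if alpha is 0 then -1 else 1.

(** The solution with value 0, respectively derivative 0, at 0: it satisfies the
    boundary condition y^(alpha) = 0 there. *)
Definition fund alpha lam x : R[i] := if alpha is 0 then sinrho lam x else cosrho lam x.

Lemma eps2 alpha : eps alpha * eps alpha = 1.
Proof. by case: alpha => [|n] /=; rewrite ?mulrNN mul1r. Qed.

Lemma trigserN alpha beta lam x : (alpha <= 1)%N -> (beta <= 1)%N ->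
  trigser (2 - (alpha + beta)) lam (- x) =
  eps alpha * eps beta * trigser (2 - (alpha + beta)) lam x.
Proof.
case: alpha => [|[|//]] _; case: beta => [|[|//]] _ /=;
  rewrite ?mulNr ?sinrhoN ?cosrhoN ?sqrrN; ring.
Qed.

Lemma product_to_sum alpha beta lam u v : (alpha <= 1)%N -> (beta <= 1)%N ->
  2 * (fund beta lam u * fund alpha lam v) =
  trigser (2 - (alpha + beta)) lam (u + v) + eps alpha * trigser (2 - (alpha + beta)) lam (u - v).
Proof.
have h w : sinrho lam w = 2 * (sinrho lam (w / 2) * cosrho lam (w / 2)).
  by rewrite {1}[w]splitr sinrhoD; ring.
case: alpha => [|[|//]] _; case: beta => [|[|//]] _ /=.
- have -> : (u + v) / 2 = u / 2 + v / 2 by ring.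
  have -> : (u - v) / 2 = u / 2 - v / 2 by ring.
  by rewrite (h u) (h v) !sinrhoD sinrhoN cosrhoN; ring.
- rewrite !sinrhoD sinrhoN cosrhoN; ring.
- rewrite !sinrhoD sinrhoN cosrhoN; ring.
- rewrite !cosrhoD sinrhoN cosrhoN; ring.
Qed.

Lemma trigser_rder d lam : (d <= 2)%N -> exists f, forall x, rder (trigser d lam) x (f x).
Proof.
case: d => [|d] d2; first by exists (fun x => - lam * sinrho lam x) => x; exact: rder_cosrho.
by exists (trigser d lam) => x; exact: rder_trigser.
Qed.

Lemma trigser_cmeas d lam D : measurable D -> (d <= 2)%N -> cmeas D (trigser d lam).
Proof. by move=> mD d2; have [f hf] := trigser_rder lam d2; apply: rder_cmeas hf. Qed.

(** The combination of reflections and translations of q through which the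
    characteristic function depends on q: see [Delta_folded]. *)
Definition folded a alpha beta q x : R[i] :=
  let q0 := ext0 `]0, 1[ q in
  eps alpha * q0 (1 - a + -1 * x) + eps beta * q0 (1 - a + 1 * x) +
  q0 (a - 1 + 1 * x) + q0 (1 + a + -1 * x).

Lemma Delta_fund q a alpha beta lam : (alpha <= 1)%N -> (beta <= 1)%N -> 0 < a < 1 -> L1 1 q ->
  Delta q a alpha beta lam = - eps alpha * (leading (2 - (alpha + beta)) lam +
    (fund beta lam (1 - a) * cintegral `]0, a[ (fun t => fund alpha lam t * q t) +
     fund alpha lam a * cintegral `]a, 1[ (fun t => fund beta lam (1 - t) * q t))).
Proof.
move=> al bl /andP[a0 a1] intq; rewrite /Delta.
have e1 : (1 : R) = a + (1 - a) by rewrite addrC subrK.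
have hs : sinrho lam 1 = sinrho lam a * cosrho lam (1 - a) + cosrho lam a * sinrho lam (1 - a).
  by rewrite {1}e1 sinrhoD.
have hc : cosrho lam 1 = cosrho lam a * cosrho lam (1 - a) - lam * sinrho lam a * sinrho lam (1 - a).
  by rewrite {1}e1 cosrhoD.
by case: alpha al => [|[|//]] _; case: beta bl => [|[|//]] _;
  rewrite ?cderive0E ?dCsol_at0 ?dCsol_at1 ?Csol_at0 ?Csol_at1// ?Ssol_derive /Ssol
    ?sub0r ?sinrhoN ?cosrhoN /= ?hs ?hc;
  move: (cintegral _ _) => I; move: (cintegral _ _) => J;
  move: (sinrho lam a) (cosrho lam a) (sinrho lam (1 - a)) (cosrho lam (1 - a)) => *; ring.
Qed.

Lemma cintegral_split (b c m : R) q : b < m < c -> cintegrable `]b, c[ q ->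
  cintegral `]b, c[ q = cintegral `]b, m[ q + cintegral `]m, c[ q.
Proof.
move=> /andP[bm mc] intq.
have e : `]b, c[%classic = `]b, m] `|` (`]m, c[%classic : set R).
  apply: eq_itvU => t; rewrite !in_itvR /=.
  by apply/idP/orP => [/andP[t0 ta]|[]/andP[t0 ta]];
    [case: (leP t m) => th; [left|right]; apply/andP; split|apply/andP; split; lra..].
rewrite {1}e cintegral_setU//.
- congr (_ + _); rewrite /cintegral; have [i1 i2] := intq.
  have sub : `]b, m[ `<=` (`]b, c[%classic : set R).
    by apply: sub_itv => t; rewrite !in_itvR => /andP[-> tm] /=; exact: lt_trans mc.
  by rewrite !Rintegral_itv_bndo_bndc//; [exact: integrableS i2|exact: integrableS i1].
- by rewrite -e.
- apply: disjoint_itv => t; rewrite !in_itvR /= => /andP[_ th] /andP[ht _].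
  by move: (lt_le_trans ht th); rewrite ltxx.
Qed.

Lemma folded_term (E : R -> R[i]) M q c (s : R) (i : interval R) :
  (s = 1) \/ (s = -1) -> cmeas setT E -> (forall x, 0 <= x <= 1 -> cabs (E x) <= M) -> L1 1 q ->
  (forall t : R, (t \in `]0, 1[) && (s * (t - c) \in `]0, 1[) = (t \in i)) ->
  cintegrable `]0, 1[ (fun x => E x * ext0 `]0, 1[ q (c + s * x)) /\
  cintegral `]0, 1[ (fun x => E x * ext0 `]0, 1[ q (c + s * x)) =
  cintegral [set` i] (fun t => E (s * (t - c)) * q t).
Proof.
move=> s1 mE hM intq hi.
have hM' x : `]0, 1[%classic x -> cabs (E x) <= M.
  by rewrite /= in_oo => /andP[x0 x1]; apply: hM; rewrite !ltW.
have [h1 h2] := cintegral_subst c s1 (measurable_itv `]0%R, 1%R[) (measurable_itv `]0%R, 1%R[)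
  intq mE hM'.
split=> //; rewrite h2; congr cintegral.
apply/seteqP; split=> t /=; first by case=> h3 h4; rewrite -hi h3.
by rewrite -hi => /andP[].
Qed.

(** Substitution turns the four terms of the folded potential into integrals of
    q over ]0,1-a[, ]1-a,1[, ]0,a[ and ]a,1[. By the parity of E the first two
    have the same integrand: they are joined, and split again at a. *)
Lemma folded_unfold (E f : R -> R[i]) M a alpha beta q : 0 < a < 1 -> L1 1 q ->
  (forall x, rder E x (f x)) -> (forall x, 0 <= x <= 1 -> cabs (E x) <= M) ->
  (forall x, E (- x) = eps alpha * eps beta * E x) ->
  cintegral `]0, 1[ (fun x => E x * folded a alpha beta q x) =
  cintegral `]0, a[ (fun t => (E (1 - a + t) + eps alpha * E (1 - a - t)) * q t) +
  cintegral `]a, 1[ (fun t => (E (1 - t + a) + eps alpha * E (1 - t - a)) * q t).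
Proof.
move=> /andP[a0 a1] intq dE hM EN.
have mE := rder_cmeas measurableT dE.
have r1 : (1 : R) = 1 \/ (1 : R) = -1 by left.
have r2 : (-1 : R) = 1 \/ (-1 : R) = -1 by right.
have mI := measurable_itv (R := R).
have [i1 e1] := folded_term (c := 1 - a) (i := `]0, 1 - a[) r2 mE hM intq
  ltac:(move=> t; rewrite !in_oo; apply/andP/andP => [[/andP[h1 h2] /andP[h3 h4]]|[h1 h2]]; split; try (apply/andP; split); lra).
have [i2 e2] := folded_term (c := 1 - a) (i := `]1 - a, 1[) r1 mE hM intq
  ltac:(move=> t; rewrite !in_oo; apply/andP/andP => [[/andP[h1 h2] /andP[h3 h4]]|[h1 h2]]; split; try (apply/andP; split); lra).
have [i3 e3] := folded_term (c := a - 1) (i := `]0, a[) r1 mE hM intq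
  ltac:(move=> t; rewrite !in_oo; apply/andP/andP => [[/andP[h1 h2] /andP[h3 h4]]|[h1 h2]]; split; try (apply/andP; split); lra).
have [i4 e4] := folded_term (c := 1 + a) (i := `]a, 1[) r2 mE hM intq
  ltac:(move=> t; rewrite !in_oo; apply/andP/andP => [[/andP[h1 h2] /andP[h3 h4]]|[h1 h2]]; split; try (apply/andP; split); lra).
have -> : cintegral `]0, 1[ (fun x => E x * folded a alpha beta q x) =
    eps alpha * cintegral `]0, 1 - a[ (fun t => E (1 - a - t) * q t) +
    eps beta * cintegral `]1 - a, 1[ (fun t => E (t - (1 - a)) * q t) +
    cintegral `]0, a[ (fun t => E (1 - a + t) * q t) +
    cintegral `]a, 1[ (fun t => E (1 - t + a) * q t).
  rewrite (eq_cintegral (g := fun x =>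
    eps alpha * (E x * ext0 `]0, 1[ q (1 - a + -1 * x)) +
    eps beta * (E x * ext0 `]0, 1[ q (1 - a + 1 * x)) +
    E x * ext0 `]0, 1[ q (a - 1 + 1 * x) + E x * ext0 `]0, 1[ q (1 + a + -1 * x))); last first.
    by move=> x _; rewrite /folded !mulrDr (mulrCA (E x)) (mulrCA (E x)).
  have z1 := cintegrableZ (eps alpha) (mI _) i1; have z2 := cintegrableZ (eps beta) (mI _) i2.
  have z12 := cintegrableD (mI _) z1 z2; have z123 := cintegrableD (mI _) z12 i3.
  rewrite (cintegralD (mI _) z123 i4) (cintegralD (mI _) z12 i3) (cintegralD (mI _) z1 z2).
  rewrite !cintegralZ// e1 e2 e3 e4; congr (_ * _ + _ * _ + _ + _);
    apply: eq_cintegral => t _; congr (_ * _); congr E; ring.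
have hM1 x : -1 <= x <= 1 -> cabs (E x) <= M.
  move=> /andP[h1 h2]; have [h|h] := leP 0 x; first by apply: hM; rewrite h.
  have ce b : cabs (eps b) = 1 by case: b => [|n]; rewrite /eps ?cabsN cabs1.
  rewrite -(opprK x) EN !cabsM !ce !mul1r; apply: hM; apply/andP; split; lra.
have iT (c s : R) (i : interval R) : (forall t : R, t \in i -> (t \in `]0, 1[) && (-1 <= c + s * t <= 1)) ->
    cintegrable [set` i] (fun t => E (c + s * t) * q t).
  move=> hi; apply: (@cintegrableM _ _ (fun t => E (c + s * t)) q M (mI _)) => //.
  - apply: (@rder_cmeas _ _ _ (fun t => s%:C * f (c + s * t))) => // t.
    apply: rder_comp; first exact: dE.
    apply: (is_derive_eq (is_deriveD (is_derive_cst c t 1) (is_deriveZ s (is_derive_id t 1)))).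
    by rewrite add0r /GRing.scale /= mulr1.
  - by move=> t /hi/andP[_]; exact: hM1.
  - by apply: cintegrableS intq => // t /hi/andP[].
pose G t := E (1 - a + -1 * t) * q t.
have GE t : E (1 - a - t) * q t = G t by rewrite /G mulN1r.
have iG (b c : R) : 0 <= b -> c <= 1 -> cintegrable `]b, c[ G.
  move=> b0 c1; apply: iT => t; rewrite !in_oo => /andP[h1 h2].
  by apply/andP; split; apply/andP; split; lra.
have -> : eps beta * cintegral `]1 - a, 1[ (fun t => E (t - (1 - a)) * q t) =
    eps alpha * cintegral `]1 - a, 1[ G.
  have pG t : eps alpha * G t = eps beta * (E (t - (1 - a)) * q t).
    rewrite -GE (_ : 1 - a - t = - (t - (1 - a))); last by ring.
    by rewrite EN !mulrA eps2 mul1r.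
  rewrite -(cintegralZ _ (mI _) (iG _ _ _ _)) ?subr_ge0 ?(ltW a1)//.
  rewrite -cintegralZ//; first by apply: eq_cintegral => t _; rewrite pG.
  have := cintegrableZ (eps beta * eps alpha) (mI _) (iG (1 - a) 1 _ _).
  move/(_ _ _)/eq_cintegrable; apply; rewrite ?subr_ge0 ?(ltW a1)// => t _.
  by rewrite -mulrA pG mulrA eps2 mul1r.
rewrite (eq_cintegral (f := fun t => E (1 - a - t) * q t) (g := G)) => [|t _]; last exact: GE.
rewrite -mulrDr -(cintegral_split (m := 1 - a)); [|by apply/andP; split; lra|exact: iG].
rewrite (cintegral_split (m := a)); [|by rewrite a0|exact: iG].
have i5 : cintegrable `]0, a[ (fun t => E (1 - a + 1 * t) * q t).
  by apply: iT => t; rewrite !in_oo => /andP[h1 h2]; apply/andP; split; apply/andP; split; lra.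
have i6 : cintegrable `]a, 1[ (fun t => E (1 + a + -1 * t) * q t).
  by apply: iT => t; rewrite !in_oo => /andP[h1 h2]; apply/andP; split; apply/andP; split; lra.
have ig1 := iG 0 a (lexx _) (ltW a1); have ig2 := iG a 1 (ltW a0) (lexx _).
rewrite (eq_cintegral (D := `]0, a[%classic) (f := fun t => (_ + _) * q t)
  (g := fun t => E (1 - a + 1 * t) * q t + eps alpha * G t)); last first.
  by move=> t _; rewrite -GE mul1r mulrDl mulrA.
rewrite (eq_cintegral (D := `]a, 1[%classic) (f := fun t => (_ + _) * q t)
  (g := fun t => E (1 + a + -1 * t) * q t + eps alpha * G t)); last first.
  move=> t _; rewrite -GE mulrDl mulrA mulN1r.
  by rewrite (_ : 1 - t + a = 1 + a - t) 1?(_ : 1 - t - a = 1 - a - t)//; ring.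
rewrite (cintegralD (mI _) i5) ?(cintegralD (mI _) i6); [|exact: cintegrableZ..].
rewrite !cintegralZ//.
rewrite (eq_cintegral (D := `]0, a[%classic) (f := fun t => E (1 - a + t) * q t)
  (g := fun t => E (1 - a + 1 * t) * q t)); last by move=> t _; rewrite mul1r.
rewrite (eq_cintegral (D := `]a, 1[%classic) (f := fun t => E (1 - t + a) * q t)
  (g := fun t => E (1 + a + -1 * t) * q t)); last first.
  by move=> t _; rewrite mulN1r addrAC.
by ring.
Qed.

Lemma folded_integral d lam a alpha beta q : d = (2 - (alpha + beta))%N ->
  (alpha <= 1)%N -> (beta <= 1)%N -> 0 < a < 1 -> L1 1 q ->
  cintegral `]0, 1[ (fun x => trigser d lam x * folded a alpha beta q x) =
  2 * (fund beta lam (1 - a) * cintegral `]0, a[ (fun t => fund alpha lam t * q t) +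
       fund alpha lam a * cintegral `]a, 1[ (fun t => fund beta lam (1 - t) * q t)).
Proof.
move=> dE al bl a01 intq; have d2 : (d <= 2)%N by rewrite dE leq_subr.
have [M hM] := trigser_bounded lam d2; have [f hf] := trigser_rder lam d2.
have EN x : trigser d lam (- x) = eps alpha * eps beta * trigser d lam x.
  by rewrite dE trigserN.
rewrite (folded_unfold a01 intq hf hM EN) mulrDr; case/andP: a01 => a0 a1.
have i0 alpha' (i : interval R) (g : R -> R) : [set` i] `<=` `]0, 1[ ->
    (forall t, derivable g t 1) -> (forall t, t \in i -> 0 <= g t <= 1) ->
    cintegrable [set` i] (fun t => fund alpha' lam (g t) * q t).
  move=> hi dg g01; have [K K0 hK] := fundamental_near0 lam.
  apply: (cintegrableM (M := K)) => //; last exact: cintegrableS intq.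
  - by case: alpha' => [|n]; [exact: sinrho_cmeas|exact: cosrho_cmeas].
  - move=> t /g01/andP[g0 g1].
    have gn : `|g t| <= 1 by rewrite ger0_norm.
    have [h1 h2 _ _] := hK _ gn; case: alpha' => [|n] //=.
    by rewrite (le_trans h2)// ler_piMr.
rewrite !mulrA -!cintegralZ//; last first.
- apply: i0 => [|t|t]; first exact: sub0a.
    exact: derivable_id.
  by rewrite in_oo => /andP[h1 h2]; apply/andP; split; lra.
- apply: i0 => [|t|t]; first exact: suba1.
    exact: derivable_subl.
  by rewrite in_oo => /andP[h1 h2]; apply/andP; split; lra.
congr (_ + _); apply: eq_cintegral => t _; rewrite mulrA -[2 * _ * _]mulrA; congr (_ * _).
- by rewrite product_to_sum// -dE.
- by rewrite (mulrC (fund alpha lam a)) product_to_sum// -dE.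
Qed.

(** The products of fundamental solutions in [Delta_fund] become sums by
    [product_to_sum], that is, values of the single function [trigser d]. *)
Lemma Delta_folded d q a alpha beta lam : d = (2 - (alpha + beta))%N ->
  (alpha <= 1)%N -> (beta <= 1)%N -> 0 < a < 1 -> L1 1 q ->
  Delta q a alpha beta lam = - eps alpha * (leading d lam +
    2^-1 * cintegral `]0, 1[ (fun x => trigser d lam x * folded a alpha beta q x)).
Proof.
move=> dE al bl a01 intq; rewrite Delta_fund// (folded_integral lam dE)// mulrA mulVf ?mul1r -?dE//.
Qed.

End CharacteristicFunction.

(** * Power series of the characteristic function *)
Section Spectrum.
Context {R : realType}.
Implicit Types (lam z : R[i]) (x t r : R) (q w : R -> R[i]) (c : nat -> R[i]) (alpha beta n d : nat).
Local Notation mu := (@lebesgue_measure R).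

Lemma psum_at0 c : entire c -> psum c 0 = c 0%N.
Proof.
move=> hc; by rewrite (pdiv_rec0 0 hc) mul0r subr0.
Qed.

Lemma psum_eq0 c : entire c -> (forall z, psum c z = 0) -> forall n, c n = 0.
Proof.
move=> hc h n; elim: n c hc h => [|n IH] c hc h; first by rewrite -psum_at0.
have hp := entire_pder hc.
suff : pder c n = 0.
  by rewrite /pder => /eqP; rewrite mulf_eq0 pnatr_eq0 => /eqP.
apply: IH => // z; rewrite -derive1_psum//.
have -> : psum c = cst 0 by apply/funext.
by rewrite derive1_cst.
Qed.

Lemma entire_fact c A : (forall n, cabs (c n) <= A / n`!%:R) -> entire c.
Proof.
move=> hc r r0.
have [M [_ hM]] : bounded_fun (exp_coeff r) by apply: cvg_seq_bounded; apply: cvgP; exact: cvg_exp_coeff.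
have hb n : r ^+ n / n`!%:R <= `|M| + 1.
  have := hM (`|M| + 1) _ n I; rewrite /exp_coeff /= => /(_ _)/(le_trans (ler_norm _)); apply.
  by rewrite (le_lt_trans (ler_norm _))// ltrDl.
have A0 : 0 <= A by have := le_trans (cabs_ge0 _) (hc 0%N); rewrite fact0 divr1.
exists (A * (`|M| + 1)) => n.
rewrite (le_trans (ler_wpM2r (exprn_ge0 _ (ltW r0)) (hc n)))//.
by rewrite -mulrA [_^-1 * _]mulrC ler_wpM2l.
Qed.

Lemma fact_double n d : (n`! <= (2 * n + d)`!)%N.
Proof. by apply: leq_fact; lia. Qed.

(** The coefficients in lam of the integral of trigser d lam x * w x. *)
Definition moment d w n : R[i] := (-1) ^+ n * cintegral `]0, 1[ (fun x => tmon (2 * n + d) x * w x).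

Definition trigcoef d n : R[i] := (-1) ^+ n * tmon (2 * n + d) 1.

Lemma cabs_sign n : cabs ((-1) ^+ n : R[i]) = 1.
Proof. by rewrite cabsX cabsN cabs1 expr1n. Qed.

Lemma cabs_tmon m x : 0 <= x <= 1 -> cabs (@tmon R m x) <= m`!%:R^-1.
Proof.
move=> /andP[x0 x1]; rewrite /tmon cabs_real ger0_norm ?divr_ge0 ?exprn_ge0//.
by rewrite ler_piMl ?invr_ge0// exprn_ile1.
Qed.

Lemma tmon_cmeas D m : measurable D -> cmeas D (@tmon R m).
Proof.
move=> mD; case: m => [|m]; first exact: rder_cmeas rder_tmon0.
exact: rder_cmeas (rder_tmon m).
Qed.

Lemma in01 x : `]0, 1[%classic x -> 0 <= x <= 1.
Proof. by rewrite /= in_oo => /andP[x0 x1]; rewrite !ltW. Qed.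

Lemma tmon_integrable m w : cintegrable `]0, 1[ w -> cintegrable `]0, 1[ (fun x => tmon m x * w x).
Proof.
move=> iw; apply: (cintegrableM (M := m`!%:R^-1)) => //; first exact: tmon_cmeas.
by move=> x /in01; exact: cabs_tmon.
Qed.

Lemma entire_trigcoef d : entire (trigcoef d).
Proof.
apply: (@entire_fact _ 1) => n; rewrite cabsM cabs_sign !mul1r.
rewrite (le_trans (cabs_tmon _ _)) ?ler01 ?lexx//.
by rewrite lef_pV2 ?posrE ?ltr0n ?fact_gt0// ler_nat fact_double.
Qed.

Lemma entire_moment d w : cintegrable `]0, 1[ w -> entire (moment d w).
Proof.
move=> iw; apply: (@entire_fact _ (2 * lnorm `]0, 1[ w)) => n.
rewrite cabsM cabs_sign mul1r.
have h := cintegralM_le (measurable_itv _) (tmon_cmeas (2 * n + d) (measurable_itv _))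
  (fun x hx => cabs_tmon (2 * n + d) (in01 hx)) iw.
rewrite (le_trans h)// mulrAC ler_wpM2l ?mulr_ge0 ?lnorm_ge0//.
by rewrite lef_pV2 ?posrE ?ltr0n ?fact_gt0// ler_nat fact_double.
Qed.

Lemma remainder_cvg d lam A : A * exp_coeff (2 * (1 + cabs lam)) (2 * n + d) @[n --> \oo] --> (0 : R).
Proof.
rewrite -[X in _ --> X](mulr0 A); apply: cvgM; first exact: cvg_cst.
have h := @cvg_exp_coeff R (2 * (1 + cabs lam)).
apply: (cvg_comp (fun n => (2 * n + d)%N) (exp_coeff (2 * (1 + cabs lam))) _ h).
apply/cvgnyPge => m; near=> n; rewrite (@leq_trans n)//; last by lia.
by near: n; exact: nbhs_infty_ge.
Unshelve. all: by end_near. Qed.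

Lemma trigser_psum d lam : (d <= 2)%N -> trigser d lam 1 = psum (trigcoef d) lam.
Proof.
move=> d2; symmetry; apply: psum_unique.
apply: (@cvg_cabs _ _ _ (fun n => expR `|complex.Im (sqrtC lam)| * exp_coeff (2 * (1 + cabs lam)) (2 * n + d))); last exact: remainder_cvg.
move=> n; rewrite cabs_distC.
have -> : \sum_(i < n) trigcoef d i * lam ^+ i = tpart d lam n 1.
  by apply: eq_bigr => i _; rewrite /trigcoef [in RHS]exprNn mulrAC.
by apply: trigser_remainder1; rewrite ?ler01 ?lexx.
Qed.

Lemma cmeasB (D : set R) (f g : R -> R[i]) : cmeas D f -> cmeas D g ->
  cmeas D (fun x => f x - g x).
Proof.
move=> [m1 m2] [m3 m4]; split.
- by under eq_fun do rewrite ReD ReN; exact: measurable_funB.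
- by under eq_fun do rewrite ImD ImN; exact: measurable_funB.
Qed.

(** The Taylor series of the kernel converges uniformly on [0,1]. *)
Lemma integral_psum d lam w : (d <= 2)%N -> cintegrable `]0, 1[ w ->
  cintegral `]0, 1[ (fun x => trigser d lam x * w x) = psum (moment d w) lam.
Proof.
move=> d2 iw; symmetry; apply: psum_unique.
apply: (@cvg_cabs _ _ _ (fun n => 2 * lnorm `]0, 1[ w * expR `|complex.Im (sqrtC lam)| *
  exp_coeff (2 * (1 + cabs lam)) (2 * n + d))); last exact: remainder_cvg.
move=> n; rewrite cabs_distC.
have [f hf] := trigser_rder lam d2.
have it m : cintegrable `]0, 1[ (fun x => (- lam) ^+ m * (tmon (2 * m + d) x * w x)).
  by apply: cintegrableZ => //; exact: tmon_integrable.
have e : \sum_(i < n) moment d w i * lam ^+ i = cintegral `]0, 1[ (fun x => tpart d lam n x * w x).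
  transitivity (\sum_(i < n) cintegral `]0, 1[ (fun x => (- lam) ^+ i * (tmon (2 * i + d) x * w x))).
    apply: eq_bigr => i _; rewrite cintegralZ//; last exact: tmon_integrable.
    by rewrite /moment [in RHS]exprNn mulrAC.
  rewrite -(cintegral_sum n (F := fun m x => (- lam) ^+ m * (tmon (2 * m + d) x * w x)))//.
  apply: eq_cintegral => x _.
  by rewrite /tpart mulr_suml; apply: eq_bigr => i _; rewrite mulrA.
have mt : cmeas `]0, 1[ (tpart d lam n).
  case: d d2 {f hf it e} => [|d] d2; last exact: rder_cmeas (rder_tpart d lam n).
  case: n => [|n]; last exact: rder_cmeas (rder_tpart0 lam n).
  by rewrite (_ : tpart 0 lam 0 = fun=> 0); [exact: cmeas_cst|apply/funext => x; rewrite /tpart big_ord0].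
pose rest x := trigser d lam x - tpart d lam n x.
have mrest : cmeas `]0, 1[ rest.
  exact: (cmeasB (trigser_cmeas lam (measurable_itv `]0%R, 1%R[) d2) mt).
have brest x : `]0, 1[%classic x -> cabs (rest x) <=
    expR `|complex.Im (sqrtC lam)| * exp_coeff (2 * (1 + cabs lam)) (2 * n + d).
  by move=> /in01 hx; exact: trigser_remainder1.
have ip : cintegrable `]0, 1[ (fun x => tpart d lam n x * w x).
  have := cintegrable_sum n (measurable_itv `]0%R, 1%R[) it.
  apply: eq_cintegrable => // x _.
  by rewrite /tpart mulr_suml; apply: eq_bigr => i _; rewrite mulrA.
have ir := cintegrableM (measurable_itv `]0%R, 1%R[) mrest brest iw.
have -> : cintegral `]0, 1[ (fun x => trigser d lam x * w x) -
    \sum_(i < n) moment d w i * lam ^+ i = cintegral `]0, 1[ (fun x => rest x * w x).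
  rewrite e; apply/eqP; rewrite subr_eq -cintegralD//; apply/eqP.
  by apply: eq_cintegral => x _; rewrite /rest; ring.
have := cintegralM_le (measurable_itv `]0%R, 1%R[) mrest brest iw.
by move/le_trans; apply; rewrite mulrAC -!mulrA [X in _ * X]mulrC !mulrA.
Qed.

Definition leadcoef d n : R[i] :=
  match d with
  | 0 => if n is m.+1 then - trigcoef 1 m else 0
  | d'.+1 => trigcoef d' n
  end.

Lemma leading_psum d lam : (d <= 2)%N ->
  entire (leadcoef d) /\ leading d lam = psum (leadcoef d) lam.
Proof.
case: d => [|d] d2.
- have e : (fun m => - trigcoef 1 m) = (fun m => -1 * trigcoef 1 m + 0 * trigcoef 1 m).
    by apply/funext => m; rewrite mulN1r mul0r addr0.
  have h1 : entire (fun m => - trigcoef 1 m) by rewrite e; apply: entireL; exact: entire_trigcoef.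
  split; first exact: (entireX h1).
  rewrite (psumX lam h1) e (psumL (-1) 0 lam (entire_trigcoef 1) (entire_trigcoef 1)) -(trigser_psum lam (isT : (1 <= 2)%N)) /=; ring.
- split; first exact: entire_trigcoef.
  rewrite -[leadcoef _]/(trigcoef d) -trigser_psum ?(ltnW d2)//.
  by case: d d2 => [|[|//]].
Qed.

Lemma folded_integrable a alpha beta q : L1 1 q -> cintegrable `]0, 1[ (folded a alpha beta q).
Proof.
move=> /(cintegrable_ext0 _ (measurable_itv _)) iq.
have h (c s : R) : (s = 1) \/ (s = -1) -> cintegrable `]0, 1[ (fun x => ext0 `]0, 1[ q (c + s * x)).
  by move=> s1; have [i _] := cintegral_affine c s1 iq; apply: cintegrableS i.
have mI := measurable_itv (R := R) `]0, 1[.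
have r1 : (1 : R) = 1 \/ (1 : R) = -1 by left.
have r2 : (-1 : R) = 1 \/ (-1 : R) = -1 by right.
have z1 := cintegrableZ (eps alpha) mI (h (1 - a) (-1) r2).
have z2 := cintegrableZ (eps beta) mI (h (1 - a) 1 r1).
exact: cintegrableD mI (cintegrableD mI (cintegrableD mI z1 z2) (h (a - 1) 1 r1)) (h (1 + a) (-1) r2).
Qed.

Definition Dcoef d a alpha beta q n : R[i] :=
  - eps alpha * leadcoef d n + (- eps alpha / 2) * moment d (folded a alpha beta q) n.

Lemma Delta_psum d a alpha beta q : d = (2 - (alpha + beta))%N ->
  (alpha <= 1)%N -> (beta <= 1)%N -> 0 < a < 1 -> L1 1 q ->
  entire (Dcoef d a alpha beta q) /\
  Delta q a alpha beta = psum (Dcoef d a alpha beta q).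
Proof.
move=> dE al bl a01 iq; have d2 : (d <= 2)%N by rewrite dE leq_subr.
have iw := folded_integrable a alpha beta iq.
have hm := entire_moment d iw.
have hl := (leading_psum 0 d2).1.
split; first exact: entireL.
apply/funext => lam; rewrite /Dcoef psumL// -(leading_psum lam d2).2 -integral_psum//.
rewrite (Delta_folded lam dE)//; ring.
Qed.

End Spectrum.

(** * Isospectral potentials *)
Section Isospectral.
Context {R : realType}.
Implicit Types (lam z : R[i]) (x t r : R) (q w : R -> R[i]) (alpha beta n d : nat).
Local Notation mu := (@lebesgue_measure R).

Lemma iter_pderL (a b : R[i]) (c d : nat -> R[i]) i :
  iter i pder (fun n => a * c n + b * d n) =
  (fun n => a * iter i pder c n + b * iter i pder d n).
Proof. by elim: i => //= i ->; apply/funext => n; rewrite /pder; ring. Qed.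

Lemma foldedB a alpha beta q q0 x :
  folded a alpha beta (fun t => q t - q0 t) x =
  folded a alpha beta q x - folded a alpha beta q0 x.
Proof.
have e y : ext0 `]0, 1[ (fun t => q t - q0 t) y = ext0 `]0, 1[ q y - ext0 `]0, 1[ q0 y.
  by rewrite /ext0; case: ifP => _; rewrite ?subr0.
by rewrite /folded !e; ring.
Qed.

Lemma L1B q q0 : L1 1 q -> L1 1 q0 -> L1 1 (fun t => q t - q0 t).
Proof.
move=> iq iq0; have := cintegrableD (measurable_itv _) iq (cintegrableZ (-1) (measurable_itv _) iq0).
by apply: eq_cintegrable => // x _; rewrite mulN1r.
Qed.

Lemma integral_trigser_le d lam w : (d <= 2)%N -> cintegrable `]0, 1[ w -> lam != 0 ->
  cabs (cintegral `]0, 1[ (fun x => trigser d lam x * w x)) * cabs (sqrtC lam) ^+ d <=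
  4 * expR `|complex.Im (sqrtC lam)| * lnorm `]0, 1[ w.
Proof.
move=> d2 iw l0.
have P0 : 0 < cabs (sqrtC lam) ^+ d by rewrite exprn_gt0// cabs_gt0 sqrtC_eq0.
rewrite -ler_pdivlMr//.
have hb x : `]0, 1[%classic x -> cabs (trigser d lam x) <=
    2 * expR `|complex.Im (sqrtC lam)| / cabs (sqrtC lam) ^+ d.
  by move=> /in01 hx; rewrite ler_pdivlMr// trigser_le.
rewrite (le_trans (cintegralM_le (measurable_itv _) (trigser_cmeas lam (measurable_itv _) d2) hb iw))//.
rewrite le_eqVlt; apply/orP; left; apply/eqP; field.
by rewrite expf_neq0// gt_eqF// cabs_gt0 sqrtC_eq0.
Qed.

Lemma cintegral_ae0 (D : set R) w : measurable D -> cintegrable D w ->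
  (\forall x \ae mu, D x -> w x = 0) -> cintegral D w = 0.
Proof.
move=> mD [i1 i2] h.
by apply/eq_complexP; rewrite /cintegral /Rintegral /= (@ae_eq_integral _ _ _ mu D (cst 0%E))//;
  rewrite ?integral0//; try (exact: measurable_int i1 || exact: measurable_int i2);
  apply: (@filterS _ _ (ae_filter_ringOfSetsType mu)) h => x h /h /= ->.
Qed.

Section TwoPotentials.
Variables (a : R) (alpha beta d : nat) (q q0 : R -> R[i]).
Hypotheses (dE : d = (2 - (alpha + beta))%N) (al : (alpha <= 1)%N) (bl : (beta <= 1)%N)
  (a01 : 0 < a < 1) (iq : L1 1 q) (iq0 : L1 1 q0).

Let w := folded a alpha beta (fun t => q t - q0 t).
Let w0 := folded a alpha beta q0.
Let d2 : (d <= 2)%N. Proof. by rewrite dE leq_subr. Qed.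
Let iw : cintegrable `]0, 1[ w.
Proof. by apply: folded_integrable; apply: L1B. Qed.
Let iw0 : cintegrable `]0, 1[ w0. Proof. exact: folded_integrable. Qed.

Let f := Dcoef d a alpha beta q0.
Let g n := 1 * Dcoef d a alpha beta q n + (-1) * Dcoef d a alpha beta q0 n.

Let hf : entire f. Proof. exact: (Delta_psum dE al bl a01 iq0).1. Qed.
Let hfq : entire (Dcoef d a alpha beta q). Proof. exact: (Delta_psum dE al bl a01 iq).1. Qed.
Let hg : entire g. Proof. exact: entireL. Qed.

Lemma DeltaB lam : Delta q a alpha beta lam - Delta q0 a alpha beta lam =
  - (eps alpha / 2) * cintegral `]0, 1[ (fun x => trigser d lam x * w x).
Proof.
rewrite !(Delta_folded lam dE)//.
have [M hM] := trigser_bounded lam d2.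
have it v : cintegrable `]0, 1[ v -> cintegrable `]0, 1[ (fun x => trigser d lam x * v x).
  move=> iv; apply: cintegrableM iv => //; first exact: trigser_cmeas.
  by move=> x /in01; exact: hM.
have -> : cintegral `]0, 1[ (fun x => trigser d lam x * folded a alpha beta q x) =
    cintegral `]0, 1[ (fun x => trigser d lam x * w x) +
    cintegral `]0, 1[ (fun x => trigser d lam x * folded a alpha beta q0 x).
  rewrite -cintegralD//; [|exact: it..].
  by apply: eq_cintegral => x _; rewrite /w foldedB -mulrDr subrK.
move: (cintegral _ _) (cintegral _ _) (leading _ _) (eps _) => *; by field.
Qed.

Lemma psum_f lam : psum f lam = Delta q0 a alpha beta lam.
Proof. by rewrite (Delta_psum dE al bl a01 iq0).2. Qed.

Lemma psum_g lam : psum g lam = - (eps alpha / 2) * cintegral `]0, 1[ (fun x => trigser d lam x * w x).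
Proof.
rewrite psumL// -DeltaB (Delta_psum dE al bl a01 iq0).2 (Delta_psum dE al bl a01 iq).2.
by rewrite mul1r mulN1r.
Qed.

Lemma spectrum_zeros : spectrum q a alpha beta = spectrum q0 a alpha beta -> zeros_include f g.
Proof.
move=> e z m h.
case: m h => [//|m] h.
have h0 : spectrum q0 a alpha beta (z, m.+1).
  split=> // i im; rewrite (Delta_psum dE al bl a01 iq0).2; exact: h.
have hq : spectrum q a alpha beta (z, m.+1) by rewrite e.
have e0 i : (i < m.+1)%N -> psum (iter i pder (Dcoef d a alpha beta q0)) z = 0.
  by move=> im; rewrite -derive1n_psum//; exact: h.
have eq i : (i < m.+1)%N -> psum (iter i pder (Dcoef d a alpha beta q)) z = 0.
  move=> im; rewrite -derive1n_psum// -(Delta_psum dE al bl a01 iq).2; exact: hq.2 i im.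
move=> i im; rewrite derive1n_psum//.
rewrite /g iter_pderL (@psumL _ _ _ (iter i pder (Dcoef d a alpha beta q))
  (iter i pder (Dcoef d a alpha beta q0))); try exact: entire_iter_pder.
by rewrite e0// eq// !mulr0 addr0.
Qed.

Lemma cabs_eps n : cabs (eps n : R[i]) = 1.
Proof. by case: n => [|n]; rewrite /eps ?cabsN cabs1. Qed.

(** On the curves of [leading_ge], the leading term makes |f| at least of the
    order of exp |Im rho| |rho| ^ (1 - d), whereas |g| is at most of the order of
    exp |Im rho| |rho| ^ (- d). *)
Lemma boundary_small e r0 : 0 < e -> exists2 r, r0 <= r & forall z, gauge z = r ->
  psum f z != 0 /\ cabs (psum g z) <= e * cabs (psum f z).
Proof.
move=> e0.
pose n0 := lnorm `]0, 1[ w0; pose n1 := lnorm `]0, 1[ w.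
have n00 : 0 <= n0 by exact: lnorm_ge0.
have n10 : 0 <= n1 by exact: lnorm_ge0.
have [r hr hlead] := leading_ge d2 (`|r0| + 4 * (2 * n0 + 2 * n1 / e + 1)).
have ne0 : 0 <= n1 / e by rewrite divr_ge0// ltW.
have r1 : 1 <= r by have := normr_ge0 r0; lra.
have rr0 : r0 <= r by have := ler_norm r0; lra.
exists (2 * r ^+ 2).
  by rewrite (le_trans rr0)// -[leLHS]mul1r expr2 mulrA ler_pM//; lra.
move=> z /hlead[rz lz].
set Y := expR _ in lz; set P := cabs (sqrtC z) ^+ d in lz.
have Y0 : 0 < Y by exact: expR_gt0.
have s0 : 0 < cabs (sqrtC z) by lra.
have z0 : z != 0 by rewrite -sqrtC_eq0 -cabs_gt0.
have P0 : 0 < P by rewrite exprn_gt0.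
have I0 := integral_trigser_le d2 iw0 z0; have I1 := integral_trigser_le d2 iw z0.
rewrite -/Y -/P -/n0 in I0; rewrite -/Y -/P -/n1 in I1.
have c2 : cabs (2^-1 : R[i]) = 2^-1 by rewrite cabsV cabs2.
have fge : Y * (2 * n1 / e + 1) <= cabs (psum f z) * P.
  rewrite psum_f (Delta_folded z dE)// -/w0 cabsM cabsN cabs_eps mul1r.
  have h := cabsB_ge (leading d z) (- (2^-1 * cintegral `]0, 1[ (fun x => trigser d z x * w0 x))).
  rewrite opprK cabsN cabsM c2 in h.
  apply: (le_trans _ (ler_wpM2r (ltW P0) h)); rewrite mulrBl.
  apply: (le_trans _ (lerB lz (_ : _ <= 2 * Y * n0))); last by rewrite -mulrA; lra.
  have -> : Y / 4 * cabs (sqrtC z) - 2 * Y * n0 = Y * (cabs (sqrtC z) / 4 - 2 * n0) by field.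
  by rewrite ler_wpM2l ?(ltW Y0)//; have := normr_ge0 r0; lra.
have gle : cabs (psum g z) * P <= 2 * Y * n1.
  by rewrite psum_g cabsM cabsN cabsM cabs_eps c2 mul1r -mulrA; lra.
have f0 : 0 < cabs (psum f z).
  rewrite -(pmulr_lgt0 _ P0) (lt_le_trans _ fge)// mulr_gt0//; lra.
split; first by rewrite -cabs_gt0.
rewrite -(ler_pM2r P0) (le_trans gle)// -(mulrA e).
apply: (le_trans _ (ler_wpM2l (ltW e0) fge)).
have -> : e * (Y * (2 * n1 / e + 1)) = 2 * Y * n1 + e * Y by field; rewrite gt_eqF.
by rewrite lerDl mulr_ge0 ?ltW.
Qed.

(** The difference g of the characteristic functions vanishes where f does, with
    multiplicity, and is small compared with f: so it is 0. *)
Lemma spectrum_moments : spectrum q a alpha beta = spectrum q0 a alpha beta ->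
  forall n, cintegral `]0, 1[ (fun x => tmon (2 * n + d) x * w x) = 0.
Proof.
move=> e.
have [r r0 hr] := @boundary_small 1 0 ltr01.
have rz : gauge ((r / 2)%:C : R[i]) = r.
  by rewrite /gauge cabs_real /= ger0_norm ?divr_ge0// -splitr.
have [f1 _] := hr _ rz.
have gz := entire_domination0 hf hg f1 (spectrum_zeros e) boundary_small.
have mz z : psum (moment d w) z = 0.
  have := gz z; rewrite psum_g integral_psum// => /eqP; rewrite mulf_eq0 oppr_eq0 mulf_eq0.
  by rewrite -!cabs_eq0 cabs_eps cabsV cabs2 oner_eq0 invr_eq0 pnatr_eq0 /= cabs_eq0 => /eqP.
move=> n; have := psum_eq0 (entire_moment d iw) mz n; rewrite /moment => /eqP.
by rewrite mulf_eq0 -cabs_eq0 cabs_sign oner_eq0 /= => /eqP.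
Qed.

(** The even moments of x ^ d * w x vanish, for the two components. *)
Lemma spectrum_folded : spectrum q a alpha beta = spectrum q0 a alpha beta ->
  \forall x \ae mu, `]0, 1[%classic x -> w x = 0.
Proof.
move=> /spectrum_moments hm.
have key (P : R[i] -> R) : (forall r z, P (r%:C * z) = r * P z) ->
    mu.-integrable `]0, 1[ (EFin \o (fun x => P (w x))) ->
    (forall v, P (cintegral `]0, 1[ v) = \int[mu]_(x in `]0, 1[) P (v x)) ->
    \forall x \ae mu, `]0, 1[%classic x -> P (w x) = 0.
  move=> PZ iP Pint.
  have xd01 (x : R) : x \in `]0, 1[ -> 0 <= x ^+ d <= 1.
    by rewrite in_oo => /andP[x0 x1]; rewrite exprn_ge0 ?exprn_ile1 ?ltW.
  have ix : mu.-integrable `]0, 1[ (EFin \o (fun x => x ^+ d * P (w x))).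
    by apply: integrable_mul01.
  have hx n : \int[mu]_(x in `]0, 1[) (x ^+ (2 * n) * (x ^+ d * P (w x))) = 0.
    have h0 : P 0 = 0 by have := PZ 0 0; rewrite mulr0 mul0r.
    have := hm n => /(congr1 P); rewrite h0 Pint => h.
    have F0 : ((2 * n + d)`!%:R : R) != 0 by rewrite pnatr_eq0 -lt0n fact_gt0.
    transitivity ((2 * n + d)`!%:R * \int[mu]_(x in `]0, 1[) P (tmon (2 * n + d) x * w x)); last by rewrite h mulr0.
    rewrite -RintegralZl//.
      by apply: eq_Rintegral => x _; rewrite /tmon PZ exprD; field.
    have := @integrable_scale R `]0, 1[ ((2 * n + d)`!%:R^-1) (fun x => x ^+ (2 * n + d) * P (w x)) (measurable_itv _).
    have -> : (fun x => (2 * n + d)`!%:R^-1 * (x ^+ (2 * n + d) * P (w x))) = (fun x => P (tmon (2 * n + d) x * w x)).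
      by apply/funext => x; rewrite /tmon PZ; ring.
    apply; apply: integrable_mul01 => // x; rewrite /= in_oo => /andP[x0 x1].
    by rewrite exprn_ge0 ?exprn_ile1 ?ltW.
  have := moments_ae0 ix hx.
  apply: (@filterS _ _ (ae_filter_ringOfSetsType mu)) => x h hx01.
  have /eqP := h hx01; rewrite mulf_eq0 expf_eq0 => /orP[/andP[_ /eqP x0]|/eqP//].
  by move: hx01; rewrite /= in_oo x0 ltxx.
have h1 := key (@complex.Re R) _ iw.1 (fun=> erefl).
have h2 := key (@complex.Im R) _ iw.2 (fun=> erefl).
have r1 : \forall x \ae mu, `]0, 1[%classic x -> complex.Re (w x) = 0.
  by apply: h1 => r z; rewrite ReM /= mul0r subr0.
have r2 : \forall x \ae mu, `]0, 1[%classic x -> complex.Im (w x) = 0.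
  by apply: h2 => r z; rewrite ImM /= mul0r addr0.
apply: (@filterS2 _ _ (ae_filter_ringOfSetsType mu) _ _ _ _ r1 r2) => x e1 e2 hx.
by apply/eq_complexP; [rewrite (e1 hx) | rewrite (e2 hx)].
Qed.

Lemma folded_spectrum : (\forall x \ae mu, `]0, 1[%classic x -> w x = 0) ->
  spectrum q a alpha beta = spectrum q0 a alpha beta.
Proof.
move=> w0ae; suff e : Delta q a alpha beta = Delta q0 a alpha beta by rewrite /spectrum e.
apply/funext => lam; apply/eqP; rewrite -subr_eq0 DeltaB.
have [M hM] := trigser_bounded lam d2.
have it : cintegrable `]0, 1[ (fun x => trigser d lam x * w x).
  apply: cintegrableM iw => //; first exact: trigser_cmeas.
  by move=> x /in01; exact: hM.
rewrite (cintegral_ae0 _ it) ?mulr0//.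
by apply: (@filterS _ _ (ae_filter_ringOfSetsType mu)) w0ae => x h /h ->; rewrite mulr0.
Qed.

End TwoPotentials.

End Isospectral.

(** * Sign patterns annihilated by the folding *)

Section Mirror.
Context {K : comNzRingType}.
Implicit Types (G : nat -> K).

(** The value of the folded function on the m-th cell from the left, in terms of
    the values [G n] of the potential on the n-th cell from the right: the
    reflections and translations that leave ]0,1[ do not contribute. *)
Definition mirror j k (e0 e1 : K) G m : K :=
  if (m < j)%N then e0 * G (j + m)%N + e1 * G (j.-1 - m)%N
  else if (m < k - j)%N then e0 * G (j + m)%N + G (m - j)%N
  else G ((2 * k).-1 - j - m)%N + G (m - j)%N.

Section Recurrence.
Variables (j k : nat) (e0 e1 : K) (G : nat -> K).
Hypotheses (j0 : (0 < j)%N) (jk : (2 * j <= k)%N)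
  (e00 : e0 * e0 = 1) (e11 : e1 * e1 = 1)
  (hG : forall m, (m < k)%N -> mirror j k e0 e1 G m = 0).

(** The continuation H of G to all indices, by the reflection H (2 k - 1 - n) =
    e0 H n and the shift H (n + 2 k) = e0 e1 H n. The three kinds of relations
    become one: H (n + 2 j) = - e0 H n. *)
Definition unfolded n : K :=
  (e0 * e1) ^+ (n %/ (2 * k)) *
  (let r := (n %% (2 * k))%N in if (r < k)%N then G r else e0 * G ((2 * k).-1 - r)%N).

Local Notation H := unfolded.

Let k0 : (0 < 2 * k)%N. Proof. by lia. Qed.

Lemma unfolded_period n : H (n + 2 * k) = e0 * e1 * H n.
Proof.
by rewrite /unfolded modnDr divnDr// divnn k0 addn1 exprS mulrA.
Qed.

Lemma unfolded_lt n : (n < k)%N -> H n = G n.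
Proof. by move=> nk; rewrite /unfolded divn_small ?modn_small ?nk ?mul1r//; lia. Qed.

Lemma unfolded_ge n : (k <= n < 2 * k)%N -> H n = e0 * G ((2 * k).-1 - n)%N.
Proof.
move=> /andP[kn nk]; rewrite /unfolded divn_small ?modn_small ?mul1r//.
by rewrite ltnNge kn.
Qed.

Lemma mirror_head m : (m < 2 * j)%N -> G m = - (e0 * e1 * G ((2 * j).-1 - m)%N).
Proof.
move=> mj; have [lt|ge] := ltnP m j.
- have := hG (m := j.-1 - m); rewrite /mirror ifT; last by lia.
  have -> : (j + (j.-1 - m) = (2 * j).-1 - m)%N by lia.
  have -> : (j.-1 - (j.-1 - m) = m)%N by lia.
  move=> /(_ ltac:(lia)) h; have : e1 * (e0 * G ((2 * j).-1 - m)%N + e1 * G m) = 0 by rewrite h mulr0.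
  by rewrite mulrDr [e1 * (e1 * _)]mulrA e11 mul1r addrC mulrCA mulrA => /eqP; rewrite addr_eq0 => /eqP.
- have := hG (m := m - j); rewrite /mirror ifT; last by lia.
  have -> : (j + (m - j) = m)%N by lia.
  have -> : (j.-1 - (m - j) = (2 * j).-1 - m)%N by lia.
  move=> /(_ ltac:(lia)) h; have : e0 * (e0 * G m + e1 * G ((2 * j).-1 - m)%N) = 0 by rewrite h mulr0.
  by rewrite mulrDr mulrA e00 mul1r mulrA => /eqP; rewrite addr_eq0 => /eqP.
Qed.

Lemma mirror_middle m : (m + 2 * j < k)%N -> G (m + 2 * j)%N = - (e0 * G m).
Proof.
move=> mk; have := hG (m := j + m); rewrite /mirror ifF; last by lia.
rewrite ifT; last by lia.
have -> : (j + (j + m) = m + 2 * j)%N by lia.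
have -> : (j + m - j = m)%N by lia.
move=> /(_ ltac:(lia)) h; have : e0 * (e0 * G (m + 2 * j)%N + G m) = 0 by rewrite h mulr0.
by rewrite mulrDr mulrA e00 mul1r => /eqP; rewrite addr_eq0 => /eqP.
Qed.

Lemma mirror_tail m : (k - 2 * j <= m < k)%N -> G ((2 * k).-1 - 2 * j - m)%N = - G m.
Proof.
move=> mk; have [lt|ge] := ltnP m (k - j).
- have := hG (m := j + m); rewrite /mirror !ifF; try lia.
  have -> : ((2 * k).-1 - j - (j + m) = (2 * k).-1 - 2 * j - m)%N by lia.
  have -> : (j + m - j = m)%N by lia.
  by move=> /(_ ltac:(lia)) /eqP; rewrite addr_eq0 => /eqP.
- have := hG (m := (2 * k).-1 - j - m); rewrite /mirror !ifF; try lia.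
  have -> : ((2 * k).-1 - j - ((2 * k).-1 - j - m) = m)%N by lia.
  have -> : ((2 * k).-1 - j - m - j = (2 * k).-1 - 2 * j - m)%N by lia.
  by move=> /(_ ltac:(lia)) /eqP; rewrite addrC addr_eq0 => /eqP.
Qed.

Lemma unfolded_step n : H (n + 2 * j) = - e0 * H n.
Proof.
suff base r : (r < 2 * k)%N -> H (r + 2 * j) = - e0 * H r.
  rewrite (divn_eq n (2 * k)); elim: (n %/ (2 * k))%N => [|t IH].
    by rewrite mul0n add0n base// ltn_pmod.
  have -> : (t.+1 * (2 * k) + n %% (2 * k) + 2 * j = t * (2 * k) + n %% (2 * k) + 2 * j + 2 * k)%N.
    by rewrite mulSn; lia.
  have -> : (t.+1 * (2 * k) + n %% (2 * k) = t * (2 * k) + n %% (2 * k) + 2 * k)%N.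
    by rewrite mulSn; lia.
  by rewrite !unfolded_period IH mulrCA.
move=> rk; have [r1|r1] := ltnP (r + 2 * j) k.
  by rewrite !unfolded_lt ?mirror_middle ?mulNr//; lia.
have [r2|r2] := ltnP r k.
  rewrite unfolded_ge ?[H r]unfolded_lt//; last by lia.
  have -> : ((2 * k).-1 - (r + 2 * j) = (2 * k).-1 - 2 * j - r)%N by lia.
  by rewrite mirror_tail ?mulrN ?mulNr//; lia.
have [r3|r3] := ltnP (r + 2 * j) (2 * k).
  rewrite !unfolded_ge; try lia.
  have e : ((2 * k).-1 - r = (2 * k).-1 - (r + 2 * j) + 2 * j)%N by lia.
  by rewrite e mirror_middle; [rewrite mulNr !mulrN opprK [e0 * (e0 * _)]mulrA e00 mul1r|lia].
have -> : (r + 2 * j = r + 2 * j - 2 * k + 2 * k)%N by lia.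
rewrite unfolded_period unfolded_lt ?unfolded_ge; try lia.
rewrite mirror_head; last by lia.
have -> : ((2 * j).-1 - (r + 2 * j - 2 * k) = (2 * k).-1 - r)%N by lia.
rewrite mulNr mulrN; congr (- _); rewrite !mulrA e00.
by rewrite -[e0 * e1 * e0]mulrA [e1 * e0]mulrC !mulrA e00 mul1r e11.
Qed.

Lemma unfolded_steps u n : H (n + u * (2 * j)) = (- e0) ^+ u * H n.
Proof.
elim: u => [|u IH]; first by rewrite mul0n addn0 mul1r.
by rewrite mulSn addnCA addnC unfolded_step IH exprS mulrA.
Qed.

Lemma unfolded_periods v n : H (n + v * (2 * k)) = (e0 * e1) ^+ v * H n.
Proof.
elim: v => [|v IH]; first by rewrite mul0n addn0 mul1r.
by rewrite mulSn addnCA addnC unfolded_period IH exprS mulrA.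
Qed.

(** As [j] and [k] are coprime, the two shifts [2 j] and [2 k] generate the
    shift by 2. *)
Lemma unfolded_shift2 u v n : (u * j = v * k + 1)%N ->
  H (n + 2) = (e0 * e1) ^+ v * (- e0) ^+ u * H n.
Proof.
move=> uv; rewrite -mulrA -unfolded_steps.
have -> : (n + u * (2 * j) = n + 2 + v * (2 * k))%N by lia.
rewrite unfolded_periods mulrA -exprMn.
by rewrite mulrACA e00 e11 mul1r expr1n mul1r.
Qed.

(** The shift by 2 leaves the initial values H 0 and H 1, which are related by the
    reflection, as 0 and 2 k - 1 have different parities. *)
Lemma mirror_pattern u v n : (u * j = v * k + 1)%N -> (n < k)%N ->
  let eta := (e0 * e1) ^+ v * (- e0) ^+ u in
  G n = (if odd n then eta ^+ (n %/ 2) * (eta ^+ k.-1 * e0) else eta ^+ (n %/ 2)) * G 0.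
Proof.
move=> uv nk eta.
have hs i m : H (m + 2 * i) = eta ^+ i * H m.
  elim: i => [|i IH]; first by rewrite addn0 mul1r.
  have -> : (m + 2 * i.+1 = m + 2 * i + 2)%N by lia.
  by rewrite (unfolded_shift2 _ uv) IH exprS mulrA.
have eta2 i : eta ^+ i * eta ^+ i = 1.
  have s2 (x : K) m : x * x = 1 -> x ^+ m * x ^+ m = 1 by move=> x2; rewrite -exprMn x2 expr1n.
  by apply: (s2 _ i); rewrite mulrACA !s2 ?mul1r// ?mulrNN// mulrACA e00 e11 mul1r.
have h1 : H 1 = eta ^+ k.-1 * e0 * H 0.
  have := hs k.-1 1%N; have -> : (1 + 2 * k.-1 = (2 * k).-1)%N by lia.
  rewrite unfolded_ge; last by lia.
  rewrite subnn -(@unfolded_lt 0); last by lia.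
  by move=> h; rewrite -mulrA h mulrA eta2 mul1r.
rewrite -(unfolded_lt nk) -(@unfolded_lt 0); last by lia.
have [odd_n|even_n] := boolP (odd n).
  have e : (n = 1 + 2 * (n %/ 2))%N by lia.
  by rewrite {1}e hs h1 mulrA.
have e : (n = 0 + 2 * (n %/ 2))%N by lia.
by rewrite {1}e hs.
Qed.

End Recurrence.

End Mirror.

Section Signs.
Context {R : realType}.
Implicit Types (G : nat -> R[i]).

Lemma signN (a b : nat) : odd a != odd b -> (-1 : R[i]) ^+ a = - (-1) ^+ b.
Proof.
rewrite -(signr_odd _ a) -(signr_odd _ b).
by case: (odd a); case: (odd b) => //= _; rewrite ?expr1 ?opprK.
Qed.

Lemma signE (a b : nat) : odd a = odd b -> (-1 : R[i]) ^+ a = (-1) ^+ b.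
Proof. by rewrite -(signr_odd _ a) -(signr_odd _ b) => ->. Qed.

Variables (alpha beta j k : nat).
Hypotheses (j0 : (0 < j)%N) (jk : (2 * j <= k)%N) (cop : coprime j k)
  (cases : [\/ alpha = 0%N /\ beta = 0%N,
                 [/\ alpha = 0%N, beta = 1%N & ~~ odd j],
                 [/\ alpha = 1%N, beta = 0%N & ~~ odd (k + j)] |
                 [/\ alpha = 1%N, beta = 1%N & ~~ odd k]]).

Local Notation e0 := (eps alpha : R[i]).
Local Notation e1 := (eps beta : R[i]).

Lemma not_both_even : odd j || odd k.
Proof.
apply/negPn/negP; rewrite negb_or -!dvdn2 => /andP[dj dk].
by have := dvdn_gcd 2 j k; rewrite dj dk (eqP cop).
Qed.

(** In each case the parities of j and k determine eta, which is 1 for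
    alpha = beta = 0 and - 1 otherwise. *)
Lemma mirror_xsign G : (forall m, (m < k)%N -> mirror j k e0 e1 G m = 0) ->
  forall n, (n < k)%N -> G n = xsign alpha beta n.+1 * G 0.
Proof.
move=> hG n nk.
have [[u v] /= uv] : exists uv : nat * nat, (uv.1 * j = uv.2 * k + 1)%N.
  by have /(coprimeP _ j0)[[u v] /= h] := cop; exists (u, v) => /=; lia.
rewrite (mirror_pattern j0 jk (eps2 alpha) (eps2 beta) hG uv nk); congr (_ * _).
have := congr1 odd uv; rewrite oddD !oddM /= => ouv.
have nbe := not_both_even.
case: cases => [[-> ->]|[-> -> c]|[-> -> c]|[-> -> c]] /=.
- rewrite mulrNN !opprK !mulr1 !expr1n !mul1r subn1 /= -(signr_odd _ n).
  by case: (odd n); rewrite ?expr1 ?expr0 ?expr1n ?mul1r.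
- rewrite mulr1 opprK expr1n mulr1.
  have -> : (-1 : R[i]) ^+ v = -1 by rewrite -[RHS]expr1; apply: signE; lia.
  case: ifP => o; last by apply: signE; lia.
  by rewrite mulrN1 mulrN -exprD; symmetry; apply: signN; lia.
- rewrite mul1r mulr1 -(exprD _ v u).
  have -> : (-1 : R[i]) ^+ (v + u) = -1 by rewrite -[RHS]expr1; apply: signE; lia.
  by case: ifP => o; rewrite -?exprD; apply: signE; lia.
- rewrite mulr1 expr1n mul1r mulr1.
  have -> : (-1 : R[i]) ^+ u = -1 by rewrite -[RHS]expr1; apply: signE; lia.
  by case: ifP => o; rewrite -?exprD; apply: signE; lia.
Qed.

Lemma xsign_mirror G : (forall n, (n < k)%N -> G n = xsign alpha beta n.+1 * G 0) ->
  forall m, (m < k)%N -> mirror j k e0 e1 G m = 0.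
Proof.
move=> hG m mk; have nbe := not_both_even.
have sgnD (s t : nat) (z : R[i]) : odd s != odd t -> (-1) ^+ s * z + (-1) ^+ t * z = 0.
  by move=> st; rewrite (signN st) mulNr addNr.
have sgnB (s t : nat) (z : R[i]) : odd s = odd t -> (-1) ^+ s * z - (-1) ^+ t * z = 0.
  by move=> st; rewrite (signE st) subrr.
rewrite /mirror; case: ifP => c1; last case: ifP => c2; rewrite (hG (_ + _)%N, hG (_ - _)%N); try lia.
- rewrite (hG (_ - _)%N); last by lia.
  case: cases => [[-> ->]|[-> -> c]|[-> -> c]|[-> -> c]] /=; rewrite ?mulN1r ?mul1r.
  + by rewrite -opprD sgnD ?oppr0//; lia.
  + by rewrite addrC sgnB//; lia.
  + by rewrite sgnB//; lia.
  + by rewrite sgnD//; lia.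
- rewrite (hG (_ - _)%N); last by lia.
  case: cases => [[-> ->]|[-> -> c]|[-> -> c]|[-> -> c]] /=; rewrite ?mulN1r ?mul1r.
  + by rewrite addrC sgnB//; lia.
  + by rewrite addrC sgnB//; lia.
  + by rewrite sgnD//; lia.
  + by rewrite sgnD//; lia.
- rewrite (hG (m - _)%N); last by lia.
  case: cases => [[-> ->]|[-> -> c]|[-> -> c]|[-> -> c]] /=; rewrite ?mulN1r ?mul1r.
  + by rewrite sgnD//; lia.
  + by rewrite sgnD//; lia.
  + by rewrite sgnD//; lia.
  + by rewrite sgnD//; lia.
Qed.
End Signs.

(** * The folded function on the cells *)

Section NullSets.
Context {R : realType}.
Implicit Types (x y : R) (p q f : R -> R[i]) (m n : nat).
Local Notation mu := (@lebesgue_measure R).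

Lemma ae_affine (A : R -> Prop) c (s : R) : (s = 1) \/ (s = -1) ->
  (\forall x \ae mu, A x) -> \forall y \ae mu, A (c + s * y).
Proof.
move=> s1 [N [mN N0 AN]].
exists ((fun y : R => c + s * y) @^-1` N); split.
- by have := @affine_measurable R c s measurableT N mN; rewrite setTI.
- by rewrite -N0; exact: (affine_measure c s1 mN).
- by move=> y /= hy; apply: AN.
Qed.

Lemma ae_neq c : \forall y \ae mu, y != c :> R.
Proof.
exists [set c]; split=> //; first by rewrite lebesgue_measure_set1.
by move=> y /= /negP; rewrite negbK => /eqP.
Qed.

Lemma L1class_eq (c : R) f q : (\forall x \ae mu, `]0, c[%classic x -> f x = q x) ->
  L1class c f = L1class c q.
Proof.
move=> fq; apply/seteqP; split=> h [ih fh]; split=> //;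
  apply: (@filterS2 _ _ (ae_filter_ringOfSetsType mu) _ _ _ _ fq fh) => x e1 e2 hx.
  by rewrite -e1// e2.
by rewrite e1// e2.
Qed.

End NullSets.

Section Cells.
Context {R : realType}.
Variables (a : R) (alpha beta j k : nat).
Hypotheses (a_def : a = j%:R / k%:R) (a_bounds : 0 < a <= 1 / 2%:R).
Implicit Types (x y : R) (p q f : R -> R[i]) (m n : nat).

Local Notation mu := (@lebesgue_measure R).
Local Notation b := (1 / k%:R : R).

Lemma k_gt0 : (0 < k)%N.
Proof.
by rewrite lt0n; apply/eqP => k0; have := a_bounds; rewrite a_def k0 invr0 mulr0 ltxx.
Qed.

Let kR : 0 < k%:R :> R. Proof. by rewrite ltr0n k_gt0. Qed.

Lemma j_gt0 : (0 < j)%N.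
Proof.
by rewrite lt0n; apply/eqP => j0; have := a_bounds; rewrite a_def j0 mul0r ltxx.
Qed.

Lemma j_half : (2 * j <= k)%N.
Proof.
have /andP[_] := a_bounds.
by rewrite a_def ler_pdivrMr// mulrAC mul1r ler_pdivlMr// -natrM ler_nat mulnC.
Qed.

Lemma b_gt0 : 0 < b. Proof. by rewrite divr_gt0. Qed.

Lemma mul_kb : k%:R * b = 1. Proof. by rewrite mulrC divfK// gt_eqF. Qed.

Lemma a_jb : a = j%:R * b. Proof. by rewrite a_def mul1r. Qed.

Lemma nodeE n : node k n = 1 - n%:R * b :> R.
Proof. by rewrite /node mulrBl mul_kb. Qed.

(** The abscissae are measured from the left or the right end of a cell. *)
Definition side (c : bool) x := if c then b - x else x.

Lemma sideN c x : side (~~ c) x = b - side c x.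
Proof. by case: c; rewrite /side //= opprB addrC subrK. Qed.

Lemma side_itv c x : 0 < x < b -> 0 < side c x < b.
Proof. by have := b_gt0; rewrite /side; case: c => // b0 h; lra. Qed.

Definition cell m x := m%:R * b + side (odd m) x.

(** The components of [Rop j k p], indexed by natural numbers. *)
Definition piece p n x := p (1 - n%:R * b - side (odd (j + n)) x).

Lemma Rop_piece p (i : 'I_k) x : Rop j k p i x = piece p i x.
Proof.
rewrite /Rop /piece /side !nodeE addnS /= subn1 /= -natr1.
by case: (odd _) => /=; congr p; ring.
Qed.

Lemma nat_lt_mulb m n : (m < n)%N -> m%:R * b + b <= n%:R * b.
Proof.
by move=> mn; rewrite -{2}[b]mul1r -mulrDl natr1 ler_wpM2r ?ler_nat// ltW// b_gt0.
Qed.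

Lemma ext0_out p y : (y <= 0) || (1 <= y) -> ext0 `]0, 1[ p y = 0.
Proof.
move=> h; rewrite /ext0 ifF//; apply/negP; rewrite inE /= in_oo => /andP[y0 y1].
by move: h; rewrite !leNgt y0 y1.
Qed.

Lemma ext0_piece p n x : 0 < x < b -> (n < k)%N ->
  ext0 `]0, 1[ p (1 - n%:R * b - side (odd (j + n)) x) = piece p n x.
Proof.
move=> xb /nat_lt_mulb; have := b_gt0; have := mul_kb.
have := side_itv (odd (j + n)) xb; rewrite /piece.
have : 0 <= n%:R * b by rewrite mulr_ge0// ltW// b_gt0.
rewrite /ext0 => n0 /andP[s0 s1] k1 b0 nk; rewrite ifT// inE /= in_oo.
by apply/andP; split; lra.
Qed.

(** The reflections and translations in the folded potential map a cell to a cell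
    or out of ]0,1[. The orientation of [side] alternates with the number of the
    cell, so that all the values are taken at the same abscissa x. *)
Lemma folded_cell p m x : 0 < x < b -> (m < k)%N ->
  folded a alpha beta p (cell m x) = mirror j k (eps alpha) (eps beta) (piece p ^~ x) m.
Proof.
move=> xb mk; have jk := j_half; have jp := j_gt0.
have s0 := side_itv (odd m) xb.
have b0 := b_gt0; have kb := mul_kb.
have m0 : 0 <= m%:R * b by rewrite mulr_ge0// ltW.
have jkb : 2 * (j%:R * b) <= 1.
  by rewrite -[leRHS]kb mulrA -natrM ler_wpM2r ?ler_nat// ltW.
have mkb := nat_lt_mulb mk.
rewrite /folded /mirror a_jb; set y := cell m x.
have yE : y = m%:R * b + side (odd m) x by [].
have at_piece n z : (n < k)%N -> z = 1 - n%:R * b - side (odd (j + n)) x ->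
    ext0 `]0, 1[ p z = piece p n x.
  by move=> nk ->; apply: ext0_piece.
have out z : (z <= 0) || (1 <= z) -> ext0 `]0, 1[ p z = 0 by apply: ext0_out.
have side_eq n : odd (j + n) = odd m -> side (odd (j + n)) x = side (odd m) x by move=> ->.
have side_neg n : odd (j + n) = ~~ odd m -> side (odd (j + n)) x = b - side (odd m) x.
  by move=> ->; rewrite sideN.
have castB (s t u : nat) : (s + t = u)%N -> (s%:R : R) = u%:R - t%:R.
  by move=> <-; rewrite natrD addrK.
have [c1|c1] := ltnP m j; [|have [c2|c2] := ltnP m (k - j)].
- have h := nat_lt_mulb c1.
  rewrite (at_piece (j + m)%N); last 2 first.
  + by clear -jk mk c1; lia.
  + rewrite side_eq ?natrD ?yE; last by clear; lia.
    by ring.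
  rewrite (at_piece (j.-1 - m)%N); last 2 first.
  + by clear -jk mk c1; lia.
  + rewrite side_neg; last by clear -c1; lia.
    rewrite (castB (j.-1 - m)%N m.+1 j) ?yE; first by rewrite -[m.+1%:R]natr1; ring.
    by clear -c1; lia.
  by rewrite (out (_ + 1 * _)) ?(out (_ + -1 * _)) ?addr0//; apply/orP; [right|left]; lra.
- have jk' : (j <= k)%N by clear -jk; lia.
  have jm : (j <= m)%N by [].
  have h := nat_lt_mulb c2; rewrite natrB ?mulrBl ?kb// in h.
  have h' : j%:R * b <= m%:R * b by rewrite ler_wpM2r ?ler_nat// ltW.
  rewrite (at_piece (j + m)%N); last 2 first.
  + by clear -c2; lia.
  + rewrite side_eq ?natrD ?yE; last by clear; lia.
    by ring.
  rewrite (out (1 - _ + 1 * _)); last by apply/orP; right; lra.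
  rewrite (out (_ - 1 + 1 * _)); last by apply/orP; left; lra.
  rewrite (at_piece (m - j)%N); last 2 first.
  + by clear -mk; lia.
  + rewrite side_eq ?yE ?(natrB _ jm); last by clear -jm; lia.
    by ring.
  by rewrite mulr0 !addr0.
- have jk' : (j <= k)%N by clear -jk; lia.
  have jm : (j <= m)%N by clear -c1; lia.
  have h' : (k - j)%:R * b <= m%:R * b by rewrite ler_wpM2r ?ler_nat// ltW.
  rewrite natrB ?mulrBl ?kb// in h'.
  rewrite (out (1 - _ + 1 * _)); last by apply/orP; right; lra.
  rewrite (out (1 - _ + -1 * _)); last by apply/orP; left; lra.
  rewrite (at_piece ((2 * k).-1 - j - m)%N); last 2 first.
  + by clear -jk jp mk c2; lia.
  + rewrite side_neg ?yE; last by clear -jk jp mk; lia.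
    rewrite (castB ((2 * k).-1 - j - m)%N (j + m).+1 (2 * k)%N); last by clear -jk jp mk; lia.
    by rewrite natrM -[(j + m).+1%:R]natr1 natrD; have := kb; lra.
  rewrite (at_piece (m - j)%N); last 2 first.
  + by clear -mk; lia.
  + rewrite side_eq ?yE ?(natrB _ jm); last by clear -jm; lia.
    by ring.
  by rewrite !mulr0 !add0r.
Qed.
Let kp : (0 < k)%N. Proof. exact: k_gt0. Qed.

Lemma side_affine (c : bool) : exists2 s : R, (s = 1) \/ (s = -1) &
  exists e, forall x, side c x = e + s * x.
Proof.
rewrite /side; case: c; [exists (-1)|exists 1]; rewrite ?eqxx; try by [left|right].
  by exists b => x; ring.
by exists 0 => x; ring.
Qed.

Lemma ae_interior : \forall y \ae mu, `]0, 1[%classic y ->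
  exists2 m : 'I_k, True & m%:R * b < y < m%:R * b + b.
Proof.
have h : \forall y \ae mu, forall m : 'I_k, y != m%:R * b :> R.
  by apply: (@filter_forall _ _ _ _ (ae_filter_ringOfSetsType mu)) => m; exact: ae_neq.
apply: (@filterS _ _ (ae_filter_ringOfSetsType mu)) h => y hy.
rewrite /= in_oo => /andP[y0 y1].
have k0 : 0 < k%:R :> R by rewrite ltr0n.
have yk0 : 0 <= y * k%:R by rewrite mulr_ge0 ?ltW.
have /andP[h1 h2] := truncn_itv yk0.
have mk : (Num.truncn (y * k%:R) < k)%N.
  by rewrite -(ltr_nat R) (le_lt_trans h1)// -[ltRHS]mul1r ltr_pM2r.
exists (Ordinal mk) => //=; apply/andP; split.
  by rewrite lt_neqAle eq_sym (hy (Ordinal mk))/= mulrA mulr1 ler_pdivrMr.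
by rewrite -[X in _ + X]mul1r -mulrDl natr1 mulrA mulr1 ltr_pdivlMr.
Qed.


Lemma cell_affine m : exists2 s : R, (s = 1) \/ (s = -1) &
  exists e, forall x, cell m x = e + s * x.
Proof.
have [s s1 [e h]] := side_affine (odd m); exists s => //.
by exists (m%:R * b + e) => x; rewrite /cell h addrA.
Qed.

Lemma sideK c x : side c (side c x) = x.
Proof. by case: c; rewrite /side // opprB addrCA subrr addr0. Qed.

Lemma cell_itv m x : (m < k)%N -> 0 < x < b -> 0 < cell m x < 1.
Proof.
move=> /nat_lt_mulb; rewrite mul_kb => mb xb.
have := side_itv (odd m) xb; rewrite /cell.
have : 0 <= m%:R * b by rewrite mulr_ge0// ltW// b_gt0.
by move=> ? /andP[? ?]; apply/andP; split; lra.
Qed.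

Lemma folded_cells p : (\forall y \ae mu, `]0, 1[%classic y -> folded a alpha beta p y = 0) ->
  \forall x \ae mu, `]0, b[%classic x -> forall m, (m < k)%N ->
    mirror j k (eps alpha) (eps beta) (piece p ^~ x) m = 0.
Proof.
move=> h.
suff H : \forall x \ae mu, forall m : 'I_k, `]0, b[%classic x ->
    mirror j k (eps alpha) (eps beta) (piece p ^~ x) m = 0.
  apply: (@filterS _ _ (ae_filter_ringOfSetsType mu)) H => x H xb m mk.
  exact: (H (Ordinal mk)).
apply: (@filter_forall _ _ _ _ (ae_filter_ringOfSetsType mu)) => m.
have [s s1 [e he]] := cell_affine m.
apply: (@filterS _ _ (ae_filter_ringOfSetsType mu)) (ae_affine e s1 h) => x.
rewrite -he /= !in_oo => hx xb.
by rewrite -folded_cell//; apply: hx; apply: cell_itv.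
Qed.

Lemma cells_folded p : (forall x, 0 < x < b -> forall m, (m < k)%N ->
    mirror j k (eps alpha) (eps beta) (piece p ^~ x) m = 0) ->
  \forall y \ae mu, `]0, 1[%classic y -> folded a alpha beta p y = 0.
Proof.
move=> h; apply: (@filterS _ _ (ae_filter_ringOfSetsType mu)) ae_interior => y hy.
move=> /hy[m _ my].
have xb : 0 < side (odd m) (y - m%:R * b) < b.
  by apply: side_itv; lra.
have -> : y = cell m (side (odd m) (y - m%:R * b)).
  by rewrite /cell sideK addrC subrK.
by rewrite folded_cell// h.
Qed.


End Cells.

(** * The isospectral set *)
Section Conclusion.
Context {R : realType}.
Variables (a : R) (alpha beta j k : nat).
Hypotheses (a_def : a = j%:R / k%:R) (a_bounds : 0 < a <= 1 / 2%:R).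
Implicit Types (x y : R) (p q f : R -> R[i]) (m n : nat).

Local Notation mu := (@lebesgue_measure R).
Local Notation b := (1 / k%:R : R).

(** The abscissa in ]0,b[ of a point y of the n-th cell from the right. *)
Definition coord n y : R := if odd (j + n.+1) then node k n - y else y - node k n.+1.

Lemma nodeS n : node k n = node k n.+1 + b :> R.
Proof.
by rewrite /node -natr1; ring.
Qed.

Lemma coord_itv n y : (node k n.+1 < y < node k n) = (0 < coord n y < b).
Proof.
rewrite /coord [node k n]nodeS; move: (node _ _) => u.
by case: (odd _); apply/idP/idP => /andP[h1 h2]; apply/andP; split; lra.
Qed.

Lemma coord_affine n : exists2 s : R, (s = 1) \/ (s = -1) &
  exists e, forall y, coord n y = e + s * y.
Proof.
rewrite /coord; case: (odd _); [exists (-1)|exists 1]; try by [left|right].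
  by exists (node k n) => y; ring.
by exists (- node k n.+1) => y; ring.
Qed.

Lemma RinvE (F : 'I_k -> R -> R[i]) y :
  Rinv j F y = \sum_(i < k) ext0 `]0, b[ (F i) (coord i y).
Proof.
rewrite /Rinv; apply: eq_bigr => i _; rewrite subn1 /= coord_itv /ext0.
have -> : (coord i y \in (`]0, b[%classic : set R)) = (0 < coord i y < b).
  by apply/idP/idP; rewrite inE /= in_oo.
by rewrite /coord; case: (odd _).
Qed.

Lemma piece_L1 p : L1 1 p -> L1 b (piece j k p 0).
Proof.
move=> /(cintegrable_ext0 _ (measurable_itv _)) ip.
have [s s1 [e he]] := @side_affine R k (odd (j + 0)).
have s1' : - s = 1 \/ - s = -1 by case: s1 => ->; rewrite ?opprK; [right|left].
have [i1 _] := cintegral_affine (1 - 0%:R * b - e) s1' ip.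
have := cintegrableS measurableT (measurable_itv _) (@subsetT _ `]0, b[%classic) i1.
apply: eq_cintegrable => // x; rewrite /= in_oo => xb.
rewrite -(ext0_piece a_def a_bounds)//; last exact: k_gt0 a_def a_bounds.
by rewrite he; congr ext0; ring.
Qed.

Lemma Rinv_L1 f : L1 b f -> L1 1 (Rinv j (Xmul k alpha beta f)).
Proof.
move=> /(cintegrable_ext0 _ (measurable_itv _)) jf.
pose F n y := xsign alpha beta n.+1 * ext0 `]0, b[ f (coord n y) : R[i].
have iF n : cintegrable `]0, 1[ (F n).
  apply: cintegrableZ => //; have [s s1 [e he]] := coord_affine n.
  have [i1 _] := cintegral_affine e s1 jf.
  have := cintegrableS measurableT (measurable_itv _) (@subsetT _ `]0, 1[%classic) i1.
  by apply: eq_cintegrable => // y _; rewrite he.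
apply: eq_cintegrable (cintegrable_sum k (measurable_itv _) iF) => // y _.
rewrite RinvE; apply: eq_bigr => i _; rewrite /F /ext0 /Xmul.
by case: ifP => // _; rewrite mulr0.
Qed.

Lemma piece_Rinv f n x : 0 < x < b -> (n < k)%N ->
  piece j k (Rinv j (Xmul k alpha beta f)) n x = xsign alpha beta n.+1 * f x.
Proof.
move=> xb nk; have := Rop_piece a_def a_bounds (Rinv j (Xmul k alpha beta f)) (Ordinal nk) x.
by rewrite RopK//.
Qed.

Lemma in_block y : (exists2 m : 'I_k, True & m%:R * b < y < m%:R * b + b) ->
  exists i : 'I_k, node k i.+1 < y < node k i.
Proof.
move=> [m _ my]; exists (rev_ord m); rewrite [node k (rev_ord m)]nodeS.
have e : node k (rev_ord m).+1 = m%:R * b :> R.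
  rewrite /node /= -natrB; last by clear; case: m => m /=; lia.
  by congr (_%:R * _); case: m {my} => m /=; clear -m; lia.
by rewrite e.
Qed.

(** The relations hold at almost every abscissa x, where they force the values on
    the k cells to be those of the pattern of signs. *)
Lemma ae_pattern p : coprime j k -> [\/ alpha = 0%N /\ beta = 0%N,
                 [/\ alpha = 0%N, beta = 1%N & ~~ odd j],
                 [/\ alpha = 1%N, beta = 0%N & ~~ odd (k + j)] |
                 [/\ alpha = 1%N, beta = 1%N & ~~ odd k]] ->
  (\forall y \ae mu, `]0, 1[%classic y -> folded a alpha beta p y = 0) ->
  \forall y \ae mu, `]0, 1[%classic y -> p y = Rinv j (Xmul k alpha beta (piece j k p 0)) y.
Proof.
move=> cop cases /(folded_cells a_def a_bounds) h.
have h1 : \forall y \ae mu, forall i : 'I_k, `]0, b[%classic (coord i y) ->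
    forall m, (m < k)%N -> mirror j k (eps alpha) (eps beta) (piece j k p ^~ (coord i y)) m = 0.
  apply: (@filter_forall _ _ _ _ (ae_filter_ringOfSetsType mu)) => i.
  have [s s1 [e he]] := coord_affine i.
  apply: (@filterS _ _ (ae_filter_ringOfSetsType mu)) (ae_affine e s1 h) => y.
  by rewrite -he.
apply: (@filterS2 _ _ (ae_filter_ringOfSetsType mu) _ _ _ _ h1 (ae_interior a_def a_bounds)).
move=> y hy int /int /in_block[i yi].
rewrite -(RinvK j p yi) !RinvE; apply: eq_bigr => n _; rewrite /ext0; case: ifP => //.
rewrite inE => /(hy n) hm; rewrite (Rop_piece a_def a_bounds) /Xmul.
exact: (mirror_xsign (j_gt0 a_def a_bounds) (j_half a_def a_bounds) cop cases hm).
Qed.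

End Conclusion.

Theorem mainTheorem4 (R : realType) (alpha beta j k : nat)
    (a : R) (a_def : a = j%:R / k%:R) (jk_coprime : coprime j k)
    (a_bounds : 0 < a <= 1 / 2%:R)
    (b : R) (b_def : b = 1 / k%:R)
    (cases : [\/ alpha = 0%N /\ beta = 0%N,
                 [/\ alpha = 0%N, beta = 1%N & ~~ odd j],
                 [/\ alpha = 1%N, beta = 0%N & ~~ odd (k + j)] |
                 [/\ alpha = 1%N, beta = 1%N & ~~ odd k]])
    (q0 : R -> R[i]) (q0_L1 : L1 1 q0)
    (Lambda : set (R[i] * nat))
    (Lambda_def : Lambda = spectrum q0 a alpha beta) :
  [set L1class 1 q | q in isospectral a alpha beta Lambda] =
  [set L1class 1 (fun x => q0 x + Rinv j (Xmul k alpha beta f) x) |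
     f in L1 b].
Proof.
have [al bl] : (alpha <= 1)%N /\ (beta <= 1)%N by case: cases => [[-> ->]|[-> ->]|[-> ->]|[-> ->]].
have a01 : 0 < a < 1 by lra.
subst b; apply/seteqP; split=> A.
- move=> [q [iq]]; rewrite Lambda_def => sq <-.
  have ip := L1B iq q0_L1.
  have hp := spectrum_folded erefl al bl a01 iq q0_L1 sq.
  exists (piece j k (fun t => q t - q0 t) 0); first exact: piece_L1 a_def a_bounds _ ip.
  apply: L1class_eq; have := ae_pattern a_def a_bounds jk_coprime cases hp.
  apply: (@filterS _ _ (ae_filter_ringOfSetsType lebesgue_measure)) => y h /h <-.
  by rewrite addrC subrK.
- move=> [f jf <-]; set r := Rinv j (Xmul k alpha beta f).
  have ir : L1 1 r := Rinv_L1 alpha beta j jf.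
  exists (fun x => q0 x + r x) => //.
  have iq : L1 1 (fun x => q0 x + r x) by apply: cintegrableD.
  split=> //; rewrite Lambda_def; apply: (folded_spectrum erefl al bl a01 iq q0_L1).
  have -> : (fun t => q0 t + r t - q0 t) = r by apply/funext => t; rewrite addrC addKr.
  apply: (cells_folded a_def a_bounds) => x xb; apply: xsign_mirror => //.
  + exact: j_gt0 a_def a_bounds.
  + exact: j_half a_def a_bounds.
  + have kp := k_gt0 a_def a_bounds; move=> n nk.
    rewrite !(piece_Rinv _ _ a_def a_bounds)//; congr (_ * _).
    by case: cases => [[-> ->]|[-> ->]|[-> ->]|[-> ->]] /=; rewrite expr0 mul1r.
Qed.
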